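(* Let $\Omega(\mathbb C_q[GL_2])$ be the 4D strongly bicovariant exterior algebra on $\mathbb C_q[GL_2]$ with relations $(\mathrm d\mathbf t_1)\mathbf t_2=R_{21}\mathbf t_2\,\mathrm d\mathbf t_1R$, $\mathrm d\mathbf t_1\,\mathrm d\mathbf t_2=-R_{21}\,\mathrm d\mathbf t_2\,\mathrm d\mathbf t_1R$. It is the universal strongly bicovariant exterior algebra on $\mathbb C_q[GL_2]$ such that (1) the canonical right coaction $\Delta_Rx_i=\sum_jx_j\otimes t^j{}_i$ of $\mathbb C_q[GL_2]$ on $\mathbb C_q^2$ is differentiable; (2) the determinant inclusion $\mathbb C_q[GL_1]=\mathbb C[D,D^{-1}]\hookrightarrow\mathbb C_q[GL_2]$ is differentiable. Here universal means that only the conditions stated are used to derive the relations, i.e. all its relations follow from requiring (1) and (2); there could be quotients of it with the same two properties.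
   Context: $q\in\mathbb C$ is a nonzero parameter. $\mathbb C_q[GL_2]$ is the Hopf algebra generated by $t^1{}_1=a,\ t^1{}_2=b,\ t^2{}_1=c,\ t^2{}_2=d$ and $D^{-1}$ with $ba=qab$, $ca=qac$, $db=qbd$, $dc=qcd$, $cb=bc$, $da-ad=(q-q^{-1})bc$, where $D=ad-q^{-1}bc=da-qcb$ is central, grouplike and inverted, and $\Delta t^i{}_j=\sum_kt^i{}_k\otimes t^k{}_j$. The differential is written $\mathrm d$, to distinguish it from the generator $d$. $R=(R^i{}_j{}^k{}_l)$ has nonzero entries $R^1{}_1{}^1{}_1=R^2{}_2{}^2{}_2=q$, $R^1{}_1{}^2{}_2=R^2{}_2{}^1{}_1=1$, $R^1{}_2{}^2{}_1=q-q^{-1}$; $R_{21}$ is $R$ with its two tensor factors swapped, and $\mathbf t_1=\mathbf t\otimes\mathrm{id}$, $\mathbf t_2=\mathrm{id}\otimes\mathbf t$ for the matrix $\mathbf t=(t^i{}_j)$. In components the calculus has (summing repeated indices) $(\mathrm dt^i{}_j)t^k{}_l=R^k{}_{p}{}^i{}_{r}\,t^p{}_n(\mathrm dt^r{}_m)R^m{}_j{}^n{}_l$ and $\mathrm dt^i{}_j\,\mathrm dt^k{}_l=-R^k{}_{p}{}^i{}_{r}\,\mathrm dt^p{}_n\,\mathrm dt^r{}_mR^m{}_j{}^n{}_l$, with implied relations for $D^{-1}$ via $\mathrm dD^{-1}=-D^{-1}(\mathrm dD)D^{-1}$, and $\Delta_*\mathrm dt^i{}_j=\mathrm dt^i{}_k\otimes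 t^k{}_j+t^i{}_k\otimes \mathrm dt^k{}_j$. The quantum plane $\mathbb C_q^2$ has generators $x_1,x_2$ with $x_2x_1=qx_1x_2$ and exterior algebra $\Omega(\mathbb C_q^2)$ with $(\mathrm dx_i)x_i=q^2x_i\mathrm dx_i$, $(\mathrm dx_1)x_2=qx_2\mathrm dx_1$, $(\mathrm dx_2)x_1=qx_1\mathrm dx_2+(q^2-1)x_2\mathrm dx_1$, $(\mathrm dx_i)^2=0$, $\mathrm dx_2\mathrm dx_1=-q^{-1}\mathrm dx_1\mathrm dx_2$. $\mathbb C_q[GL_1]=\mathbb C[D,D^{-1}]$ ($\Delta D=D\otimes D$), included in $\mathbb C_q[GL_2]$ by sending $D$ to the $q$-determinant, has the exterior algebra with $(\mathrm dD)D=q^2D\,\mathrm dD$, $(\mathrm dD)^2=0$. An exterior algebra on an algebra $A$ is a differential graded algebra (DGA) $\Omega(A)=\oplus_{n\ge0}\Omega^n(A)$ with $\Omega^0=A$, generated by $A$ and $\Omega^1=\mathrm{span}\{a\,\mathrm db\}$, with $\mathrm d^2=0$ and graded Leibniz rule. The super tensor product $\underline\otimes$ has product $(a\otimes b)(c\otimes e)=(-1)^{|b||c|}ac\otimes be$ and differential $\mathrm d\otimes\mathrm{id}+(-1)^{|\ |}\mathrm{id}\otimes \mathrm d$. For a Hopf algebra, $\Omega(A)$ is strongly bicovariant if it is a super-Hopf algebra (grade = form degree mod 2) with coproduct $\Delta_*$ preserving total degree, restricting to $\Delta$ on $A$, and $\Delta_*\mathrm d=(\mathrm d\otimes\mathrm{id}+(-1)^{|\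 |}\mathrm{id}\otimes \mathrm d)\Delta_*$. An algebra map between algebras with exterior algebras is differentiable if it extends to a map of DGAs; a coaction $B\to B\otimes A$ (making $B$ a comodule algebra) is differentiable if it extends to a degree-preserving DGA map $\Omega(B)\to\Omega(B)\underline\otimes\Omega(A)$.
   Formalization: Besides q ≠ 0, the theorem assumes q² ≠ −1: for q² = −1 the stated relations do not force (da)² = 0, while extending the coaction to (dx₁)² = 0 requires it, so condition (1) fails for Ω. *)

(* Defs.v *)
From HB Require Import structures.
From mathcomp Require Import all_boot all_order all_algebra generic_quotient.
From mathcomp Require Import boolp classical_sets.

Set Implicit Arguments.
Unset Strict Implicit.
Unset Printing Implicit Defensive.

Import GRing.Theory.
Local Open Scope ring_scope.
Local Open Scope quotient_scope.

(* The grading is given by the projections [gr n] onto the components of       *)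
(* degree n; [gr n x = x] says that x is homogeneous of degree n.              *)
HB.mixin Record isGraded (K : fieldType) A of GRing.Algebra K A := {
  gr : nat -> A -> A;
  gr_linear : forall n, linear (gr n);
  gr_gr : forall m n x, gr m (gr n x) = if m == n then gr n x else 0;
  gr_total : forall x, exists N, x = \sum_(n < N) gr n x;
  gr_one : gr 0 1 = 1;
  gr_mul : forall m n x y,
    gr m x = x -> gr n y = y -> gr (m + n)%N (x * y) = x * y }.

#[short(type="gralgType")]
HB.structure Definition GradedAlgebra (K : fieldType) :=
  { A of GRing.Algebra K A & isGraded K A }.

Section Graded.
Variables (K : fieldType) (A : gralgType K).
Implicit Types (x y : A) (m n N : nat).

Lemma gr_add n : {morph @gr K A n : x y / x + y}.
Proof. by move=> x y; have := gr_linear n 1 x y; rewrite !scale1r. Qed.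

Lemma gr_0 n : gr n (0 : A) = 0.
Proof. by apply: (addrI (gr n 0)); rewrite -gr_add !addr0. Qed.

Lemma gr_scale n k x : gr n (k *: x) = k *: gr n x.
Proof. by have := gr_linear n k x 0; rewrite gr_0 !addr0. Qed.

Lemma gr_sum n I (s : seq I) P (F : I -> A) :
  gr n (\sum_(i <- s | P i) F i) = \sum_(i <- s | P i) gr n (F i).
Proof. by elim/big_rec2: _ => [|i y1 y2 _ <-]; rewrite ?gr_0 ?gr_add. Qed.

Definition gr_bound x : nat := projT1 (cid (gr_total x)).

Lemma gr_boundE x : x = \sum_(n < gr_bound x) gr n x.
Proof. exact: projT2 (cid (gr_total x)). Qed.

Lemma gr_out x n : (gr_bound x <= n)%N -> gr n x = 0.
Proof.
move=> le; rewrite {1}(gr_boundE x) gr_sum big1 // => i _.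
by rewrite gr_gr gtn_eqF // (leq_trans (ltn_ord i)).
Qed.

(* The sum over all degrees n of F n (x_n), where x_n is the component of x;   *)
(* the sum is finite when F n 0 = 0.                                           *)
Definition gr_fold (W : nmodType) (F : nat -> A -> W) x : W :=
  \sum_(n < gr_bound x) F n (gr n x).

Lemma gr_fold_wide (W : nmodType) (F : nat -> A -> W) x N :
  (forall n, F n 0 = 0) -> (forall n, (N <= n)%N -> gr n x = 0) ->
  gr_fold F x = \sum_(n < N) F n (gr n x).
Proof.
move=> F0 H.
have wid M M' : (M <= M')%N -> (forall n, (M <= n)%N -> gr n x = 0) ->
    \sum_(n < M') F n (gr n x) = \sum_(n < M) F n (gr n x).
  move=> le HM; rewrite (big_ord_widen _ (fun n => F n (gr n x)) le).
  rewrite [LHS](bigID (fun i : 'I_M' => (i < M)%N)) /= [X in _ + X]big1 ?addr0 //.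
  by move=> i; rewrite -leqNgt => /HM ->.
rewrite /gr_fold; case: (leqP (gr_bound x) N) => [le|/ltnW le].
  by rewrite (wid _ _ le) // => n; apply: gr_out.
by rewrite (wid _ _ le).
Qed.

Lemma gr_fold_homog (W : nmodType) (F : nat -> A -> W) n x :
  (forall n, F n 0 = 0) -> gr n x = x -> gr_fold F x = F n x.
Proof.
move=> F0 hx; rewrite (@gr_fold_wide _ _ _ n.+1) //; last first.
  by move=> m lt; rewrite -hx gr_gr gtn_eqF.
rewrite big_ord_recr /= hx big1 ?add0r // => i _.
by rewrite -hx gr_gr ltn_eqF.
Qed.

Lemma gr_fold_linear (W : lmodType K) (F : nat -> A -> W) :
  (forall n, linear (F n)) -> linear (gr_fold F).
Proof.
move=> Fl k x y.
have F0 n : F n 0 = 0.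
  by apply: (addrI (F n 0)); have := Fl n 1 0 0; rewrite !scale1r !addr0 => <-.
pose N := maxn (gr_bound x) (gr_bound y).
have Hx n : (N <= n)%N -> gr n x = 0.
  by rewrite geq_max => /andP[? _]; apply: gr_out.
have Hy n : (N <= n)%N -> gr n y = 0.
  by rewrite geq_max => /andP[_ ?]; apply: gr_out.
have Hxy n : (N <= n)%N -> gr n (k *: x + y) = 0.
  by move=> le; rewrite gr_linear Hx // Hy // scaler0 addr0.
rewrite !(@gr_fold_wide _ _ _ N) //.
rewrite scaler_sumr -big_split /=; apply: eq_bigr => i _.
by rewrite gr_linear Fl.
Qed.

(* The parity involution, (-1)^n on degree n *)
Definition sgn : A -> A := gr_fold (fun n x => (-1) ^+ n *: x).

Lemma sgn_linear : linear sgn.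
Proof.
apply: gr_fold_linear => n k x y.
by rewrite scalerDr !scalerA mulrC.
Qed.

Lemma sgn_homog n x : gr n x = x -> sgn x = (-1) ^+ n *: x.
Proof. by apply: gr_fold_homog => m; rewrite scaler0. Qed.

Lemma gr_ind (P : A -> Prop) :
  (forall x y, P x -> P y -> P (x + y)) ->
  (forall n x, gr n x = x -> P x) -> forall x, P x.
Proof.
move=> PD Ph x; rewrite (gr_boundE x); apply: big_ind => //.
  by apply: (Ph 0%N); rewrite gr_0.
by move=> i _; apply: (Ph i); rewrite gr_gr eqxx.
Qed.

End Graded.
Arguments sgn {K A}.

HB.mixin Record isDGA (K : fieldType) A of GradedAlgebra K A := {
  dif : A -> A;
  dif_linear : linear dif;
  gr0_dif : forall x, gr 0 (dif x) = 0;
  grS_dif : forall n x, gr n.+1 (dif x) = dif (gr n x);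
  dif_dif : forall x, dif (dif x) = 0;
  dif_mul : forall x y, dif (x * y) = dif x * y + sgn x * dif y }.

#[short(type="dgaType")]
HB.structure Definition DGA (K : fieldType) :=
  { A of GradedAlgebra K A & isDGA K A }.

Definition alg_map (K : fieldType) (A B : algType K) (f : A -> B) : Prop :=
  [/\ linear f, f 1 = 1 & {morph f : x y / x * y}].

Definition dga_map (K : fieldType) (A B : dgaType K) (f : A -> B) : Prop :=
  [/\ alg_map f, forall n x, f (gr n x) = gr n (f x)
    & forall x, f (dif x) = dif (f x)].

Section Linear.
Variables (K : fieldType) (U V : lmodType K) (f : U -> V).
Hypothesis fl : linear f.

Lemma linD x y : f (x + y) = f x + f y.
Proof. by have := fl 1 x y; rewrite !scale1r. Qed.

Lemma lin0 : f 0 = 0.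
Proof. by apply: (addrI (f 0)); rewrite -linD !addr0. Qed.

Lemma linZ k x : f (k *: x) = k *: f x.
Proof. by have := fl k x 0; rewrite lin0 !addr0. Qed.

Lemma linN x : f (- x) = - f x.
Proof. by rewrite -!scaleN1r linZ. Qed.

Lemma lin_sum I (s : seq I) (P : pred I) F :
  f (\sum_(i <- s | P i) F i) = \sum_(i <- s | P i) f (F i).
Proof. by elim/big_rec2: _ => [|i y1 y2 _ <-]; rewrite ?lin0 ?linD. Qed.

End Linear.

Lemma linear_functional (K : fieldType) (V : lmodType K) (v : V) :
  v != 0 -> exists2 f : V -> K^o, linear f & f v = 1.
Proof.
move=> v0.
pose P (U : set V) := ~ U v /\ forall k x y, U x -> U y -> U (k *: x + y).
have [F FP Ftot|U [[Uv Ul] Umax]] := @Zorn_bigcup V P.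
  split=> [[X FX Xv]|k x y [X FX Xx] [Y FY Yy]]; first by case: (FP X FX).
  case: (Ftot X Y FX FY) => le.
    by exists Y => //; apply: (FP Y FY).2 => //; apply: le.
  by exists X => //; apply: (FP X FX).2 => //; apply: le.
have U0 : U 0.
  apply: contrapT => nU0.
  have noU x : ~ U x.
    by move=> Ux; apply: nU0; have := Ul (-1) _ _ Ux Ux; rewrite scaleN1r addNr.
  apply: (Umax [set 0]%classic).
    by split=> [x /noU//|H]; apply: (noU 0); apply: H.
  split=> [/= E|k x y /= -> ->]; last by rewrite scaler0 addr0.
  by rewrite E eqxx in v0.
have UD x y : U x -> U y -> U (x + y).
  by move=> Ux Uy; rewrite -[x]scale1r; apply: Ul.
have UZ k x : U x -> U (k *: x).
  by move=> Ux; rewrite -[_ *: _]addr0; apply: Ul.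
have UN x : U x -> U (- x) by rewrite -scaleN1r; apply: UZ.
have ex x : exists c : K, U (x - c *: v).
  have [Ux|nUx] := pselect (U x); first by exists 0; rewrite scale0r subr0.
  pose W := [set y | exists k : K, U (y - k *: x)]%classic.
  have UW : (U `<` W)%classic.
    split=> [y Uy|/(_ x)]; first by exists 0; rewrite scale0r subr0.
    by move=> H; apply: nUx; apply: H; exists 1; rewrite scale1r subrr.
  have [k Uk] : W v.
    apply: contrapT => nWv; apply: (Umax W UW); split=> // k y z [a Ha] [b Hb].
    exists (k * a + b).
    have -> : k *: y + z - (k * a + b) *: x = k *: (y - a *: x) + (z - b *: x).
      by rewrite scalerBr scalerDl -scalerA opprD addrACA.
    exact: Ul.
  have k0 : k != 0.
    by apply/negP => /eqP k0; apply: Uv; rewrite k0 scale0r subr0 in Uk.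
  exists k^-1.
  have -> : x - k^-1 *: v = - k^-1 *: (v - k *: x).
    by rewrite scalerBr !scaleNr opprK scalerA mulVf // scale1r addrC.
  exact: UZ.
have uniq x c c' : U (x - c *: v) -> U (x - c' *: v) -> c = c'.
  move=> Hc Hc'; apply/eqP; rewrite -subr_eq0; apply/negPn/negP => nz; apply: Uv.
  have -> : v = (c - c')^-1 *: ((x - c' *: v) - (x - c *: v)).
    by rewrite opprB [x - _ + _]addrC subrKA -scalerBl scalerA mulVf // scale1r.
  by apply: UZ; apply: UD => //; apply: UN.
pose f x : K^o := projT1 (cid (ex x)).
have fP x : U (x - f x *: v) := projT2 (cid (ex x)).
exists f => [k x y|].
  apply: (uniq (k *: x + y)) => //.
  have -> : k *: x + y - (k *: f x + f y : K^o) *: v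
          = k *: (x - f x *: v) + (y - f y *: v).
    by rewrite scalerDl -scalerA scalerBr opprD addrACA.
  exact: Ul.
by apply: (uniq v) => //; rewrite scale1r subrr.
Qed.

Section GradedTheory.
Variables (K : fieldType) (A : gralgType K).
Implicit Types x y : A.

Lemma gr_homog n x : gr n (gr n x) = gr n x.
Proof. by rewrite gr_gr eqxx. Qed.

Lemma sgn_mul x y : sgn (x * y) = sgn x * sgn y.
Proof.
have sl := @sgn_linear K A.
elim/gr_ind: x => [x x' hx hx'|m x hx].
  by rewrite mulrDl !(linD sl) mulrDl hx hx'.
elim/gr_ind: y => [y y' hy hy'|n y hy].
  by rewrite mulrDr !(linD sl) mulrDr hy hy'.
rewrite (sgn_homog hx) (sgn_homog hy) (sgn_homog (gr_mul _ _ _ _ hx hy)).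
by rewrite -scalerAl -scalerAr scalerA exprD.
Qed.

Lemma sgn_one : sgn (1 : A) = 1.
Proof. by rewrite (sgn_homog gr_one) expr0 scale1r. Qed.

Lemma gr_sgn n x : gr n (sgn x) = (-1) ^+ n *: gr n x.
Proof.
elim/gr_ind: x => [x y hx hy|m x hx].
  by rewrite (linD (@sgn_linear K A)) !gr_add hx hy scalerDr.
rewrite (sgn_homog hx) gr_scale -hx gr_gr.
by case: eqP => [->//|]; rewrite !scaler0.
Qed.

Lemma sgn_sgn x : sgn (sgn x) = x.
Proof.
elim/gr_ind: x => [x y hx hy|m x hx].
  by rewrite !(linD (@sgn_linear K A)) hx hy.
rewrite (sgn_homog hx) (linZ (@sgn_linear K A)) (sgn_homog hx) scalerA -exprD.
by rewrite addnn -mul2n exprM sqrrN expr1n expr1n scale1r.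
Qed.

End GradedTheory.

Section DGATheory.
Variables (K : fieldType) (A : dgaType K).

Lemma dif_homog n (x : A) : gr n x = x -> gr n.+1 (dif x) = dif x.
Proof. by move=> hx; rewrite grS_dif hx. Qed.

Lemma sgn_dif (x : A) : sgn (dif x) = - dif (sgn x).
Proof.
have sl := @sgn_linear K A; have dl := @dif_linear K A.
elim/gr_ind: x => [x y hx hy|m x hx].
  by rewrite (linD dl) !(linD sl) (linD dl) hx hy opprD.
rewrite (sgn_homog hx) (sgn_homog (dif_homog hx)) (linZ dl).
by rewrite exprS mulN1r scaleNr.
Qed.

End DGATheory.

Section Regular.
Variable K : fieldType.
Implicit Types x y : K^o.

Let rgr (n : nat) x : K^o := if n == 0%N then x else 0.

Lemma regular_gr_linear n : linear (rgr n).
Proof. by rewrite /rgr; case: eqP => // _ k x y; rewrite scaler0 addr0. Qed.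

Lemma regular_gr_gr m n x : rgr m (rgr n x) = if m == n then rgr n x else 0.
Proof. by case: m n => [|m] [|n] //=; rewrite /rgr /=; case: ifP. Qed.

Lemma regular_gr_total x : exists N, x = \sum_(n < N) rgr n x.
Proof. by exists 1%N; rewrite big_ord1. Qed.

Lemma regular_gr_mul m n x y :
  rgr m x = x -> rgr n y = y -> rgr (m + n)%N (x * y) = x * y.
Proof.
by case: m n => [|m] [|n] //= <- <-; rewrite /rgr /= ?mul0r ?mulr0.
Qed.

HB.instance Definition _ := isGraded.Build K K^o
  regular_gr_linear regular_gr_gr regular_gr_total (erefl _) regular_gr_mul.

Let rdif x : K^o := 0.

Lemma regular_dif_linear : linear rdif.
Proof. by move=> k x y; rewrite scaler0 addr0. Qed.

Lemma regular_gr0_dif x : gr 0 (rdif x) = 0. Proof. by []. Qed.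

Lemma regular_grS_dif n x : gr n.+1 (rdif x) = rdif (gr n x). Proof. by []. Qed.

Lemma regular_dif_mul x y : rdif (x * y) = rdif x * y + sgn x * rdif y.
Proof. by rewrite mul0r mulr0 addr0. Qed.

HB.instance Definition _ := isDGA.Build K K^o
  regular_dif_linear regular_gr0_dif regular_grS_dif (fun=> erefl) regular_dif_mul.

Lemma regular_dif x : dif x = 0. Proof. by []. Qed.

End Regular.

(* Generators and relations. [term K G] consists of the noncommutative         *)
(* polynomial expressions in the generators G.                                 *)
Inductive term (K G : Type) : Type :=
| Gen of G
| Cst of K
| Add of term K G & term K G
| Mul of term K G & term K G.
Arguments Gen {K G}.
Arguments Cst {K G}.
Arguments Add {K G}.
Arguments Mul {K G}.

HB.instance Definition _ (K G : Type) := gen_eqMixin (term K G).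
HB.instance Definition _ (K G : Type) := gen_choiceMixin (term K G).

Fixpoint eval (K : fieldType) (G : Type) (B : algType K) (h : G -> B)
    (t : term K G) : B :=
  match t with
  | Gen g => h g
  | Cst k => k%:A
  | Add s t => eval h s + eval h t
  | Mul s t => eval h s * eval h t
  end.

(* The algebra of terms modulo the identities valid in every member of the     *)
(* family h m : G -> V m; the member m0 ensures that 1 != 0.                   *)
Section ModelQuotient.
Variables (K : fieldType) (G M : Type) (V : M -> algType K).
Variables (h : forall m, G -> V m) (m0 : M).

Definition mq_eq (s t : term K G) : bool :=
  `[< forall m, eval (h m) s = eval (h m) t >].

Lemma mq_eqP s t :
  reflect (forall m, eval (h m) s = eval (h m) t) (mq_eq s t).
Proof. exact: asboolP. Qed.

Lemma mq_refl : reflexive mq_eq. Proof. by move=> s; apply/mq_eqP. Qed.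

Lemma mq_sym : symmetric mq_eq.
Proof. by move=> s t; apply/mq_eqP/mq_eqP. Qed.

Lemma mq_trans : transitive mq_eq.
Proof. by move=> s t u /mq_eqP H1 /mq_eqP H2; apply/mq_eqP => m; rewrite H1. Qed.

Definition mq_equiv := EquivRel mq_eq mq_refl mq_sym mq_trans.

Definition mquot of M := {eq_quot mq_equiv}.
Local Notation Q := (mquot m0).

HB.instance Definition _ := Choice.on Q.
HB.instance Definition _ := EqQuotient.on Q.

Definition mq_class (t : term K G) : Q := \pi_Q t.
Definition mq_ev m (x : Q) : V m := eval (h m) (repr x).

Lemma mq_ev_class m t : mq_ev m (mq_class t) = eval (h m) t.
Proof.
have /eqmodP/mq_eqP : repr (mq_class t) = t %[mod Q] by rewrite reprK.
exact.
Qed.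

Lemma mq_ext (x y : Q) : (forall m, mq_ev m x = mq_ev m y) -> x = y.
Proof.
by move=> H; rewrite -[x]reprK -[y]reprK; apply/eqmodP/mq_eqP => m; apply: H.
Qed.

Definition mq_zero : Q := mq_class (Cst 0).
Definition mq_one : Q := mq_class (Cst 1).
Definition mq_add (x y : Q) : Q := mq_class (Add (repr x) (repr y)).
Definition mq_mul (x y : Q) : Q := mq_class (Mul (repr x) (repr y)).
Definition mq_scale (k : K) (x : Q) : Q := mq_class (Mul (Cst k) (repr x)).
Definition mq_opp (x : Q) : Q := mq_scale (-1) x.

Lemma mq_ev0 m : mq_ev m mq_zero = 0.
Proof. by rewrite mq_ev_class /= scale0r. Qed.
Lemma mq_ev1 m : mq_ev m mq_one = 1.
Proof. by rewrite mq_ev_class /= scale1r. Qed.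
Lemma mq_evD m x y : mq_ev m (mq_add x y) = mq_ev m x + mq_ev m y.
Proof. by rewrite mq_ev_class. Qed.
Lemma mq_evM m x y : mq_ev m (mq_mul x y) = mq_ev m x * mq_ev m y.
Proof. by rewrite mq_ev_class. Qed.
Lemma mq_evZ m k x : mq_ev m (mq_scale k x) = k *: mq_ev m x.
Proof. by rewrite mq_ev_class /= -scalerAl mul1r. Qed.
Lemma mq_evN m x : mq_ev m (mq_opp x) = - mq_ev m x.
Proof. by rewrite mq_evZ scaleN1r. Qed.

Let evE := (mq_ev0, mq_ev1, mq_evD, mq_evM, mq_evZ, mq_evN).

Lemma mq_addA : associative mq_add.
Proof. by move=> x y z; apply: mq_ext => m; rewrite !evE addrA. Qed.
Lemma mq_addC : commutative mq_add.
Proof. by move=> x y; apply: mq_ext => m; rewrite !evE addrC. Qed.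
Lemma mq_add0 : left_id mq_zero mq_add.
Proof. by move=> x; apply: mq_ext => m; rewrite !evE add0r. Qed.
Lemma mq_addN : left_inverse mq_zero mq_opp mq_add.
Proof. by move=> x; apply: mq_ext => m; rewrite !evE addNr. Qed.

HB.instance Definition _ :=
  GRing.isZmodule.Build Q mq_addA mq_addC mq_add0 mq_addN.

Lemma mq_mulA : associative mq_mul.
Proof. by move=> x y z; apply: mq_ext => m; rewrite !evE mulrA. Qed.
Lemma mq_mul1x : left_id mq_one mq_mul.
Proof. by move=> x; apply: mq_ext => m; rewrite !evE mul1r. Qed.
Lemma mq_mulx1 : right_id mq_one mq_mul.
Proof. by move=> x; apply: mq_ext => m; rewrite !evE mulr1. Qed.
Lemma mq_mulDl : left_distributive mq_mul mq_add.
Proof. by move=> x y z; apply: mq_ext => m; rewrite !evE mulrDl. Qed.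
Lemma mq_mulDr : right_distributive mq_mul mq_add.
Proof. by move=> x y z; apply: mq_ext => m; rewrite !evE mulrDr. Qed.
Lemma mq_one_neq0 : mq_one != mq_zero.
Proof.
apply/eqP => /(congr1 (mq_ev m0)); rewrite mq_ev0 mq_ev1 => /eqP.
by rewrite oner_eq0.
Qed.

HB.instance Definition _ := GRing.Zmodule_isNzRing.Build Q
  mq_mulA mq_mul1x mq_mulx1 mq_mulDl mq_mulDr mq_one_neq0.

Lemma mq_scaleA k l x : mq_scale k (mq_scale l x) = mq_scale (k * l) x.
Proof. by apply: mq_ext => m; rewrite !evE scalerA. Qed.
Lemma mq_scale1 : left_id 1 mq_scale.
Proof. by move=> x; apply: mq_ext => m; rewrite !evE scale1r. Qed.
Lemma mq_scaleDr : right_distributive mq_scale +%R.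
Proof. by move=> k x y; apply: mq_ext => m; rewrite !evE scalerDr. Qed.
Lemma mq_scaleDl x : {morph mq_scale^~ x : k l / k + l}.
Proof. by move=> k l; apply: mq_ext => m; rewrite !evE scalerDl. Qed.

HB.instance Definition _ := GRing.Zmodule_isLmodule.Build K Q
  mq_scaleA mq_scale1 mq_scaleDr mq_scaleDl.

Lemma mq_scalerAl (k : K) (x y : Q) : k *: (x * y) = (k *: x) * y.
Proof. by apply: mq_ext => m; rewrite !evE scalerAl. Qed.
Lemma mq_scalerAr (k : K) (x y : Q) : k *: (x * y) = x * (k *: y).
Proof. by apply: mq_ext => m; rewrite !evE scalerAr. Qed.

HB.instance Definition _ := GRing.Lmodule_isLalgebra.Build K Q mq_scalerAl.
HB.instance Definition _ := GRing.Lalgebra_isAlgebra.Build K Q mq_scalerAr.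

Lemma mq_ev_map m : alg_map (@mq_ev m).
Proof. by split=> [k x y||x y]; rewrite ?mq_evD ?mq_evZ ?mq_ev1 ?mq_evM. Qed.

End ModelQuotient.

(* The algebra presented by generators G and relations rel; it is regarded as  *)
(* graded, concentrated in degree 0. The model m0 only serves to ensure 1 != 0.*)
Section PresentedAlgebra.
Variables (K : fieldType) (G : Type) (rel : term K G -> term K G -> Prop).

Record alg_model := AlgModel {
  am_alg : algType K;
  am_gen : G -> am_alg;
  am_rel : forall s t, rel s t -> eval am_gen s = eval am_gen t }.

Variable m0 : alg_model.

Definition palg := mquot am_gen m0.
HB.instance Definition _ := GRing.Algebra.on palg.

Definition palg_gen (g : G) : palg := mq_class am_gen m0 (Gen g).

(* This is an algebra map if h satisfies the relations. *)
Definition palg_lift (B : algType K) (h : G -> B) (x : palg) : B :=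
  eval h (repr x).

Lemma palg_class t : mq_class am_gen m0 t = eval palg_gen t.
Proof.
by apply: mq_ext => m; elim: t => [g|k|s IHs t IHt|s IHs t IHt];
  rewrite ?mq_evZ ?mq_ev1 ?mq_evD ?mq_evM mq_ev_class //= -?IHs -?IHt ?mq_ev_class.
Qed.

Lemma palg_rel s t : rel s t -> eval palg_gen s = eval palg_gen t.
Proof.
by move=> st; rewrite -!palg_class; apply: mq_ext => m; rewrite !mq_ev_class; exact: am_rel.
Qed.

Lemma palg_liftP (B : algType K) (h : G -> B) :
    (forall s t, rel s t -> eval h s = eval h t) ->
  alg_map (palg_lift h) /\ forall g, palg_lift h (palg_gen g) = h g.
Proof.
move=> hrel; pose m := AlgModel hrel; split.
  by have := @mq_ev_map K G alg_model am_alg am_gen m0 m.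
by move=> g; have := @mq_ev_class K G alg_model am_alg am_gen m0 m (Gen g).
Qed.

Lemma palg_generated (P : palg -> Prop) :
  (forall g, P (palg_gen g)) -> (forall k, P k%:A) ->
  (forall x y, P x -> P y -> P (x + y)) -> (forall x y, P x -> P y -> P (x * y)) ->
  forall x, P x.
Proof.
move=> Pg Pk PD PM x; rewrite -[x]reprK.
change (P (mq_class am_gen m0 (repr x))); rewrite palg_class.
by elim: (repr x) => //= s Ps t Pt; [apply: PD|apply: PM].
Qed.

Definition palg_gr (n : nat) (x : palg) : palg := if n == 0%N then x else 0.

Lemma palg_gr_linear n : linear (palg_gr n).
Proof. by rewrite /palg_gr; case: eqP => // _ k x y; rewrite scaler0 addr0. Qed.

Lemma palg_gr_gr m n x :
  palg_gr m (palg_gr n x) = if m == n then palg_gr n x else 0.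
Proof. by case: m n => [|m] [|n] //=; rewrite /palg_gr /=; case: ifP. Qed.

Lemma palg_gr_total x : exists N, x = \sum_(n < N) palg_gr n x.
Proof. by exists 1%N; rewrite big_ord1. Qed.

Lemma palg_gr_mul m n x y :
  palg_gr m x = x -> palg_gr n y = y -> palg_gr (m + n)%N (x * y) = x * y.
Proof.
by case: m n => [|m] [|n] //= <- <-; rewrite /palg_gr /= ?mul0r ?mulr0.
Qed.

HB.instance Definition _ := isGraded.Build K palg
  palg_gr_linear palg_gr_gr palg_gr_total (erefl _) palg_gr_mul.

End PresentedAlgebra.

Lemma sgn_map (K : fieldType) (A B : gralgType K) (f : A -> B) :
  linear f -> (forall n x, f (gr n x) = gr n (f x)) ->
  forall x, f (sgn x) = sgn (f x).
Proof.
move=> fl fgr; have sA := @sgn_linear K A; have sB := @sgn_linear K B.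
elim/gr_ind => [x y hx hy|n x hx].
  by rewrite (linD sA) !(linD fl) (linD sB) hx hy.
have hfx : gr n (f x) = f x by rewrite -fgr hx.
by rewrite (sgn_homog hx) (sgn_homog hfx) (linZ fl).
Qed.

Lemma gr_mulE (K : fieldType) (A : gralgType K) n (x y : A) :
  gr n (x * y) = \sum_(i < n.+1) gr i x * gr (n - i) y.
Proof.
elim/gr_ind: x => [x x' hx hx'|p x hx].
  rewrite mulrDl gr_add hx hx' -big_split /=; apply: eq_bigr => i _.
  by rewrite gr_add mulrDl.
elim/gr_ind: y => [y y' hy hy'|r y hy].
  rewrite mulrDr gr_add hy hy' -big_split /=; apply: eq_bigr => i _.
  by rewrite gr_add mulrDr.
rewrite -{1}(gr_mul _ _ _ _ hx hy) gr_gr (gr_mul _ _ _ _ hx hy).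
have grE m (z : A) k : gr k z = z -> gr m z = if m == k then z else 0.
  by move=> <-; rewrite gr_gr.
have [lt|le] := ltnP n p.
  rewrite ltn_eqF ?(leq_trans lt) ?leq_addr // big1 // => i _.
  by rewrite (grE i _ _ hx) ltn_eqF ?mul0r // (leq_trans _ lt).
rewrite (bigD1 (Ordinal (le : (p < n.+1)%N))) //= hx (grE _ _ _ hy) big1.
  by rewrite addr0 -(eqn_add2l p (n - p)) subnKC //; case: eqP; rewrite ?mulr0.
by move=> i; rewrite -val_eqE /= => /negPf ne; rewrite (grE i _ _ hx) ne mul0r.
Qed.

(* The DGA presented by generators g of degree 0, their differentials, and     *)
(* relations between these: the generator g corresponds to inl g and its       *)
(* differential to inr g.                                                      *)
Definition dgen (K : fieldType) (G : Type) (B : dgaType K) (h : G -> B)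
    (g : G + G) : B :=
  match g with inl x => h x | inr x => dif (h x) end.

Section PresentedDGA.
Variables (K : fieldType) (G : Type).
Variable rel : term K (G + G) -> term K (G + G) -> Prop.

Record dga_model := DGAModel {
  dm_alg : dgaType K;
  dm_gen : G -> dm_alg;
  dm_deg : forall g, gr 0 (dm_gen g) = dm_gen g;
  dm_rel : forall s t, rel s t -> eval (dgen dm_gen) s = eval (dgen dm_gen) t }.

Variable m0 : dga_model.

Definition pdga := mquot (fun m : dga_model => dgen (@dm_gen m)) m0.
HB.instance Definition _ := GRing.Algebra.on pdga.

Local Notation class := (mq_class (fun m : dga_model => dgen (@dm_gen m)) m0).
Local Notation ev m :=
  (@mq_ev K (G + G) dga_model dm_alg (fun m => dgen (@dm_gen m)) m0 m).

Definition pdga_gen (g : G) : pdga := class (Gen (inl g)).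

(* This is a DGA map if h is of degree 0 and satisfies the relations. *)
Definition pdga_lift (B : dgaType K) (h : G -> B) (x : pdga) : B :=
  eval (dgen h) (repr x).

Fixpoint term_gr (n : nat) (t : term K (G + G)) : term K (G + G) :=
  match t with
  | Gen (inl _) | Cst _ => if n == 0%N then t else Cst 0
  | Gen (inr _) => if n == 1%N then t else Cst 0
  | Add s t => Add (term_gr n s) (term_gr n t)
  | Mul s t => \big[Add/Cst 0]_(i < n.+1) Mul (term_gr i s) (term_gr (n - i)%N t)
  end.

Fixpoint term_bound (t : term K (G + G)) : nat :=
  match t with
  | Gen _ | Cst _ => 2
  | Add s t | Mul s t => (term_bound s + term_bound t)%N
  end.

Fixpoint term_sgn (t : term K (G + G)) : term K (G + G) :=
  match t with
  | Gen (inl _) | Cst _ => t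
  | Gen (inr _) => Mul (Cst (-1)) t
  | Add s t => Add (term_sgn s) (term_sgn t)
  | Mul s t => Mul (term_sgn s) (term_sgn t)
  end.

Fixpoint term_dif (t : term K (G + G)) : term K (G + G) :=
  match t with
  | Gen (inl g) => Gen (inr g)
  | Gen (inr _) | Cst _ => Cst 0
  | Add s t => Add (term_dif s) (term_dif t)
  | Mul s t => Add (Mul (term_dif s) t) (Mul (term_sgn s) (term_dif t))
  end.

Lemma eval_sum (B : algType K) (h : G + G -> B) n (F : 'I_n -> term K (G + G)) :
  eval h (\big[Add/Cst 0]_(i < n) F i) = \sum_(i < n) eval h (F i).
Proof. by elim/big_rec2: _ => [|i x y _ <-] /=; rewrite ?scale0r. Qed.

Section Eval.
Variables (B : dgaType K) (h : G -> B).
Hypothesis h0 : forall g, gr 0 (h g) = h g.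

Lemma gr_cst n (k : K) : gr n (k%:A : B) = if n == 0%N then k%:A else 0.
Proof. by rewrite gr_scale -{1}gr_one gr_gr gr_one; case: eqP; rewrite ?scaler0. Qed.

Lemma eval_gr (n : nat) t : eval (dgen h) (term_gr n t) = gr n (eval (dgen h) t).
Proof.
elim: t n => [[g|g]|k|s IHs t IHt|s IHs t IHt] n /=.
- by rewrite -h0 gr_gr; case: eqP => _ /=; rewrite ?h0 ?scale0r.
- rewrite -(dif_homog (h0 g)) gr_gr (dif_homog (h0 g)).
  by case: eqP => _ /=; rewrite ?scale0r.
- by rewrite gr_cst; case: eqP => _ /=; rewrite ?scale0r.
- by rewrite gr_add IHs IHt.
by rewrite eval_sum gr_mulE; apply: eq_bigr => i _ /=; rewrite IHs IHt.
Qed.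

Lemma eval_bound (n : nat) t :
  (term_bound t <= n)%N -> gr n (eval (dgen h) t) = 0.
Proof.
elim: t n => [[g|g]|k|s IHs t IHt|s IHs t IHt] n /=.
- by case: n => // n _; rewrite -h0 gr_gr.
- by case: n => [|[|n]] // _; rewrite -(dif_homog (h0 g)) gr_gr.
- by case: n => // n _; rewrite gr_cst.
- move=> le; rewrite gr_add IHs ?IHt ?addr0 // (leq_trans _ le) //.
    exact: leq_addl.
  exact: leq_addr.
move=> le; rewrite gr_mulE big1 // => i _.
have [lt|ge] := ltnP i (term_bound s); last by rewrite IHs // mul0r.
have le' : (i + term_bound t <= n)%N.
  by apply: leq_trans le; rewrite leq_add2r ltnW.
by rewrite (IHt (n - i)%N) ?mulr0 // leq_subRL // (leq_trans _ le') ?leq_addr.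
Qed.

Lemma eval_sgn t : eval (dgen h) (term_sgn t) = sgn (eval (dgen h) t).
Proof.
elim: t => [[g|g]|k|s IHs t IHt|s IHs t IHt] /=.
- by rewrite (sgn_homog (h0 g)) scale1r.
- by rewrite (sgn_homog (dif_homog (h0 g))) -scalerAl mul1r.
- by rewrite (linZ (@sgn_linear K B)) sgn_one.
- by rewrite (linD (@sgn_linear K B)) IHs IHt.
by rewrite sgn_mul IHs IHt.
Qed.

Lemma dif_one : dif (1 : B) = 0.
Proof.
have := dif_mul (1 : B) 1; rewrite sgn_one !mulr1 mul1r.
by move/eqP; rewrite -subr_eq0 opprD addNKr oppr_eq0 => /eqP.
Qed.

Lemma eval_dif t : eval (dgen h) (term_dif t) = dif (eval (dgen h) t).
Proof.
have dl := @dif_linear K B.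
elim: t => [[g|g]|k|s IHs t IHt|s IHs t IHt] //=.
- by rewrite dif_dif scale0r.
- by rewrite (linZ dl) dif_one scaler0 scale0r.
- by rewrite (linD dl) IHs IHt.
by rewrite dif_mul IHs IHt eval_sgn.
Qed.

End Eval.

Definition pdga_gr n (x : pdga) : pdga := class (term_gr n (repr x)).
Definition pdga_dif (x : pdga) : pdga := class (term_dif (repr x)).

Lemma pdga_ext (x y : pdga) : (forall m, ev m x = ev m y) -> x = y.
Proof. exact: mq_ext. Qed.

Lemma ev_gr m n x : ev m (pdga_gr n x) = gr n (ev m x).
Proof. by rewrite mq_ev_class; apply: eval_gr; apply: dm_deg. Qed.

Lemma ev_map m : alg_map (ev m).
Proof. exact: mq_ev_map. Qed.

Lemma ev_linear m : linear (ev m).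
Proof. by case: (ev_map m). Qed.

Lemma ev_dif m x : ev m (pdga_dif x) = dif (ev m x).
Proof. by rewrite mq_ev_class; apply: eval_dif; apply: dm_deg. Qed.

Lemma pdga_gr_linear n : linear (pdga_gr n).
Proof.
move=> k x y; apply: pdga_ext => m; have fl := ev_linear m.
by rewrite ev_gr !(linD fl) !(linZ fl) !ev_gr gr_linear.
Qed.

Lemma pdga_gr_gr p n x :
  pdga_gr p (pdga_gr n x) = if p == n then pdga_gr n x else 0.
Proof.
apply: pdga_ext => m; rewrite !ev_gr gr_gr.
by case: eqP => _; rewrite ?ev_gr // (lin0 (ev_linear m)).
Qed.

Lemma pdga_gr_total x : exists N, x = \sum_(n < N) pdga_gr n x.
Proof.
exists (term_bound (repr x)); apply: pdga_ext => m.
rewrite (lin_sum (ev_linear m)); under eq_bigr do rewrite ev_gr.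
rewrite -(@gr_fold_wide _ _ _ (fun=> id)) //; first exact: gr_boundE.
by move=> n le; apply: eval_bound => //; apply: dm_deg.
Qed.

Lemma pdga_gr_one : pdga_gr 0 1 = 1.
Proof.
apply: pdga_ext => m; rewrite ev_gr; case: (ev_map m) => _ e1 _.
by rewrite [ev m 1]e1 gr_one.
Qed.

Lemma pdga_gr_mul p n x y :
  pdga_gr p x = x -> pdga_gr n y = y -> pdga_gr (p + n)%N (x * y) = x * y.
Proof.
move=> hx hy; apply: pdga_ext => m; rewrite ev_gr.
case: (ev_map m) => _ _ eM; rewrite [ev m (x * y)]eM.
by apply: gr_mul; rewrite -ev_gr ?hx ?hy.
Qed.

HB.instance Definition _ := isGraded.Build K pdga
  pdga_gr_linear pdga_gr_gr pdga_gr_total pdga_gr_one pdga_gr_mul.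

Lemma ev_sgn m (x : pdga) : ev m (sgn x) = sgn (ev m x).
Proof. by apply: sgn_map; [exact: ev_linear|move=> n y; apply: ev_gr]. Qed.

Lemma pdga_dif_linear : linear pdga_dif.
Proof.
move=> k x y; apply: pdga_ext => m; have fl := ev_linear m.
by rewrite ev_dif !(linD fl) !(linZ fl) !ev_dif dif_linear.
Qed.

Lemma pdga_gr0_dif x : gr 0 (pdga_dif x) = 0.
Proof.
apply: pdga_ext => m.
by rewrite [LHS]ev_gr ev_dif gr0_dif (lin0 (ev_linear m)).
Qed.

Lemma pdga_grS_dif n x : gr n.+1 (pdga_dif x) = pdga_dif (gr n x).
Proof.
by apply: pdga_ext => m; rewrite [LHS]ev_gr !ev_dif grS_dif [in RHS]ev_gr.
Qed.

Lemma pdga_dif_dif x : pdga_dif (pdga_dif x) = 0.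
Proof.
by apply: pdga_ext => m; rewrite !ev_dif dif_dif (lin0 (ev_linear m)).
Qed.

Lemma pdga_dif_mul x y :
  pdga_dif (x * y) = pdga_dif x * y + sgn x * pdga_dif y.
Proof.
apply: pdga_ext => m; case: (ev_map m) => _ _ eM.
rewrite ev_dif [ev m (x * y)]eM (linD (ev_linear m)).
by rewrite [ev m (_ * y)]eM [ev m (_ * pdga_dif y)]eM !ev_dif ev_sgn dif_mul.
Qed.

HB.instance Definition _ := isDGA.Build K pdga
  pdga_dif_linear pdga_gr0_dif pdga_grS_dif pdga_dif_dif pdga_dif_mul.

Lemma pdga_gen_deg g : gr 0 (pdga_gen g) = pdga_gen g.
Proof. by apply: pdga_ext => m; rewrite [LHS]ev_gr mq_ev_class /= dm_deg. Qed.

Lemma pdga_class t : class t = eval (dgen pdga_gen) t.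
Proof.
elim: t => [[g|g]|k|s IHs t IHt|s IHs t IHt] //=; apply: pdga_ext => m;
  case: (ev_map m) => fl e1 eM.
- by rewrite [RHS]ev_dif !mq_ev_class.
- by rewrite mq_ev_class (linZ fl) [in RHS]e1.
- by rewrite (linD fl) -IHs -IHt !mq_ev_class.
by rewrite [RHS]eM -IHs -IHt !mq_ev_class.
Qed.

Lemma pdga_rel s t :
  rel s t -> eval (dgen pdga_gen) s = eval (dgen pdga_gen) t.
Proof.
by move=> st; rewrite -!pdga_class; apply: pdga_ext => m; rewrite !mq_ev_class; apply: dm_rel.
Qed.

Lemma pdga_liftP (B : dgaType K) (h : G -> B) :
    (forall g, gr 0 (h g) = h g) ->
    (forall s t, rel s t -> eval (dgen h) s = eval (dgen h) t) ->
  dga_map (pdga_lift h) /\ forall g, pdga_lift h (pdga_gen g) = h g.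
Proof.
move=> h0 hrel; pose m := DGAModel h0 hrel; split; last first.
  by move=> g; have := @mq_ev_class K (G + G) dga_model dm_alg
    (fun m => dgen (@dm_gen m)) m0 m (Gen (inl g)).
split; first by have := @mq_ev_map K (G + G) dga_model dm_alg
    (fun m => dgen (@dm_gen m)) m0 m.
  by move=> n x; have := ev_gr m n x.
by move=> x; have := ev_dif m x.
Qed.

Lemma pdga_generated (P : pdga -> Prop) :
  (forall g, P (pdga_gen g)) -> (forall g, P (dif (pdga_gen g))) ->
  (forall k, P k%:A) -> (forall x y, P x -> P y -> P (x + y)) ->
  (forall x y, P x -> P y -> P (x * y)) -> forall x, P x.
Proof.
move=> Pg Pd Pk PD PM x; rewrite -[x]reprK.
change (P (class (repr x))); rewrite pdga_class.
by elim: (repr x) => [[g|g]|k|s Ps t Pt|s Ps t Pt] //=; [apply: PD|apply: PM].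
Qed.

End PresentedDGA.

(* Tensor products: formal sums of pairs, modulo equality under every bilinear *)
(* map.                                                                        *)
Definition bilin (K : fieldType) (U V W : lmodType K) (f : U -> V -> W) : Prop :=
  (forall v, linear (f^~ v)) /\ (forall u, linear (f u)).

Section Tensor.
Variables (K : fieldType) (U V : lmodType K).

Definition tens_eq (s t : seq (U * V)) : bool :=
  `[< forall (W : lmodType K) (f : U -> V -> W), bilin f ->
        \sum_(p <- s) f p.1 p.2 = \sum_(p <- t) f p.1 p.2 >].

Lemma tens_refl : reflexive tens_eq. Proof. by move=> s; apply/asboolP. Qed.

Lemma tens_sym : symmetric tens_eq.
Proof. by move=> s t; apply/asboolP/asboolP => H W f fb; rewrite H. Qed.

Lemma tens_trans : transitive tens_eq.
Proof.
move=> s t u /asboolP H1 /asboolP H2; apply/asboolP => W f fb.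
by rewrite H1 ?H2.
Qed.

Definition tens_equiv := EquivRel tens_eq tens_refl tens_sym tens_trans.

Definition tens := {eq_quot tens_equiv}.

HB.instance Definition _ := Choice.on tens.
HB.instance Definition _ := EqQuotient.on tens.

Definition tlift (W : lmodType K) (f : U -> V -> W) (x : tens) : W :=
  \sum_(p <- repr x) f p.1 p.2.

Definition tens_class (s : seq (U * V)) : tens := \pi_tens s.

Lemma tlift_class (W : lmodType K) (f : U -> V -> W) s :
  bilin f -> tlift f (tens_class s) = \sum_(p <- s) f p.1 p.2.
Proof.
have /eqmodP/asboolP : repr (tens_class s) = s %[mod tens] by rewrite reprK.
exact.
Qed.

Lemma tens_ext x y :
  (forall (W : lmodType K) (f : U -> V -> W), bilin f -> tlift f x = tlift f y) ->
  x = y.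
Proof.
by move=> H; rewrite -[x]reprK -[y]reprK; apply/eqmodP/asboolP => W f; apply: H.
Qed.

Definition tens_zero : tens := tens_class [::].
Definition tens_add (x y : tens) : tens := tens_class (repr x ++ repr y).
Definition tens_scale (k : K) (x : tens) : tens :=
  tens_class [seq (k *: p.1, p.2) | p <- repr x].
Definition tens_opp (x : tens) : tens := tens_scale (-1) x.

Section Lift.
Variables (W : lmodType K) (f : U -> V -> W).
Hypothesis fb : bilin f.

Lemma tlift0 : tlift f tens_zero = 0.
Proof. by rewrite tlift_class // big_nil. Qed.

Lemma tliftD x y : tlift f (tens_add x y) = tlift f x + tlift f y.
Proof. by rewrite tlift_class // big_cat. Qed.

Lemma tliftZ k x : tlift f (tens_scale k x) = k *: tlift f x.
Proof.
rewrite tlift_class // big_map scaler_sumr; apply: eq_bigr => p _ /=.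
exact: (linZ (fb.1 p.2)).
Qed.

Lemma tliftN x : tlift f (tens_opp x) = - tlift f x.
Proof. by rewrite tliftZ scaleN1r. Qed.

End Lift.

Lemma tens_addA : associative tens_add.
Proof. by move=> x y z; apply: tens_ext => W f fb; rewrite !tliftD // addrA. Qed.
Lemma tens_addC : commutative tens_add.
Proof. by move=> x y; apply: tens_ext => W f fb; rewrite !tliftD // addrC. Qed.
Lemma tens_add0 : left_id tens_zero tens_add.
Proof. by move=> x; apply: tens_ext => W f fb; rewrite tliftD // tlift0 // add0r. Qed.
Lemma tens_addN : left_inverse tens_zero tens_opp tens_add.
Proof.
move=> x; apply: tens_ext => W f fb.
by rewrite tliftD // tliftN // tlift0 // addNr.
Qed.

HB.instance Definition _ :=
  GRing.isZmodule.Build tens tens_addA tens_addC tens_add0 tens_addN.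

Lemma tens_scaleA k l x : tens_scale k (tens_scale l x) = tens_scale (k * l) x.
Proof. by apply: tens_ext => W f fb; rewrite !tliftZ // scalerA. Qed.
Lemma tens_scale1 : left_id 1 tens_scale.
Proof. by move=> x; apply: tens_ext => W f fb; rewrite tliftZ // scale1r. Qed.
Lemma tens_scaleDr : right_distributive tens_scale +%R.
Proof.
move=> k x y; apply: tens_ext => W f fb.
have fD u v : tlift f (u + v) = tlift f u + tlift f v by apply: tliftD.
by rewrite fD !tliftZ // fD scalerDr.
Qed.
Lemma tens_scaleDl x : {morph tens_scale^~ x : k l / k + l}.
Proof.
by move=> k l; apply: tens_ext => W f fb; rewrite tliftD // !tliftZ // scalerDl.
Qed.

HB.instance Definition _ := GRing.Zmodule_isLmodule.Build K tens
  tens_scaleA tens_scale1 tens_scaleDr tens_scaleDl.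

Lemma tlift_linear (W : lmodType K) (f : U -> V -> W) :
  bilin f -> linear (tlift f).
Proof. by move=> fb k x y; rewrite tliftD // tliftZ. Qed.

Definition tpure (u : U) (v : V) : tens := tens_class [:: (u, v)].

Lemma tlift_pure (W : lmodType K) (f : U -> V -> W) u v :
  bilin f -> tlift f (tpure u v) = f u v.
Proof. by move=> fb; rewrite tlift_class // big_seq1. Qed.

Lemma tpure_bilin : bilin tpure.
Proof.
by split=> [v k u u'|u k v v']; apply: tens_ext => W f fb;
  rewrite (tlift_linear fb) !tlift_pure // ?fb.1 ?fb.2.
Qed.

Lemma tens_pureE (x : tens) : x = \sum_(p <- repr x) tpure p.1 p.2.
Proof.
apply: tens_ext => W f fb; rewrite (lin_sum (tlift_linear fb)) /tlift.
by apply: eq_bigr => p _; rewrite -/(tlift _ _) tlift_pure.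
Qed.

Lemma tens_ind (P : tens -> Prop) :
  (forall x y, P x -> P y -> P (x + y)) -> (forall u v, P (tpure u v)) ->
  forall x, P x.
Proof.
move=> PD Pp x; rewrite (tens_pureE x); apply: big_ind => //.
by rewrite -(lin0 (tpure_bilin.1 0)); apply: Pp.
Qed.

End Tensor.

Notation "x ⊗ y" := (tpure x y) (at level 40, left associativity) : ring_scope.

Definition tmap (K : fieldType) (U V U' V' : lmodType K)
    (f : U -> U') (g : V -> V') : tens U V -> tens U' V' :=
  tlift (fun u v => f u ⊗ g v).

Definition tassoc (K : fieldType) (U V W : lmodType K) :
    tens (tens U V) W -> tens U (tens V W) :=
  tlift (fun x w => tlift (fun u v => u ⊗ (v ⊗ w)) x).

Section Parametric.
Variables (K : fieldType) (Z W : lmodType K).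

Lemma linear_sum I (s : seq I) (F : I -> Z -> W) :
  (forall i, linear (F i)) -> linear (fun z => \sum_(i <- s) F i z).
Proof.
move=> Fl k x y; rewrite scaler_sumr -big_split /=; apply: eq_bigr => i _.
exact: Fl.
Qed.

Lemma gr_fold_param (A : gralgType K) (F : Z -> nat -> A -> W) x :
  (forall n y, linear (fun z => F z n y)) ->
  linear (fun z => gr_fold (F z) x).
Proof. by move=> Fl; apply: linear_sum => n; apply: Fl. Qed.

Lemma tlift_param (U V : lmodType K) (F : Z -> U -> V -> W) x :
  (forall u v, linear (fun z => F z u v)) -> linear (fun z => tlift (F z) x).
Proof. by move=> Fl; apply: linear_sum => p; apply: Fl. Qed.

End Parametric.

Section SuperTensor.
Variables (K : fieldType) (A B : gralgType K).
Local Notation T := (tens A B).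

(* (a ⊗ b)(c ⊗ e) = (-1)^(|b||c|) ac ⊗ be, extended from homogeneous b and c *)
Definition koszul (a : A) (b : B) (c : A) (e : B) : T :=
  gr_fold (fun m b' =>
    gr_fold (fun n c' => (-1) ^+ (m * n) *: ((a * c') ⊗ (b' * e))) c) b.

Definition tens_mul (x y : T) : T :=
  tlift (fun a b => tlift (fun c e => koszul a b c e) y) x.

Let pl v : linear (fun u : A => u ⊗ v : T) := (tpure_bilin A B).1 v.
Let pr u : linear (fun v : B => u ⊗ v : T) := (tpure_bilin A B).2 u.

Lemma koszul_term (s : K) :
  [/\ forall b c e, linear (fun a : A => s *: ((a * c) ⊗ (b * e)) : T),
      forall a c e, linear (fun b : B => s *: ((a * c) ⊗ (b * e)) : T),
      forall a b e, linear (fun c : A => s *: ((a * c) ⊗ (b * e)) : T)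
    & forall a b c, linear (fun e : B => s *: ((a * c) ⊗ (b * e)) : T)].
Proof.
split=> ? ? ? k x y.
- by rewrite mulrDl -scalerAl pl scalerDr !scalerA mulrC.
- by rewrite mulrDl -scalerAl pr scalerDr !scalerA mulrC.
- by rewrite mulrDr -scalerAr pl scalerDr !scalerA mulrC.
by rewrite mulrDr -scalerAr pr scalerDr !scalerA mulrC.
Qed.

Lemma koszul_homog m n a b c e :
  gr m b = b -> gr n c = c ->
  koszul a b c e = (-1) ^+ (m * n) *: ((a * c) ⊗ (b * e)).
Proof.
have lb k := let: And4 _ l _ _ := koszul_term k in l.
have lc k := let: And4 _ _ l _ := koszul_term k in l.
move=> hb hc; rewrite /koszul (gr_fold_homog _ hb); last first.
  move=> p; rewrite /gr_fold big1 // => i _; exact: (lin0 (lb _ _ _ _)).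
by rewrite (gr_fold_homog _ hc) // => p; apply: (lin0 (lc _ _ _ _)).
Qed.

Lemma koszul_linear :
  [/\ forall b c e, linear (fun a => koszul a b c e),
      forall a c e, linear (fun b => koszul a b c e),
      forall a b e, linear (fun c => koszul a b c e)
    & forall a b c, linear (fun e => koszul a b c e)].
Proof.
have la k := let: And4 l _ _ _ := koszul_term k in l.
have lb k := let: And4 _ l _ _ := koszul_term k in l.
have lc k := let: And4 _ _ l _ := koszul_term k in l.
have le k := let: And4 _ _ _ l := koszul_term k in l.
split=> ? ? ?.
- by apply: gr_fold_param => n y; apply: gr_fold_param => m z; apply: la.
- by apply: gr_fold_linear => n; apply: gr_fold_param => m z; apply: lb.
- by apply: gr_fold_param => n y; apply: gr_fold_linear => m; apply: lc.
by apply: gr_fold_param => n y; apply: gr_fold_param => m z; apply: le.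
Qed.

Lemma koszul_bilin a b : bilin (koszul a b).
Proof. by have [_ _ lc le] := koszul_linear; split=> ?; [apply: lc|apply: le]. Qed.

Lemma tens_mul_bilin y :
  bilin (fun a b => tlift (fun c e => koszul a b c e) y).
Proof.
have [la lb _ _] := koszul_linear.
by split=> ?; apply: tlift_param => c e; [apply: la|apply: lb].
Qed.

Lemma tens_mulr_linear x : linear (tens_mul x).
Proof.
have H a b := tlift_linear (koszul_bilin a b).
move=> k y z; rewrite /tens_mul /tlift scaler_sumr -big_split /=.
by apply: eq_bigr => p _; have := H p.1 p.2 k y z.
Qed.

Lemma tens_mull_linear y : linear (tens_mul^~ y).
Proof. exact: (tlift_linear (tens_mul_bilin y)). Qed.

Lemma tens_mul_pure a b c e : tens_mul (a ⊗ b) (c ⊗ e) = koszul a b c e.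
Proof.
by rewrite /tens_mul tlift_pure; [rewrite tlift_pure //; exact: koszul_bilin|
  exact: tens_mul_bilin].
Qed.

Lemma tens_mul_homog m n a b c e :
  gr m b = b -> gr n c = c ->
  tens_mul (a ⊗ b) (c ⊗ e) = (-1) ^+ (m * n) *: ((a * c) ⊗ (b * e)).
Proof. by move=> hb hc; rewrite tens_mul_pure (koszul_homog _ _ hb hc). Qed.

Lemma tens_homog_ind (P : T -> Prop) :
  (forall x y, P x -> P y -> P (x + y)) ->
  (forall m n a b, gr m a = a -> gr n b = b -> P (a ⊗ b)) ->
  forall x, P x.
Proof.
move=> PD Pp; apply: tens_ind => // a b.
elim/gr_ind: a => [a a' Pa Pa'|m a ha]; first by rewrite (linD (pl b)); apply: PD.
elim/gr_ind: b => [b b' Pb Pb'|n b hb]; first by rewrite (linD (pr a)); apply: PD.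
exact: (Pp m n).
Qed.

Let ml y := linD (tens_mull_linear y).
Let mr x := linD (tens_mulr_linear x).
Let mlZ y := linZ (tens_mull_linear y).
Let mrZ x := linZ (tens_mulr_linear x).

Definition tens_one : T := 1 ⊗ 1.

Lemma tens_mulA : associative tens_mul.
Proof.
move=> x y z.
elim/tens_homog_ind: x => [x x' Hx Hx'|m1 n1 a1 b1 ha1 hb1].
  by rewrite !ml Hx Hx'.
elim/tens_homog_ind: y => [y y' Hy Hy'|m2 n2 a2 b2 ha2 hb2].
  by rewrite ml !mr ml Hy Hy'.
elim/tens_homog_ind: z => [z z' Hz Hz'|m3 n3 a3 b3 ha3 hb3].
  by rewrite !mr Hz Hz'.
rewrite (tens_mul_homog _ _ hb2 ha3) (tens_mul_homog _ _ hb1 ha2) mrZ mlZ.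
rewrite (tens_mul_homog _ _ hb1 (gr_mul _ _ _ _ ha2 ha3)).
rewrite (tens_mul_homog _ _ (gr_mul _ _ _ _ hb1 hb2) ha3) !mulrA !scalerA.
by rewrite -!exprD mulnDr mulnDl addnC -addnA.
Qed.

Lemma tens_mul1x : left_id tens_one tens_mul.
Proof.
move=> x; elim/tens_homog_ind: x => [x x' Hx Hx'|m n a b ha hb].
  by rewrite mr Hx Hx'.
by rewrite (tens_mul_homog _ _ gr_one ha) mul0n scale1r !mul1r.
Qed.

Lemma tens_mulx1 : right_id tens_one tens_mul.
Proof.
move=> x; elim/tens_homog_ind: x => [x x' Hx Hx'|m n a b ha hb].
  by rewrite ml Hx Hx'.
by rewrite (tens_mul_homog _ _ hb gr_one) muln0 scale1r !mulr1.
Qed.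

Lemma tens_mulDl : left_distributive tens_mul +%R.
Proof. by move=> x y z; rewrite ml. Qed.

Lemma tens_mulDr : right_distributive tens_mul +%R.
Proof. by move=> x y z; rewrite mr. Qed.

Lemma tens_one_neq0 : tens_one != 0.
Proof.
have [f fl f1] := linear_functional (oner_neq0 A).
have [g gl g1] := linear_functional (oner_neq0 B).
have fgb : bilin (fun a b => f a * g b : K^o).
  split=> ? k x y; first by rewrite fl mulrDl -scalerAl.
  by rewrite gl mulrDr -scalerAr.
apply/eqP => /(congr1 (tlift (fun a b => f a * g b : K^o))).
rewrite (lin0 (tlift_linear fgb)) tlift_pure // f1 g1 mulr1 => /eqP.
by rewrite oner_eq0.
Qed.

HB.instance Definition _ := GRing.Zmodule_isNzRing.Build T
  tens_mulA tens_mul1x tens_mulx1 tens_mulDl tens_mulDr tens_one_neq0.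

Lemma tens_scalerAl (k : K) (x y : T) : k *: (x * y) = (k *: x) * y.
Proof. by rewrite [RHS]mlZ. Qed.
Lemma tens_scalerAr (k : K) (x y : T) : k *: (x * y) = x * (k *: y).
Proof. by rewrite [RHS]mrZ. Qed.

HB.instance Definition _ := GRing.Lmodule_isLalgebra.Build K T tens_scalerAl.
HB.instance Definition _ := GRing.Lalgebra_isAlgebra.Build K T tens_scalerAr.

Definition tens_gr (n : nat) : T -> T :=
  tlift (fun a b => \sum_(i < n.+1) gr i a ⊗ gr (n - i)%N b).

Lemma tens_gr_bilin (n : nat) :
  bilin (fun (a : A) (b : B) => \sum_(i < n.+1) gr i a ⊗ gr (n - i)%N b : T).
Proof.
by split=> ?; apply: linear_sum => i k x y; rewrite gr_linear ?pl ?pr.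
Qed.

Lemma tens_gr_linear n : linear (tens_gr n).
Proof. exact: (tlift_linear (tens_gr_bilin n)). Qed.

Lemma tens_gr_homog (n p r : nat) a b : gr p a = a -> gr r b = b ->
  tens_gr n (a ⊗ b) = if n == (p + r)%N then a ⊗ b else 0.
Proof.
move=> ha hb; rewrite /tens_gr tlift_pure; last exact: tens_gr_bilin.
have grE (C : gralgType K) m (z : C) k : gr k z = z -> gr m z = if m == k then z else 0.
  by move=> <-; rewrite gr_gr.
have [lt|le] := ltnP n p.
  rewrite ltn_eqF ?(leq_trans lt) ?leq_addr // big1 // => i _.
  by rewrite (grE _ i _ _ ha) ltn_eqF ?(lin0 (pl _)) // (leq_trans _ lt).
rewrite (bigD1 (Ordinal (le : (p < n.+1)%N))) //= ha (grE _ _ _ _ hb) big1.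
  rewrite addr0 -(eqn_add2l p (n - p)) subnKC //.
  by case: eqP => // _; rewrite (lin0 (pr _)).
move=> i; rewrite -val_eqE /= => /negPf ne.
by rewrite (grE _ i _ _ ha) ne (lin0 (pl _)).
Qed.

Lemma tens_gr_gr m n x : tens_gr m (tens_gr n x) = if m == n then tens_gr n x else 0.
Proof.
elim/tens_homog_ind: x => [x y Hx Hy|p r a b ha hb].
  by rewrite !(linD (tens_gr_linear _)) Hx Hy; case: eqP; rewrite ?addr0.
rewrite (tens_gr_homog n ha hb); case: (n =P _) => [->|_].
  by rewrite (tens_gr_homog m ha hb).
by rewrite (lin0 (tens_gr_linear m)); case: eqP.
Qed.

Lemma tens_gr_total x : exists N, x = \sum_(n < N) tens_gr n x.
Proof.
suff [N H] : exists N, forall M, (N <= M)%N -> x = \sum_(n < M) tens_gr n x.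
  by exists N; apply: H.
elim/tens_homog_ind: x => [x y [N Hx] [N' Hy]|p r a b ha hb].
  exists (maxn N N') => M; rewrite geq_max => /andP[le le'].
  under eq_bigr do rewrite (linD (tens_gr_linear _)).
  by rewrite big_split /= -Hx // -Hy.
exists (p + r).+1 => M le.
under eq_bigr do rewrite (tens_gr_homog _ ha hb).
by rewrite (bigD1 (Ordinal le)) //= eqxx big1 ?addr0 // => i /negPf; rewrite -val_eqE /= => ->.
Qed.

Lemma tens_gr_one : tens_gr 0 1 = 1.
Proof. by rewrite [tens_gr 0 _](tens_gr_homog 0 gr_one gr_one). Qed.

Lemma tens_gr_mul m n x y :
  tens_gr m x = x -> tens_gr n y = y -> tens_gr (m + n)%N (x * y) = x * y.
Proof.
suff H : forall x y, tens_gr (m + n)%N (tens_gr m x * tens_gr n y)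
                     = tens_gr m x * tens_gr n y.
  by move=> hx hy; have := H x y; rewrite hx hy.
have gl := tens_gr_linear; move=> {}x {}y.
elim/tens_homog_ind: x => [x x' Hx Hx'|m1 n1 a1 b1 ha1 hb1].
  by rewrite (linD (gl m)) mulrDl (linD (gl _)) Hx Hx'.
elim/tens_homog_ind: y => [y y' Hy Hy'|m2 n2 a2 b2 ha2 hb2].
  by rewrite (linD (gl n)) mulrDr (linD (gl _)) Hy Hy'.
rewrite (tens_gr_homog _ ha1 hb1) (tens_gr_homog _ ha2 hb2).
case: eqP => [->|_]; last by rewrite mul0r (lin0 (gl _)).
case: eqP => [->|_]; last by rewrite mulr0 (lin0 (gl _)).
rewrite [_ * _](tens_mul_homog _ _ hb1 ha2) (linZ (gl _)).
rewrite (tens_gr_homog _ (gr_mul _ _ _ _ ha1 ha2) (gr_mul _ _ _ _ hb1 hb2)).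
by rewrite addnACA eqxx.
Qed.

HB.instance Definition _ := isGraded.Build K T
  tens_gr_linear tens_gr_gr tens_gr_total tens_gr_one tens_gr_mul.

Lemma tens_pure_homog m n (a : A) (b : B) :
  gr m a = a -> gr n b = b -> gr (m + n)%N (a ⊗ b : T) = a ⊗ b.
Proof. by move=> ha hb; rewrite [LHS](tens_gr_homog _ ha hb) eqxx. Qed.

End SuperTensor.

Section SuperTensorDGA.
Variables (K : fieldType) (A B : dgaType K).
Local Notation T := (tens A B).

Definition tens_dif : T -> T :=
  tlift (fun a b => dif a ⊗ b + sgn a ⊗ dif b).

Let pl v : linear (fun u : A => u ⊗ v : T) := (tpure_bilin A B).1 v.
Let pr u : linear (fun v : B => u ⊗ v : T) := (tpure_bilin A B).2 u.
Let dA := @dif_linear K A.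
Let dB := @dif_linear K B.
Let sA := @sgn_linear K A.

Lemma tens_dif_bilin :
  bilin (fun (a : A) (b : B) => dif a ⊗ b + sgn a ⊗ dif b : T).
Proof.
split=> v k x y.
  by rewrite dA sA !pl scalerDr addrACA.
by rewrite dB !pr scalerDr addrACA.
Qed.

Lemma tens_dif_linear : linear tens_dif.
Proof. exact: (tlift_linear tens_dif_bilin). Qed.

Lemma tens_dif_pure a b : tens_dif (a ⊗ b) = dif a ⊗ b + sgn a ⊗ dif b.
Proof. by rewrite /tens_dif tlift_pure //; exact: tens_dif_bilin. Qed.

Lemma tens_dif_homog m a b : gr m a = a ->
  tens_dif (a ⊗ b) = dif a ⊗ b + (-1) ^+ m *: (a ⊗ dif b).
Proof. by move=> ha; rewrite tens_dif_pure (sgn_homog ha) (linZ (pl _)). Qed.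

Let dl := tens_dif_linear.

Lemma tens_grS_dif n x : gr n.+1 (tens_dif x) = tens_dif (gr n x).
Proof.
elim/tens_homog_ind: x => [x y Hx Hy|p r a b ha hb].
  by rewrite (linD dl) !gr_add (linD dl) Hx Hy.
rewrite [gr n _](tens_gr_homog n ha hb) (tens_dif_homog _ ha) gr_add gr_scale.
rewrite [gr _ (_ ⊗ _)](tens_gr_homog n.+1 (dif_homog ha) hb).
rewrite [gr _ (_ ⊗ _)](tens_gr_homog n.+1 ha (dif_homog hb)).
rewrite addSn addnS eqSS; case: eqP => _; first by rewrite (tens_dif_homog _ ha).
by rewrite scaler0 addr0 (lin0 dl).
Qed.

Lemma tens_gr0_dif x : gr 0 (tens_dif x) = 0.
Proof.
elim/tens_homog_ind: x => [x y Hx Hy|p r a b ha hb].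
  by rewrite (linD dl) gr_add Hx Hy addr0.
rewrite (tens_dif_homog _ ha) gr_add gr_scale.
rewrite [gr _ (_ ⊗ _)](tens_gr_homog 0 (dif_homog ha) hb).
rewrite [gr _ (_ ⊗ _)](tens_gr_homog 0 ha (dif_homog hb)).
by rewrite addSn addnS /= scaler0 addr0.
Qed.

Lemma tens_dif_dif x : tens_dif (tens_dif x) = 0.
Proof.
elim/tens_homog_ind: x => [x y Hx Hy|p r a b ha hb].
  by rewrite !(linD dl) Hx Hy addr0.
rewrite (tens_dif_homog _ ha) (linD dl) (linZ dl) (tens_dif_homog _ (dif_homog ha)).
rewrite (tens_dif_homog _ ha) !dif_dif (lin0 (pl _)) (lin0 (pr _)) add0r scaler0 addr0.
by rewrite exprS mulN1r scaleNr addNr.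
Qed.

Lemma tens_dif_mul x y :
  tens_dif (x * y) = tens_dif x * y + sgn x * tens_dif y.
Proof.
have sT := @sgn_linear K T.
elim/tens_homog_ind: x => [x x' Hx Hx'|p1 r1 a b ha hb].
  by rewrite mulrDl !(linD dl) Hx Hx' (linD sT) !mulrDl addrACA.
elim/tens_homog_ind: y => [y y' Hy Hy'|p2 r2 c e hc he].
  by rewrite mulrDr !(linD dl) Hy Hy' !mulrDr addrACA.
have hda := dif_homog ha; have hdb := dif_homog hb.
have hdc := dif_homog hc; have hde := dif_homog he.
rewrite [a ⊗ b * _](tens_mul_homog _ _ hb hc) (linZ dl).
rewrite (tens_dif_homog _ (gr_mul _ _ _ _ ha hc)) (tens_dif_homog _ ha).
rewrite (tens_dif_homog _ hc) (sgn_homog (tens_pure_homog ha hb)).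
rewrite mulrDl mulrDr -!scalerAl -!scalerAr.
rewrite [dif a ⊗ b * _](tens_mul_homog _ _ hb hc).
rewrite [a ⊗ dif b * _](tens_mul_homog _ _ hdb hc).
rewrite [a ⊗ b * (dif c ⊗ _)](tens_mul_homog _ _ hb hdc).
rewrite [a ⊗ b * (c ⊗ _)](tens_mul_homog _ _ hb hc).
rewrite !dif_mul (sgn_homog ha) (sgn_homog hb) -!scalerAl.
rewrite (linD (pl _)) (linD (pr _)) !scalerDr.
rewrite (linZ (pl _)) (linZ (pr _)) !scalerA -!exprD -!addrA; congr (_ + _).
rewrite addrCA; congr (_ + (_ + _)); congr (_ *: _);
  rewrite -[LHS]signr_odd -[RHS]signr_odd ?(oddD, oddM, oddS) /=;
  by case: (odd p1); case: (odd p2); case: (odd r1).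
Qed.

HB.instance Definition _ := isDGA.Build K T
  tens_dif_linear tens_gr0_dif tens_grS_dif tens_dif_dif tens_dif_mul.

End SuperTensorDGA.

Section Notions.
Variable K : fieldType.

Definition exterior_algebra (A : algType K) (W : dgaType K) (i : A -> W) : Prop :=
  [/\ alg_map i,
      injective i,
      forall w, gr 0 w = w <-> exists a, w = i a,
      forall w, gr 1 w = w <->
        exists s : seq (A * A), w = \sum_(p <- s) i p.1 * dif (i p.2)
    & forall P : W -> Prop,
        (forall w, gr 0 w = w -> P w) -> (forall w, gr 1 w = w -> P w) ->
        (forall v w, P v -> P w -> P (v + w)) ->
        (forall v w, P v -> P w -> P (v * w)) -> forall w, P w].

(* For bicovariant calculi on a Hopf algebra A the rank over A equals the      *)
(* dimension of the space of left-invariant 1-forms.                           *)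
Definition calculus_dim (A : algType K) (W : dgaType K) (i : A -> W) (n : nat) :
    Prop :=
  exists e : 'I_n -> W, (forall k, gr 1 (e k) = e k) /\
    forall w, gr 1 w = w ->
      exists! c : {ffun 'I_n -> A}, w = \sum_k i (c k) * e k.

Definition is_counit (H : gralgType K) (Delta : H -> tens H H) (eps : H -> K^o) :
    Prop :=
  [/\ alg_map eps,
      forall x, tlift (fun a b => eps a *: b) (Delta x) = x
    & forall x, tlift (fun a b => eps b *: a) (Delta x) = x].

(* Super with respect to the parity of the degree: for an algebra concentrated *)
(* in degree 0 this is an ordinary Hopf algebra.                               *)
Definition super_hopf (H : gralgType K) (Delta : H -> tens H H) : Prop :=
  [/\ alg_map Delta,
      forall x, Delta (sgn x) = sgn (Delta x),
      forall x, tassoc (tmap Delta id (Delta x)) = tmap id Delta (Delta x)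
    & exists (eps : H -> K^o) (S : H -> H),
      [/\ is_counit Delta eps /\ forall x, eps (sgn x) = eps x,
          linear S /\ forall x, S (sgn x) = sgn (S x),
          forall x, tlift (fun a b => S a * b) (Delta x) = (eps x : K) *: (1 : H)
        & forall x, tlift (fun a b => a * S b) (Delta x) = (eps x : K) *: (1 : H)]].

Definition strongly_bicovariant (A : gralgType K) (Delta : A -> tens A A)
    (W : dgaType K) (i : A -> W) : Prop :=
  exists Dstar : W -> tens W W,
    [/\ super_hopf Dstar,
        forall n x, Dstar (gr n x) = gr n (Dstar x),
        forall a, Dstar (i a) = tmap i i (Delta a)
      & forall x, Dstar (dif x) = dif (Dstar x)].

Definition comodule_algebra (A B : gralgType K) (Delta : A -> tens A A)
    (delta : B -> tens B A) : Prop :=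
  [/\ alg_map delta,
      forall b, tassoc (tmap delta id (delta b)) = tmap id Delta (delta b)
    & exists eps : A -> K^o, is_counit Delta eps /\
      forall b, tlift (fun b' a => eps a *: b') (delta b) = b].

Definition differentiable_coaction (A B : gralgType K) (Delta : A -> tens A A)
    (WA WB : dgaType K) (iA : A -> WA) (iB : B -> WB) (delta : B -> tens B A) :
    Prop :=
  comodule_algebra Delta delta /\
  exists f : WB -> tens WB WA,
    dga_map f /\ forall b, f (iB b) = tmap iB iA (delta b).

Definition differentiable_map (A B : algType K)
    (WA WB : dgaType K) (iA : A -> WA) (iB : B -> WB) (f : A -> B) : Prop :=
  alg_map f /\
  exists g : WA -> WB, dga_map g /\ forall a, g (iA a) = iB (f a).

End Notions.

Fixpoint term_inl (K G : Type) (t : term K G) : term K (G + G) :=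
  match t with
  | Gen g => Gen (inl g)
  | Cst k => Cst k
  | Add s t => Add (term_inl s) (term_inl t)
  | Mul s t => Mul (term_inl s) (term_inl t)
  end.

Lemma eval_inl (K : fieldType) (G : Type) (B : dgaType K) (h : G -> B) (s : term K G) :
  eval (dgen h) (term_inl s) = eval h s.
Proof. by elim: s => //= s -> t ->. Qed.

(* If the relations of the DGA are those of the algebra and relations which    *)
(* hold when all differentials vanish, then the DGA is an exterior algebra.    *)
Section PresentedExterior.
Variables (K : fieldType) (G : Type) (rel0 : term K G -> term K G -> Prop).
Variable rel : term K (G + G) -> term K (G + G) -> Prop.
Variables (m0 : alg_model rel0) (m1 : dga_model rel).

Let A := palg m0.
Let W := pdga m1.
Let i : A -> W := palg_lift (fun g => pdga_gen m1 g : W).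

Definition palg_triv := A.
HB.instance Definition _ := GradedAlgebra.on palg_triv.

Let tdif (x : palg_triv) : palg_triv := 0.
Lemma triv_dif_linear : linear tdif.
Proof. by move=> k x y; rewrite scaler0 addr0. Qed.
Lemma triv_gr0_dif x : gr 0 (tdif x) = 0. Proof. exact: gr_0. Qed.
Lemma triv_grS_dif n x : gr n.+1 (tdif x) = tdif (gr n x).
Proof. exact: gr_0. Qed.
Lemma triv_dif_mul x y : tdif (x * y) = tdif x * y + sgn x * tdif y.
Proof. by rewrite mul0r mulr0 addr0. Qed.
HB.instance Definition _ := isDGA.Build K palg_triv
  triv_dif_linear triv_gr0_dif triv_grS_dif (fun=> erefl) triv_dif_mul.

Hypothesis rel_alg : forall s t, rel0 s t -> rel (term_inl s) (term_inl t).
Hypothesis rel_triv : forall (B : dgaType K) (h : G -> B),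
  (forall x : B, dif x = 0) ->
  (forall s t, rel0 s t -> eval h s = eval h t) ->
  forall s t, rel s t -> eval (dgen h) s = eval (dgen h) t.

Lemma palg_to_pdga_map : alg_map i /\ forall g, i (palg_gen m0 g) = pdga_gen m1 g.
Proof.
apply: palg_liftP => s t /rel_alg/(pdga_rel m1).
by rewrite !eval_inl.
Qed.

Let il : linear i. Proof. by case: palg_to_pdga_map => -[]. Qed.
Let i1 : i 1 = 1. Proof. by case: palg_to_pdga_map => -[]. Qed.
Let iM x y : i (x * y) = i x * i y. Proof. by case: palg_to_pdga_map => -[]. Qed.
Let ig g : i (palg_gen m0 g) = pdga_gen m1 g.
Proof. by case: palg_to_pdga_map. Qed.

Lemma presented_inj : injective i.
Proof.
pose h (g : G) : palg_triv := palg_gen m0 g.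
have [[[rl r1 rM] _ _] rg] : dga_map (@pdga_lift _ _ _ m1 _ h) /\
    forall g, @pdga_lift _ _ _ m1 _ h (pdga_gen m1 g) = h g.
  by apply: pdga_liftP => //; apply: rel_triv => // s t; exact: palg_rel.
apply: (can_inj (g := @pdga_lift _ _ _ m1 _ h)).
elim/palg_generated => [g|k|x y Hx Hy|x y Hx Hy].
- by rewrite ig rg.
- by rewrite (linZ il) (linZ rl) i1 r1.
- by rewrite (linD il) (linD rl) Hx Hy.
by rewrite iM rM Hx Hy.
Qed.

Let i_deg a : gr 0 (i a) = i a.
Proof.
elim/palg_generated: a => [g|k|x y Hx Hy|x y Hx Hy].
- by rewrite ig pdga_gen_deg.
- by rewrite (linZ il) i1 gr_scale gr_one.
- by rewrite (linD il) gr_add Hx Hy.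
by rewrite iM -[0%N]/(0 + 0)%N gr_mul.
Qed.

Let gr0_img (w : W) : exists a, gr 0 w = i a.
Proof.
elim/pdga_generated: w => [g|g|k|x y [a Ha] [b Hb]|x y [a Ha] [b Hb]].
- by exists (palg_gen m0 g); rewrite ig pdga_gen_deg.
- by exists 0; rewrite (lin0 il) gr0_dif.
- by exists k%:A; rewrite (linZ il) i1 gr_scale gr_one.
- by exists (a + b); rewrite (linD il) gr_add Ha Hb.
by exists (a * b); rewrite iM gr_mulE big_ord1 Ha Hb.
Qed.

Let form1 (s : seq (A * A)) : W := \sum_(p <- s) i p.1 * dif (i p.2).

Let gr1_img (w : W) : exists s, gr 1 w = form1 s.
Proof.
have c0 (x : W) : gr 0 x = x -> exists s, gr 1 x = form1 s.
  by move=> <-; exists [::]; rewrite /form1 big_nil gr_gr.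
elim/pdga_generated: w => [g|g|k|x y [s Hs] [t Ht]|x y [s Hs] [t Ht]].
- by apply: c0; exact: pdga_gen_deg.
- exists [:: (1, palg_gen m0 g)].
  by rewrite /form1 big_seq1 i1 mul1r /= ig grS_dif pdga_gen_deg.
- by apply: c0; rewrite gr_scale gr_one.
- by exists (s ++ t); rewrite gr_add Hs Ht /form1 big_cat.
have [a Ha] := gr0_img x; have [b Hb] := gr0_img y.
exists ([seq (a * p.1, p.2) | p <- t] ++
        ([seq (p.1, p.2 * b) | p <- s] ++ [seq (- p.1 * p.2, b) | p <- s])).
rewrite gr_mulE big_ord_recr big_ord1 /= Ha Hb Hs Ht /form1 !big_cat !big_map.
congr (_ + _).
  by rewrite mulr_sumr; apply: eq_bigr => p _; rewrite iM mulrA.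
rewrite mulr_suml; apply: (etrans _ (big_split _ _ _ _ _)).
apply: eq_bigr => p _ /=.
have sg : sgn (i p.2) = i p.2 by rewrite (sgn_homog (i_deg _)) scale1r.
rewrite !iM (linN il) dif_mul sg mulrDr !mulrA -addrA.
by rewrite !mulNr subrr addr0.
Qed.

Lemma presented_exterior : exterior_algebra i.
Proof.
split.
- by case: palg_to_pdga_map.
- exact: presented_inj.
- move=> w; split=> [<-|[a ->]]; [exact: gr0_img|exact: i_deg].
- move=> w; split=> [<-|[s ->]]; first exact: gr1_img.
  rewrite gr_sum; apply: eq_bigr => p _; rewrite -[1%N]/(0 + 1)%N gr_mul //.
  by rewrite grS_dif i_deg.
move=> P P0 P1 PD PM; apply: pdga_generated => //.
- by move=> g; apply: P0; exact: pdga_gen_deg.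
- by move=> g; apply: P1; rewrite grS_dif pdga_gen_deg.
by move=> k; apply: P0; rewrite gr_scale gr_one.
Qed.

End PresentedExterior.

Declare Scope term_scope.
Delimit Scope term_scope with T.
Bind Scope term_scope with term.
Local Notation "s + t" := (Add s t) : term_scope.
Local Notation "s * t" := (Mul s t) : term_scope.
Local Notation "k *: t" := (Mul (Cst k%R) t) : term_scope.
Local Notation "- t" := (Mul (Cst (-1)%R) t) : term_scope.
Local Notation "s - t" := (Add s (- t)) : term_scope.
Local Notation "0" := (Cst 0%R) : term_scope.
Local Notation "1" := (Cst 1%R) : term_scope.
Local Notation "\sum_ i t" := (\big[Add/Cst 0%R]_i t%T) : term_scope.
Local Notation "\sum_ ( i < n ) t" :=
  (\big[Add/Cst 0%R]_(i < n) t%T) : term_scope.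

Local Notation i1 := (ord0 : 'I_2).
Local Notation i2 := (ord_max : 'I_2).

Section QuantumGroups.
Variables (K : fieldType) (q : K).

(* R i j k l is the entry of R with upper indices i, k and lower indices j, l. *)
Definition Rmat (i j k l : 'I_2) : K :=
  if (i == j) && (k == l) then (if i == k then q else 1)
  else if [&& i == i1, j == i2, k == i2 & l == i1] then q - q^-1
  else 0.

Inductive gl2_gen := Tgen of 'I_2 & 'I_2 | Dinv.

Section Relations.
Let a : term K gl2_gen := Gen (Tgen i1 i1).
Let b : term K gl2_gen := Gen (Tgen i1 i2).
Let c : term K gl2_gen := Gen (Tgen i2 i1).
Let d : term K gl2_gen := Gen (Tgen i2 i2).
Let D := (a * d - q^-1 *: (b * c))%T.
Let D' : term K gl2_gen := Gen Dinv.

Inductive gl2_rel : term K gl2_gen -> term K gl2_gen -> Prop :=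
| gl2_ba : gl2_rel (b * a) (q *: (a * b))
| gl2_ca : gl2_rel (c * a) (q *: (a * c))
| gl2_db : gl2_rel (d * b) (q *: (b * d))
| gl2_dc : gl2_rel (d * c) (q *: (c * d))
| gl2_cb : gl2_rel (c * b) (b * c)
| gl2_da : gl2_rel (d * a - a * d) ((q - q^-1) *: (b * c))
| gl2_DDinv : gl2_rel (D * D') 1
| gl2_DinvD : gl2_rel (D' * D) 1.
End Relations.

Section OmegaRelations.
Let t i j : term K (gl2_gen + gl2_gen) := Gen (inl (Tgen i j)).
Let dt i j : term K (gl2_gen + gl2_gen) := Gen (inr (Tgen i j)).

(* The relations of D^-1 with forms follow from those of D, and those of its   *)
(* differential from the Leibniz rule.                                         *)
Inductive gl2_omega_rel :
    term K (gl2_gen + gl2_gen) -> term K (gl2_gen + gl2_gen) -> Prop :=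
| gl2_omega_alg s s' :
    gl2_rel s s' -> gl2_omega_rel (term_inl s) (term_inl s')
| gl2_omega_dt_t i j k l :
    gl2_omega_rel (dt i j * t k l)
      (\sum_(p < 2) \sum_(r < 2) \sum_(n < 2) \sum_(m < 2)
         (Rmat k p i r * Rmat m j n l) *: (t p n * dt r m))
| gl2_omega_dt_dt i j k l :
    gl2_omega_rel (dt i j * dt k l)
      (- \sum_(p < 2) \sum_(r < 2) \sum_(n < 2) \sum_(m < 2)
         (Rmat k p i r * Rmat m j n l) *: (dt p n * dt r m)).
End OmegaRelations.

Inductive plane_rel : term K 'I_2 -> term K 'I_2 -> Prop :=
| plane_xx : plane_rel (Gen i2 * Gen i1) (q *: (Gen i1 * Gen i2)).

Section PlaneOmegaRelations.
Let x i : term K ('I_2 + 'I_2) := Gen (inl i).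
Let dx i : term K ('I_2 + 'I_2) := Gen (inr i).

Inductive plane_omega_rel :
    term K ('I_2 + 'I_2) -> term K ('I_2 + 'I_2) -> Prop :=
| plane_omega_alg s s' :
    plane_rel s s' -> plane_omega_rel (term_inl s) (term_inl s')
| plane_omega_dx_x i : plane_omega_rel (dx i * x i) (q ^+ 2 *: (x i * dx i))
| plane_omega_dx1_x2 : plane_omega_rel (dx i1 * x i2) (q *: (x i2 * dx i1))
| plane_omega_dx2_x1 : plane_omega_rel (dx i2 * x i1)
    (q *: (x i1 * dx i2) + (q ^+ 2 - 1) *: (x i2 * dx i1))
| plane_omega_dx_dx i : plane_omega_rel (dx i * dx i) 0
| plane_omega_dx2_dx1 :
    plane_omega_rel (dx i2 * dx i1) (- (q^-1 *: (dx i1 * dx i2))).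
End PlaneOmegaRelations.

(* true stands for D, false for its inverse *)
Inductive gl1_rel : term K bool -> term K bool -> Prop :=
| gl1_DDinv : gl1_rel (Gen true * Gen false) 1
| gl1_DinvD : gl1_rel (Gen false * Gen true) 1.

Section GL1OmegaRelations.
Let D : term K (bool + bool) := Gen (inl true).
Let dD : term K (bool + bool) := Gen (inr true).

Inductive gl1_omega_rel :
    term K (bool + bool) -> term K (bool + bool) -> Prop :=
| gl1_omega_alg s s' :
    gl1_rel s s' -> gl1_omega_rel (term_inl s) (term_inl s')
| gl1_omega_dD_D : gl1_omega_rel (dD * D) (q ^+ 2 *: (D * dD))
| gl1_omega_dD_dD : gl1_omega_rel (dD * dD) 0.
End GL1OmegaRelations.

Definition gl2_char (g : gl2_gen) : K^o :=
  match g with Tgen i j => (i == j)%:R | Dinv => 1 end.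

Lemma gl2_char_rel s t : gl2_rel s t -> eval gl2_char s = eval gl2_char t.
Proof.
by case=> /=; rewrite ?(mulr0, mul0r, mulr1, mul1r, scaler0, addr0, scale1r,
  scaleN1r, subrr, oppr0).
Qed.

Lemma gl2_char_omega_rel s t : gl2_omega_rel s t ->
  eval (dgen gl2_char) s = eval (dgen gl2_char) t.
Proof.
case=> [{}s {}t /gl2_char_rel|i j k l|i j k l] /=; first by rewrite !eval_inl.
  rewrite mul0r; symmetry; rewrite eval_sum big1 // => p _.
  rewrite eval_sum big1 // => r _; rewrite eval_sum big1 // => n _.
  by rewrite eval_sum big1 // => m _ /=; rewrite !mulr0.
rewrite mul0r; symmetry; rewrite eval_sum big1 ?mulr0 // => p _.
rewrite eval_sum big1 // => r _; rewrite eval_sum big1 // => n _.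
by rewrite eval_sum big1 // => m _ /=; rewrite !mulr0.
Qed.

Definition plane_char (i : 'I_2) : K^o := 0.

Lemma plane_char_rel s t : plane_rel s t -> eval plane_char s = eval plane_char t.
Proof. by case=> /=; rewrite !mulr0. Qed.

Lemma plane_char_omega_rel s t : plane_omega_rel s t ->
  eval (dgen plane_char) s = eval (dgen plane_char) t.
Proof.
case=> [{}s {}t /plane_char_rel|i||| |] /=; rewrite ?eval_inl //;
  by rewrite ?regular_dif /plane_char ?(mulr0, mul0r, scale0r, addr0).
Qed.

Definition gl1_char (g : bool) : K^o := 1.

Lemma gl1_char_rel s t : gl1_rel s t -> eval gl1_char s = eval gl1_char t.
Proof. by case=> /=; rewrite scale1r mulr1. Qed.

Lemma gl1_char_omega_rel s t : gl1_omega_rel s t ->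
  eval (dgen gl1_char) s = eval (dgen gl1_char) t.
Proof.
case=> [{}s {}t /gl1_char_rel| |] /=; rewrite ?eval_inl //;
  by rewrite ?regular_dif ?(mulr0, mul0r, scale0r).
Qed.

Definition GL2 := palg (AlgModel gl2_char_rel).
Definition OmegaGL2 := pdga (DGAModel (fun=> erefl) gl2_char_omega_rel).
Definition plane := palg (AlgModel plane_char_rel).
Definition OmegaPlane := pdga (DGAModel (fun=> erefl) plane_char_omega_rel).
Definition GL1 := palg (AlgModel gl1_char_rel).
Definition OmegaGL1 := pdga (DGAModel (fun=> erefl) gl1_char_omega_rel).

HB.instance Definition _ := GradedAlgebra.on GL2.
HB.instance Definition _ := GradedAlgebra.on plane.
HB.instance Definition _ := GradedAlgebra.on GL1.
HB.instance Definition _ := DGA.on OmegaGL2.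
HB.instance Definition _ := DGA.on OmegaPlane.
HB.instance Definition _ := DGA.on OmegaGL1.

Definition tG (i j : 'I_2) : GL2 := palg_gen _ (Tgen i j).
Definition DinvG : GL2 := palg_gen _ Dinv.
Definition xP (i : 'I_2) : plane := palg_gen _ i.
Definition qdet : GL2 := tG i1 i1 * tG i2 i2 - q^-1 *: (tG i1 i2 * tG i2 i1).

Definition omegaGL2 : GL2 -> OmegaGL2 := palg_lift (fun g => pdga_gen _ g : OmegaGL2).
Definition omegaPlane : plane -> OmegaPlane :=
  palg_lift (fun g => pdga_gen _ g : OmegaPlane).
Definition omegaGL1 : GL1 -> OmegaGL1 := palg_lift (fun g => pdga_gen _ g : OmegaGL1).

Lemma omegaPlane_exterior : exterior_algebra omegaPlane.
Proof.
apply: presented_exterior; first exact: plane_omega_alg.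
move=> B h d0 hrel _ _ [s t /hrel|i|||i|] /=; rewrite ?eval_inl //;
  by rewrite !d0 ?(mulr0, mul0r, scaler0, scale0r, addr0).
Qed.

Lemma omegaGL1_exterior : exterior_algebra omegaGL1.
Proof.
apply: presented_exterior; first exact: gl1_omega_alg.
move=> B h d0 hrel _ _ [s t /hrel| |] /=; rewrite ?eval_inl //;
  by rewrite !d0 ?(mulr0, mul0r, scaler0, scale0r, addr0).
Qed.

Definition DeltaGL2 : GL2 -> tens GL2 GL2 :=
  palg_lift (fun g => match g with
    | Tgen i j => \sum_k tG i k ⊗ tG k j
    | Dinv => DinvG ⊗ DinvG
    end : tens GL2 GL2).

Definition DeltaR : plane -> tens plane GL2 :=
  palg_lift (fun i => \sum_j xP j ⊗ tG j i : tens plane GL2).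

Definition det_incl : GL1 -> GL2 :=
  palg_lift (fun g : bool => if g then qdet else DinvG).

Definition coaction_condition (W : dgaType K) (i : GL2 -> W) : Prop :=
  differentiable_coaction DeltaGL2 i omegaPlane DeltaR.

Definition det_condition (W : dgaType K) (i : GL2 -> W) : Prop :=
  differentiable_map omegaGL1 i det_incl.

End QuantumGroups.

(* Main.v *)
Require Import Defs.
From HB Require Import structures.
From mathcomp Require Import all_boot all_order all_algebra generic_quotient.
From mathcomp Require Import boolp reals complex.

(** Applied to the relations of the quantum plane, the coaction forces the
    relations between dt and t up to one unknown 1-form: with
    theta = (da) d - d (da), the differences between the two sides of
    (dt_1) t_2 = R_21 t_2 dt_1 R are multiples of theta. Associativity of the
    products dt t t then gives theta t = q^2 t theta, so that the relation
    (dD) D = q^2 D dD reduces to q^2 (1 + q^2) D theta = 0, whence theta = 0.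
    The relations between 2-forms are the differentials of those between dt
    and t.

    All finite identities between generators are proved by reduction to normal
    form. The 1-forms are shown to be free on dt^i_j by means of a model: a
    DGA of triangular matrices in which d is the difference of two algebra
    maps. The antipode of the super Hopf algebra is the DGA map to the graded
    opposite which sends t to its inverse. *)
Set Implicit Arguments.
Unset Strict Implicit.
Unset Printing Implicit Defensive.

Import GRing.Theory.
Local Open Scope ring_scope.

Local Notation i1 := (ord0 : 'I_2).
Local Notation i2 := (ord_max : 'I_2).

(** * A normal form for noncommutative expressions *)

(** The 16 products dt^i_j t^k_l are subject to 12 linear equations from the coaction and to 4 more
    from applying d to the relations for ca, db, cb and da. The system has rank 15. Its kernel is
    spanned by eps (x) eps, where eps is the q-antisymmetric tensor with entries 1 and -q^-1 that
    also defines the q-determinant. Hence exactly one unknown form remains, and only the determinant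
    condition sees it.

    The assumption q^2 != -1 always enters through the factor 1 + q^2: as the determinant of the 2 x
    2 systems hidden in the 16 equations, as a coefficient of D theta, and in x = -q^2 x for x =
    (dt^i_j)^2.

    No basis of any of the algebras is established. The rewriting is only proved sound, so
    termination and confluence are not at issue. Where linear independence is needed, for the
    1-forms and for the monomials x_1^2, x_1 x_2, x_2^2, it is read off explicit matrices, which
    works at roots of unity as well. *)

Inductive qscal : Type :=
| SPow of int
| SZero
| SOne
| SOpp of qscal
| SAdd of qscal & qscal
| SMul of qscal & qscal.

Inductive qexp : Type :=
| QGen of nat
| QZero
| QOne
| QOpp of qexp
| QAdd of qexp & qexp
| QMul of qexp & qexp
| QScale of qscal & qexp.

(* A monomial (c, (e, w)) stands for c q^e times the word w. *)
Definition mono : Type := int * (int * seq nat).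

Fixpoint qins (c : int) (k : int * seq nat) (p : seq mono) : seq mono :=
  if p is m :: p' then
    if m.2 == k then
      let c' := c + m.1 in if c' == 0 then p' else (c', k) :: p'
    else m :: qins c k p'
  else [:: (c, k)].

Definition qadd (p r : seq mono) : seq mono :=
  foldr (fun m acc => qins m.1 m.2 acc) r p.

Definition qscale (c e : int) (p : seq mono) : seq mono :=
  [seq (c * m.1, (e + m.2.1, m.2.2)) | m <- p].

Fixpoint snorm (s : qscal) : seq (int * int) :=
  match s with
  | SPow e => [:: (1, e)]
  | SZero => [::]
  | SOne => [:: (1, 0)]
  | SOpp s => [seq (- m.1, m.2) | m <- snorm s]
  | SAdd s t => snorm s ++ snorm t
  | SMul s t => [seq (m.1 * m'.1, m.2 + m'.2) | m <- snorm s, m' <- snorm t]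
  end.

Section Normalize.
Variable rule : nat -> nat -> option (seq mono).

Definition qlmulp (lm : nat -> seq nat -> seq mono) (z : nat) (p : seq mono) :
    seq mono :=
  foldr (fun m acc => qadd (qscale m.1 m.2.1 (lm z m.2.2)) acc) [::] p.

Definition qwmulp (lm : nat -> seq nat -> seq mono) (w : seq nat) (p : seq mono) :
    seq mono :=
  foldr (qlmulp lm) p w.

Definition qmulp (lm : nat -> seq nat -> seq mono) (p r : seq mono) : seq mono :=
  foldr (fun m acc => qadd (qscale m.1 m.2.1 (qwmulp lm m.2.2 r)) acc) [::] p.

(* Left multiplication of the normal word w by the letter x; n is fuel. *)
Fixpoint qlmul (n : nat) (x : nat) (w : seq nat) : seq mono :=
  match n, w with
  | n'.+1, y :: w' =>
    if rule x y is Some r then qmulp (qlmul n') r [:: (1, (0, w'))]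
    else [:: (1, (0, x :: w))]
  | _, _ => [:: (1, (0, x :: w))]
  end.

Fixpoint qnorm (n : nat) (e : qexp) : seq mono :=
  match e with
  | QGen x => [:: (1, (0, [:: x]))]
  | QZero => [::]
  | QOne => [:: (1, (0, [::]))]
  | QOpp e => qscale (-1) 0 (qnorm n e)
  | QAdd e f => qadd (qnorm n e) (qnorm n f)
  | QMul e f => qmulp (qlmul n) (qnorm n e) (qnorm n f)
  | QScale s e =>
    let p := qnorm n e in
    foldr (fun m acc => qadd (qscale m.1 m.2 p) acc) [::] (snorm s)
  end.

End Normalize.

(** The empty rule set merely expands the right-hand side into words; these are reduced when the
    rule is applied. *)
Definition qcompile (rule : nat -> nat -> option qexp) (x y : nat) :
    option (seq mono) :=
  omap (qnorm (fun _ _ => None) 0) (rule x y).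

(** A poor rule set or too little fuel (here 100) can make the test fail, but never succeed
    wrongly. *)
Definition qequal (rule : nat -> nat -> option qexp) (e f : qexp) : bool :=
  nilp (qnorm (qcompile rule) 100 (QAdd e (QOpp f))).

Fixpoint qlookup (rules : seq (nat * nat * qexp)) (x y : nat) : option qexp :=
  if rules is r :: rules' then
    if (r.1.1 == x) && (r.1.2 == y) then Some r.2 else qlookup rules' x y
  else None.

Section Eval.
Variables (K : fieldType) (q : K).

Fixpoint seval (s : qscal) : K :=
  match s with
  | SPow e => q ^ e
  | SZero => 0
  | SOne => 1
  | SOpp s => - seval s
  | SAdd s t => seval s + seval t
  | SMul s t => seval s * seval t
  end.

Fixpoint qeval (B : algType K) (env : nat -> B) (e : qexp) : B :=
  match e with
  | QGen x => env x
  | QZero => 0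
  | QOne => 1
  | QOpp e => - qeval env e
  | QAdd e f => qeval env e + qeval env f
  | QMul e f => qeval env e * qeval env f
  | QScale s e => seval s *: qeval env e
  end.

Definition rules_ok (B : algType K) (env : nat -> B)
    (rule : nat -> nat -> option qexp) : Prop :=
  forall x y e, rule x y = Some e -> env x * env y = qeval env e.

(** Unlike [rules_ok], this simplifies to a plain conjunction of equations, to which the relations
    can be applied by rewriting. *)
Fixpoint table_ok (B : algType K) (env : nat -> B)
    (rules : seq (nat * nat * qexp)) : Prop :=
  if rules is r :: rules' then
    env r.1.1 * env r.1.2 = qeval env r.2 /\ table_ok env rules'
  else True.

Lemma table_rules_ok (B : algType K) (env : nat -> B) rules :
  table_ok env rules -> rules_ok env (qlookup rules).
Proof.
elim: rules => [_ x y e //|[[x0 y0] e0] rules IH /= [H0 H] x y e /=].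
by case: ifP => [/andP[/eqP <- /eqP <-] [<-]//|_]; apply: IH.
Qed.

Lemma table_ok_cat (B : algType K) (env : nat -> B) s t :
  table_ok env s /\ table_ok env t <-> table_ok env (s ++ t).
Proof. by elim: s => [|r s IH] /=; [tauto|move: IH; tauto]. Qed.

Section Sound.
Hypothesis q0 : q != 0.
Variables (B : algType K) (env : nat -> B).

Definition weval (w : seq nat) : B := foldr (fun x y => env x * y) 1 w.
Definition meval (m : mono) : B := (m.1%:~R * q ^ m.2.1) *: weval m.2.2.
Definition peval (p : seq mono) : B := \sum_(m <- p) meval m.

Lemma peval_cons m p : peval (m :: p) = meval m + peval p.
Proof. exact: big_cons. Qed.

Lemma peval_nil : peval [::] = 0.
Proof. exact: big_nil. Qed.

Lemma peval_word w : peval [:: (1, (0, w))] = weval w.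
Proof.
by rewrite peval_cons peval_nil addr0 /meval expr0z mulr1 scale1r.
Qed.

Lemma peval_ins c k p : peval (qins c k p) = meval (c, k) + peval p.
Proof.
elim: p => [|m p IH] /=; first by rewrite peval_cons.
case: eqP => [<-|_]; last by rewrite !peval_cons IH addrCA.
have E : meval (c, m.2) + meval m = meval (c + m.1, m.2).
  by rewrite /meval -scalerDl -mulrDl -intrD.
case: eqP => [z|_]; rewrite !peval_cons addrA E //.
by rewrite z /meval mul0r scale0r add0r.
Qed.

Lemma peval_add p r : peval (qadd p r) = peval p + peval r.
Proof.
elim: p => [|m p IH] /=; first by rewrite peval_nil add0r.
by rewrite peval_ins IH peval_cons addrA; case: m.
Qed.

Lemma peval_scale c e p : peval (qscale c e p) = (c%:~R * q ^ e) *: peval p.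
Proof.
rewrite /peval /qscale big_map scaler_sumr; apply: eq_bigr => m _.
by rewrite /meval /= scalerA intrM expfzDr // mulrACA.
Qed.

Lemma snorm_eval s : \sum_(m <- snorm s) m.1%:~R * q ^ m.2 = seval s.
Proof.
elim: s => [e|||s IH|s IHs t IHt|s IHs t IHt] /=.
- by rewrite big_seq1 mul1r.
- exact: big_nil.
- by rewrite big_seq1 mul1r expr0z.
- rewrite big_map -IH -sumrN; apply: eq_bigr => m _.
  by rewrite /= intrN mulNr.
- by rewrite big_cat IHs IHt.
rewrite big_allpairs_dep /= -IHs -IHt big_distrl /=; apply: eq_bigr => m _.
rewrite big_distrr /=; apply: eq_bigr => m' _.
by rewrite intrM expfzDr // mulrACA.
Qed.

Lemma peval_fold (I : Type) (s : seq I) (c e : I -> int) (F : I -> seq mono) :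
  peval (foldr (fun i acc => qadd (qscale (c i) (e i) (F i)) acc) [::] s)
  = \sum_(i <- s) ((c i)%:~R * q ^ e i) *: peval (F i).
Proof.
elim: s => [|i s IH] /=; first by rewrite peval_nil big_nil.
by rewrite peval_add peval_scale IH big_cons.
Qed.

Section Rules.
Variable lm : nat -> seq nat -> seq mono.
Hypothesis lmP : forall x w, peval (lm x w) = env x * weval w.

Lemma peval_lmulp x p : peval (qlmulp lm x p) = env x * peval p.
Proof.
rewrite /qlmulp peval_fold /peval mulr_sumr; apply: eq_bigr => m _.
by rewrite -/(peval _) lmP /meval scalerAr.
Qed.

Lemma peval_wmulp w p : peval (qwmulp lm w p) = weval w * peval p.
Proof.
by elim: w => [|x w IH] /=; rewrite ?mul1r // peval_lmulp IH mulrA.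
Qed.

Lemma peval_mulp p r : peval (qmulp lm p r) = peval p * peval r.
Proof.
rewrite /qmulp peval_fold {2}/peval mulr_suml; apply: eq_bigr => m _.
by rewrite peval_wmulp /meval scalerAl.
Qed.

End Rules.

(** True for every amount of fuel: a word that is left unreduced still has the right value. *)
Lemma peval_lmul rule n x w :
  (forall x y r, rule x y = Some r -> env x * env y = peval r) ->
  peval (qlmul rule n x w) = env x * weval w.
Proof.
move=> ruleP.
elim: n x w => [|n IH] x [|y w] /=; rewrite ?peval_word //.
case E: (rule x y) => [r|]; last by rewrite peval_word.
by rewrite (peval_mulp IH) peval_word /= mulrA (ruleP _ _ _ E).
Qed.

Lemma peval_norm rule n e :
  (forall x y r, rule x y = Some r -> env x * env y = peval r) ->
  peval (qnorm rule n e) = qeval env e.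
Proof.
move=> ruleP; have lmP x w := peval_lmul n x w ruleP.
elim: e => [x|||e IH|e IHe f IHf|e IHe f IHf|s e IH] /=.
- by rewrite peval_word /= mulr1.
- exact: peval_nil.
- exact: peval_word.
- by rewrite peval_scale IH expr0z mulr1 scaleN1r.
- by rewrite peval_add IHe IHf.
- by rewrite (peval_mulp lmP) IHe IHf.
rewrite peval_fold; under eq_bigr do rewrite IH.
by rewrite -scaler_suml snorm_eval.
Qed.

Lemma qequal_sound rule e f :
  rules_ok env rule -> qequal rule e f -> qeval env e = qeval env f.
Proof.
move=> ok /nilP H; apply/eqP; rewrite -subr_eq0; apply/eqP.
rewrite -[LHS]/(qeval env (QAdd e (QOpp f))).
rewrite -(@peval_norm (qcompile rule) 100); first by rewrite H peval_nil.
move=> x y r; rewrite /qcompile; case E: (rule x y) => [g|] //= -[<-].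
by rewrite (ok _ _ _ E) peval_norm.
Qed.

End Sound.
End Eval.

(** * Maps of tensor products and super Hopf algebras from generators *)

Section AlgebraMaps.
Variable K : fieldType.

Lemma alg_map_comp (A B C : algType K) (f : B -> C) (g : A -> B) :
  alg_map f -> alg_map g -> alg_map (fun x => f (g x)).
Proof.
by move=> [fl f1 fM] [gl g1 gM]; split=> [k x y||x y]; rewrite ?gl ?fl ?g1 ?f1 ?gM ?fM.
Qed.

Lemma eval_alg_map (G : Type) (A B : algType K) (f : A -> B) (h : G -> A) t :
  alg_map f -> f (eval h t) = eval (fun g => f (h g)) t.
Proof.
move=> [fl f1 fM]; elim: t => //= [k|s IHs t IHt|s IHs t IHt].
- by rewrite (linZ fl) f1.
- by rewrite (linD fl) IHs IHt.
by rewrite fM IHs IHt.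
Qed.

Definition graded_map (A B : gralgType K) (f : A -> B) : Prop :=
  forall n x, f (gr n x) = gr n (f x).

Definition generated_by (A : algType K) (G : Type) (gen : G -> A) : Prop :=
  forall P : A -> Prop, (forall g, P (gen g)) -> (forall k, P k%:A) ->
    (forall x y, P x -> P y -> P (x + y)) ->
    (forall x y, P x -> P y -> P (x * y)) -> forall x, P x.

Lemma alg_map_eq (A B : algType K) (G : Type) (gen : G -> A) (f g : A -> B) :
  generated_by gen -> alg_map f -> alg_map g ->
  (forall x, f (gen x) = g (gen x)) -> forall x, f x = g x.
Proof.
move=> ind [fl f1 fM] [gl g1 gM] H; apply: ind => // [k|x y Hx Hy|x y Hx Hy].
- by rewrite (linZ fl) (linZ gl) f1 g1.
- by rewrite (linD fl) (linD gl) Hx Hy.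
by rewrite fM gM Hx Hy.
Qed.

Lemma gr_degree (A : gralgType K) n m (x : A) :
  gr n x = x -> gr m x = if m == n then x else 0.
Proof. by move=> hx; rewrite -hx gr_gr hx. Qed.

Lemma graded_map_gen (A B : gralgType K) (G : Type) (gen : G -> A) (deg : G -> nat)
    (f : A -> B) :
  generated_by gen -> alg_map f ->
  (forall g, gr (deg g) (gen g) = gen g) ->
  (forall g, gr (deg g) (f (gen g)) = f (gen g)) -> graded_map f.
Proof.
move=> ind [fl f1 fM] hg hfg n x; move: n.
elim/ind: x => [g n|k n|x y Hx Hy n|x y Hx Hy n].
- rewrite (gr_degree _ (hg g)) (gr_degree _ (hfg g)).
  by case: eqP => // _; rewrite (lin0 fl).
- rewrite gr_scale !(linZ fl) gr_scale f1 (gr_degree _ gr_one) (gr_degree _ (@gr_one K B)).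
  by case: eqP; rewrite ?f1 ?(lin0 fl).
- by rewrite !(gr_add, linD fl) Hx Hy.
rewrite fM !gr_mulE (lin_sum fl); apply: eq_bigr => i _.
by rewrite fM Hx Hy.
Qed.

End AlgebraMaps.

Section TensorMaps.
Variable K : fieldType.

Lemma tpureDl (U V : lmodType K) (u u' : U) (v : V) :
  (u + u') ⊗ v = u ⊗ v + u' ⊗ v.
Proof. exact: (linD ((tpure_bilin U V).1 v)). Qed.

Lemma tpureDr (U V : lmodType K) (u : U) (v v' : V) :
  u ⊗ (v + v') = u ⊗ v + u ⊗ v'.
Proof. exact: (linD ((tpure_bilin U V).2 u)). Qed.

Lemma tpureZl (U V : lmodType K) k (u : U) (v : V) :
  (k *: u) ⊗ v = k *: (u ⊗ v).
Proof. exact: (linZ ((tpure_bilin U V).1 v)). Qed.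

Lemma tpureZr (U V : lmodType K) k (u : U) (v : V) :
  u ⊗ (k *: v) = k *: (u ⊗ v).
Proof. exact: (linZ ((tpure_bilin U V).2 u)). Qed.

Lemma tpure0l (U V : lmodType K) (v : V) : (0 : U) ⊗ v = 0.
Proof. exact: (lin0 ((tpure_bilin U V).1 v)). Qed.

Section Tmap.
Variables (U V U' V' : lmodType K) (f : U -> U') (g : V -> V').
Hypotheses (fl : linear f) (gl : linear g).

Lemma tmap_bilin : bilin (fun u v => f u ⊗ g v).
Proof.
split=> w k x y; first by rewrite fl tpureDl tpureZl.
by rewrite gl tpureDr tpureZr.
Qed.

Lemma tmap_linear : linear (tmap f g).
Proof. exact: (tlift_linear tmap_bilin). Qed.

Lemma tmap_pure u v : tmap f g (u ⊗ v) = f u ⊗ g v.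
Proof. by rewrite /tmap tlift_pure //; exact: tmap_bilin. Qed.

End Tmap.

Section TmapAlg.
Variables (A B A' B' : gralgType K) (f : A -> A') (g : B -> B').
Hypotheses (fa : alg_map f) (ga : alg_map g).
Hypotheses (fgr : graded_map f) (ggr : graded_map g).

Let fl : linear f. Proof. by case: fa. Qed.
Let gl : linear g. Proof. by case: ga. Qed.

(** Preservation of degrees makes the Koszul signs of the two products agree. *)
Lemma tmap_alg : alg_map (tmap f g).
Proof.
have tl := tmap_linear fl gl; case: fa => _ f1 fM; case: ga => _ g1 gM.
split=> // [|x y]; first by rewrite [LHS]tmap_pure // f1 g1.
elim/tens_homog_ind: x => [x x' Hx Hx'|m n a b ha hb].
  by rewrite mulrDl !(linD tl) Hx Hx' mulrDl.
elim/tens_homog_ind: y => [y y' Hy Hy'|m' n' c e hc he].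
  by rewrite mulrDr !(linD tl) Hy Hy' mulrDr.
have hgb : gr n (g b) = g b by rewrite -ggr hb.
have hfc : gr m' (f c) = f c by rewrite -fgr hc.
rewrite [a ⊗ b * _](tens_mul_homog _ _ hb hc) (linZ tl) !tmap_pure //.
by rewrite [f a ⊗ g b * _](tens_mul_homog _ _ hgb hfc) fM gM.
Qed.

Lemma tmap_graded : graded_map (tmap f g).
Proof.
have tl := tmap_linear fl gl => n x.
elim/tens_homog_ind: x => [x x' Hx Hx'|m m' a b ha hb].
  by rewrite gr_add !(linD tl) gr_add Hx Hx'.
have hfa : gr m (f a) = f a by rewrite -fgr ha.
have hgb : gr m' (g b) = g b by rewrite -ggr hb.
rewrite (gr_degree _ (tens_pure_homog ha hb)) tmap_pure //.
rewrite (gr_degree _ (tens_pure_homog hfa hgb)).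
by case: eqP => _; rewrite ?(lin0 tl) ?tmap_pure.
Qed.

End TmapAlg.

Section Assoc.
Variables (U V W : lmodType K).

Lemma tassoc_bilin1 (w : W) : bilin (fun (u : U) (v : V) => u ⊗ (v ⊗ w)).
Proof.
split=> z k x y; first by rewrite tpureDl tpureZl.
by rewrite tpureDl tpureZl tpureDr tpureZr.
Qed.

Lemma tassoc_bilin :
  bilin (fun (x : tens U V) (w : W) => tlift (fun u v => u ⊗ (v ⊗ w)) x).
Proof.
split=> z; first exact: (tlift_linear (tassoc_bilin1 z)).
apply: tlift_param => u v k x y.
by rewrite tpureDr tpureZr tpureDr tpureZr.
Qed.

Lemma tassoc_linear : linear (@tassoc K U V W).
Proof. exact: (tlift_linear tassoc_bilin). Qed.

Lemma tassoc_pure u v w :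
  @tassoc K U V W ((u ⊗ v) ⊗ w) = u ⊗ (v ⊗ w).
Proof.
rewrite /tassoc tlift_pure; last exact: tassoc_bilin.
by rewrite tlift_pure //; exact: tassoc_bilin1.
Qed.

End Assoc.

Lemma tassoc_alg (A B C : gralgType K) : alg_map (@tassoc K A B C).
Proof.
have tl := @tassoc_linear A B C.
split=> // [|x y]; first by rewrite [LHS]tassoc_pure.
elim/tens_homog_ind: x => [x x' Hx Hx'|m n ab c hab hc].
  by rewrite mulrDl !(linD tl) Hx Hx' mulrDl.
elim/tens_homog_ind: y => [y y' Hy Hy'|m' n' ab' c' hab' hc'].
  by rewrite mulrDr !(linD tl) Hy Hy' mulrDr.
(* Only the total degree of [ab] is known. Written as [gr m ab], it can be split into pure tensors
   of homogeneous elements, of which those of another total degree contribute 0. *)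
rewrite -hab -hab'; elim/tens_homog_ind: ab {hab} => [x x' Hx Hx'|ma mb a b ha hb].
  by rewrite !(gr_add, tpureDl, mulrDl, linD tl) Hx Hx'.
elim/tens_homog_ind: ab' {hab'} => [x x' Hx Hx'|ma' mb' a' b' ha' hb'].
  by rewrite !(gr_add, tpureDl, mulrDr, linD tl) Hx Hx'.
rewrite (gr_degree _ (tens_pure_homog ha hb)).
rewrite (gr_degree _ (tens_pure_homog ha' hb')).
case: eqP => _; last by rewrite tpure0l mul0r (lin0 tl) mul0r.
case: eqP => [em'|_]; last by rewrite tpure0l mulr0 (lin0 tl) mulr0.
have hab' := tens_pure_homog ha' hb'; have hbc := tens_pure_homog hb hc.
rewrite [_ ⊗ c * _](tens_mul_homog _ _ hc hab') [a ⊗ b * _](tens_mul_homog _ _ hb ha').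
rewrite tpureZl !(linZ tl) !tassoc_pure.
rewrite [a ⊗ _ * _](tens_mul_homog _ _ hbc ha') [b ⊗ c * _](tens_mul_homog _ _ hc hb').
by rewrite tpureZr !scalerA -!exprD mulnDr mulnDl addnC addnA.
Qed.

End TensorMaps.

Section Counit.
Variables (K : fieldType) (A B : gralgType K) (eps : A -> K^o).
Hypotheses (ea : alg_map eps) (egr : graded_map eps).

Let el : linear eps. Proof. by case: ea. Qed.

Lemma counitl_bilin : bilin (fun (a : A) (b : B) => (eps a : K) *: b).
Proof.
split=> z k x y; first by rewrite el scalerDl -scalerA.
by rewrite scalerDr !scalerA mulrC.
Qed.

Lemma counitr_bilin : bilin (fun (b : B) (a : A) => (eps a : K) *: b).
Proof. by have [? ?] := counitl_bilin; split. Qed.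

Lemma graded_functional n x : gr n x = x -> n != 0%N -> eps x = 0.
Proof.
move=> hx /negPf n0; rewrite -hx egr.
by rewrite (gr_degree n (erefl : gr 0 (eps x) = eps x)) n0.
Qed.

(** The sign (-1)^(|b||c|) in (a ⊗ b)(c ⊗ e) can differ from 1 only if |c| > 0, and then eps c =
    0. *)
Lemma counitl_alg : alg_map (tlift (fun (a : A) (b : B) => (eps a : K) *: b)).
Proof.
have tl := tlift_linear counitl_bilin; case: ea => _ e1 eM.
split=> // [|x y]; first by rewrite [LHS]tlift_pure ?e1 ?scale1r //; exact: counitl_bilin.
elim/tens_homog_ind: x => [x x' Hx Hx'|m n a b ha hb].
  by rewrite mulrDl !(linD tl) Hx Hx' mulrDl.
elim/tens_homog_ind: y => [y y' Hy Hy'|m' n' c e hc he].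
  by rewrite mulrDr !(linD tl) Hy Hy' mulrDr.
rewrite [a ⊗ b * _](tens_mul_homog _ _ hb hc) (linZ tl).
rewrite !(tlift_pure _ _ counitl_bilin) eM -scalerAl -scalerAr.
have [->|m'0] := eqVneq m' 0%N; first by rewrite muln0 scale1r scalerA.
by rewrite (graded_functional hc m'0) mulr0 !scale0r !scaler0.
Qed.

Lemma counitr_alg : alg_map (tlift (fun (b : B) (a : A) => (eps a : K) *: b)).
Proof.
have tl := tlift_linear counitr_bilin; case: ea => _ e1 eM.
split=> // [|x y]; first by rewrite [LHS]tlift_pure ?e1 ?scale1r //; exact: counitr_bilin.
elim/tens_homog_ind: x => [x x' Hx Hx'|m n a b ha hb].
  by rewrite mulrDl !(linD tl) Hx Hx' mulrDl.
elim/tens_homog_ind: y => [y y' Hy Hy'|m' n' c e hc he].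
  by rewrite mulrDr !(linD tl) Hy Hy' mulrDr.
rewrite [a ⊗ b * _](tens_mul_homog _ _ hb hc) (linZ tl).
rewrite !(tlift_pure _ _ counitr_bilin) eM -scalerAl -scalerAr.
have [->|n0] := eqVneq n 0%N; first by rewrite mul0n scale1r scalerA.
by rewrite (graded_functional hb n0) mul0r !scale0r !scaler0.
Qed.

End Counit.

Section HopfFromGenerators.
Variables (K : fieldType) (H : gralgType K) (G : Type) (gen : G -> H).
Variables (deg : G -> nat) (Delta : H -> tens H H) (eps : H -> K^o) (S : H -> H).
Hypothesis gen_ind : generated_by gen.
Hypothesis gen_deg : forall g, gr (deg g) (gen g) = gen g.
Hypotheses (Da : alg_map Delta) (Dgr : graded_map Delta).
Hypotheses (ea : alg_map eps) (egr : graded_map eps).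
Hypotheses (Sl : linear S) (S1 : S 1 = 1) (Sgr : graded_map S).
Hypothesis Smul : forall m n x y, gr m x = x -> gr n y = y ->
  S (x * y) = (-1) ^+ (m * n) *: (S y * S x).

Let lantip (X : tens H H) : H := tlift (fun a b => S a * b) X.
Let rantip (X : tens H H) : H := tlift (fun a b => a * S b) X.

Let Dl : linear Delta. Proof. by case: Da. Qed.
Let el : linear eps. Proof. by case: ea. Qed.

Lemma lantip_bilin : bilin (fun a b : H => S a * b).
Proof.
split=> z k x y; first by rewrite Sl mulrDl scalerAl.
by rewrite mulrDr scalerAr.
Qed.

Lemma rantip_bilin : bilin (fun a b : H => a * S b).
Proof.
split=> z k x y; first by rewrite mulrDl scalerAl.
by rewrite Sl mulrDr scalerAr.
Qed.

Let ll : linear lantip. Proof. exact: (tlift_linear lantip_bilin). Qed.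
Let rl : linear rantip. Proof. exact: (tlift_linear rantip_bilin). Qed.
Let lpure a b : lantip (a ⊗ b) = S a * b.
Proof. by rewrite /lantip tlift_pure //; exact: lantip_bilin. Qed.
Let rpure a b : rantip (a ⊗ b) = a * S b.
Proof. by rewrite /rantip tlift_pure //; exact: rantip_bilin. Qed.

(** Since S reverses products, S(ac) b e is S(c) (S(a) b) e up to sign, so the value on X ends up
    between S(c) and e. The sign depends on X only through its total degree, which [gr N X]
    fixes. *)
Lemma lantip_mul N X p c e : gr p c = c ->
  lantip (gr N X * (c ⊗ e)) = (-1) ^+ (N * p) *: (S c * lantip (gr N X) * e).
Proof.
move=> hc; elim/tens_homog_ind: X => [X Y HX HY|m n a b ha hb].
  by rewrite !gr_add mulrDl !(linD ll) HX HY mulrDr mulrDl scalerDr.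
rewrite (gr_degree N (tens_pure_homog ha hb)).
case: eqP => [->|_]; last by rewrite mul0r (lin0 ll) mulr0 mul0r scaler0.
rewrite [a ⊗ b * _](tens_mul_homog _ _ hb hc) (linZ ll) !lpure (Smul ha hc).
by rewrite -scalerAl scalerA -exprD mulnDl addnC !mulrA.
Qed.

Lemma rantip_mul N X p c e : gr p e = e ->
  rantip ((c ⊗ e) * gr N X) = (-1) ^+ (N * p) *: (c * rantip (gr N X) * S e).
Proof.
move=> he; elim/tens_homog_ind: X => [X Y HX HY|m n a b ha hb].
  by rewrite !gr_add mulrDr !(linD rl) HX HY mulrDr mulrDl scalerDr.
rewrite (gr_degree N (tens_pure_homog ha hb)).
case: eqP => [->|_]; last by rewrite mulr0 (lin0 rl) mulr0 mul0r scaler0.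
rewrite [c ⊗ e * _](tens_mul_homog _ _ he ha) (linZ rl) !rpure (Smul he hb).
by rewrite -scalerAr scalerA -exprD -mulnDr mulnC !mulrA.
Qed.

Let eps_sign (N p : nat) x : gr N x = x -> (-1) ^+ (N * p) * (eps x : K) = eps x.
Proof.
move=> hx; have [->|N0] := eqVneq N 0%N; first by rewrite mul0n mul1r.
by rewrite (graded_functional egr hx N0) mulr0.
Qed.

(** By [lantip_mul], the antipode identity for x reduces the value on Delta(x) Delta(y) to eps(x)
    times the value on Delta(y). The sign is harmless because eps vanishes in positive degree. The
    induction is over all components [gr n x], because sums of generators need not be
    homogeneous. *)
Lemma lantip_counit :
  (forall g, lantip (Delta (gen g)) = (eps (gen g) : K) *: 1) ->
  forall x, lantip (Delta x) = (eps x : K) *: 1.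
Proof.
move=> Hg; case: (ea) => _ e1 eM; case: (Da) => _ D1 DM.
suff Hx x n : lantip (Delta (gr n x)) = (eps (gr n x) : K) *: 1.
  move=> x; rewrite [x]gr_boundE (lin_sum Dl) (lin_sum ll) (lin_sum el) scaler_suml.
  by apply: eq_bigr => i _.
elim/gen_ind: x n => [g n|k n|x y Hx Hy n|x y Hx Hy n].
- rewrite (gr_degree n (gen_deg g)); case: eqP => // _.
  by rewrite (lin0 Dl) (lin0 ll) (lin0 el) scale0r.
- rewrite gr_scale (gr_degree n gr_one); case: eqP => _.
    rewrite (linZ Dl) (linZ ll) (linZ el) e1 D1 [lantip _]lpure S1 mulr1.
    by congr (_ *: _); rewrite -[LHS]mulr1.
  by rewrite scaler0 (lin0 Dl) (lin0 ll) (lin0 el) scale0r.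
- by rewrite gr_add (linD Dl) (linD ll) Hx Hy (linD el) scalerDl.
rewrite gr_mulE (lin_sum Dl) (lin_sum ll) (lin_sum el) scaler_suml.
apply: eq_bigr => i _; rewrite DM eM.
set Y := Delta (gr (n - i) y).
suff -> : lantip (Delta (gr i x) * Y) = (eps (gr i x) : K) *: lantip Y.
  by rewrite Hy scalerA.
elim/tens_homog_ind: Y => [X Y HX HY|m m' c e hc he].
  by rewrite mulrDr !(linD ll) HX HY scalerDr.
rewrite Dgr (lantip_mul _ _ _ hc) -Dgr Hx lpure -scalerAr mulr1 -scalerAl scalerA.
by rewrite (eps_sign _ (gr_homog i x)).
Qed.

Lemma rantip_counit :
  (forall g, rantip (Delta (gen g)) = (eps (gen g) : K) *: 1) ->
  forall x, rantip (Delta x) = (eps x : K) *: 1.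
Proof.
move=> Hg; case: (ea) => _ e1 eM; case: (Da) => _ D1 DM.
suff Hx x n : rantip (Delta (gr n x)) = (eps (gr n x) : K) *: 1.
  move=> x; rewrite [x]gr_boundE (lin_sum Dl) (lin_sum rl) (lin_sum el) scaler_suml.
  by apply: eq_bigr => i _.
elim/gen_ind: x n => [g n|k n|x y Hx Hy n|x y Hx Hy n].
- rewrite (gr_degree n (gen_deg g)); case: eqP => // _.
  by rewrite (lin0 Dl) (lin0 rl) (lin0 el) scale0r.
- rewrite gr_scale (gr_degree n gr_one); case: eqP => _.
    rewrite (linZ Dl) (linZ rl) (linZ el) e1 D1 [rantip _]rpure S1 mulr1.
    by congr (_ *: _); rewrite -[LHS]mulr1.
  by rewrite scaler0 (lin0 Dl) (lin0 rl) (lin0 el) scale0r.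
- by rewrite gr_add (linD Dl) (linD rl) Hx Hy (linD el) scalerDl.
rewrite gr_mulE (lin_sum Dl) (lin_sum rl) (lin_sum el) scaler_suml.
apply: eq_bigr => i _; rewrite DM eM.
set Y := Delta (gr i x).
suff -> : rantip (Y * Delta (gr (n - i) y)) = (eps (gr (n - i) y) : K) *: rantip Y.
  by rewrite Hx scalerA mulrC.
elim/tens_homog_ind: Y => [X Y HX HY|m m' c e hc he].
  by rewrite mulrDl !(linD rl) HX HY scalerDr.
rewrite Dgr (rantip_mul _ _ _ he) -Dgr Hy rpure -scalerAr mulr1 -scalerAl scalerA.
by rewrite (eps_sign _ (gr_homog (n - i) y)).
Qed.

(** Both sides are algebra maps in b. A general [delta] is allowed, so that the coproduct and the
    coaction on the plane are both covered. *)
Lemma coassoc_gen (B : gralgType K) (G' : Type) (gen' : G' -> B)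
    (delta : B -> tens B H) :
  generated_by gen' -> alg_map delta -> graded_map delta ->
  (forall g, tassoc (tmap delta id (delta (gen' g)))
             = tmap id Delta (delta (gen' g))) ->
  forall b, tassoc (tmap delta id (delta b)) = tmap id Delta (delta b).
Proof.
move=> ind da dgr Hg; apply: (alg_map_eq ind) Hg.
  apply: alg_map_comp; first exact: tassoc_alg.
  by apply: alg_map_comp => //; apply: tmap_alg.
by apply: alg_map_comp => //; apply: tmap_alg.
Qed.

Lemma super_hopf_gen :
  (forall g, tassoc (tmap Delta id (Delta (gen g))) = tmap id Delta (Delta (gen g))) ->
  (forall g, tlift (fun a b => (eps a : K) *: b) (Delta (gen g)) = gen g) ->
  (forall g, tlift (fun a b => (eps b : K) *: a) (Delta (gen g)) = gen g) ->
  (forall g, lantip (Delta (gen g)) = (eps (gen g) : K) *: 1) ->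
  (forall g, rantip (Delta (gen g)) = (eps (gen g) : K) *: 1) ->
  super_hopf Delta.
Proof.
move=> Hco Hl Hr Hal Har; split=> //.
- exact: sgn_map.
- exact: (coassoc_gen gen_ind).
exists eps, S; split.
- split; last first.
    by move=> x; rewrite (sgn_map el) // (sgn_homog (erefl : gr 0 (eps x) = _)) scale1r.
  split=> //; apply: (alg_map_eq gen_ind) => //.
    by apply: alg_map_comp => //; exact: counitl_alg.
  by apply: alg_map_comp => //; exact: counitr_alg.
- by split=> //; apply: sgn_map.
- exact: lantip_counit.
exact: rantip_counit.
Qed.

End HopfFromGenerators.

(** * Auxiliary differential graded algebras *)

(* The opposite in the graded sense: x * y in sop A is (-1)^(|x||y|) y x. *)
Definition sop (K : fieldType) (A : gralgType K) : Type := A.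

Section SuperOpposite.
Variables (K : fieldType) (A : gralgType K).
Implicit Types x y z : A.

HB.instance Definition _ := GRing.Lmodule.on (sop A).

Let sl := @sgn_linear K A.

Definition sgnn (n : nat) x : A := if odd n then sgn x else x.

Lemma sgnn_linear n : linear (sgnn n).
Proof. by rewrite /sgnn; case: (odd n). Qed.

Lemma sgnn_mul n x y : sgnn n (x * y) = sgnn n x * sgnn n y.
Proof. by rewrite /sgnn; case: (odd n); rewrite ?sgn_mul. Qed.

Lemma sgnn_add m n x : sgnn (m + n) x = sgnn m (sgnn n x).
Proof.
by rewrite /sgnn oddD; case: (odd m); case: (odd n); rewrite //= sgn_sgn.
Qed.

Lemma sgnn_homog m n x : gr m x = x -> sgnn n x = (-1) ^+ (m * n) *: x.
Proof.
move=> hx; rewrite -signr_odd oddM /sgnn; case: (odd n).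
  by rewrite andbT signr_odd (sgn_homog hx).
by rewrite andbF expr0 scale1r.
Qed.

Lemma gr_sgnn m n x : gr m x = x -> gr m (sgnn n x) = sgnn n x.
Proof. by move=> hx; rewrite (sgnn_homog _ hx) gr_scale hx. Qed.

(** The sign (-1)^(|x||y|) is the |y|-th power of the parity involution applied to x. Hence only y
    has to be split into its components, and one fold suffices. *)
Definition smul (x y : A) : A := gr_fold (fun n y' => y' * sgnn n x) y.

Lemma smulr_linear x : linear (smul x).
Proof. by apply: gr_fold_linear => n k y z; rewrite mulrDl scalerAl. Qed.

Lemma smull_linear y : linear (smul^~ y).
Proof.
apply: gr_fold_param => n z k x x'.
by rewrite sgnn_linear mulrDr scalerAr.
Qed.

Lemma smul_homogr n x y : gr n y = y -> smul x y = y * sgnn n x.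
Proof. by move=> hy; rewrite /smul (gr_fold_homog _ hy) // => m; rewrite mul0r. Qed.

Lemma smul_homog m n x y : gr m x = x -> gr n y = y ->
  smul x y = (-1) ^+ (m * n) *: (y * x).
Proof. by move=> hx hy; rewrite (smul_homogr _ hy) (sgnn_homog _ hx) scalerAr. Qed.

Let ml y := linD (smull_linear y).
Let mr x := linD (smulr_linear x).

Lemma smulA : associative smul.
Proof.
move=> x y z; elim/gr_ind: z => [z z' Hz Hz'|r z hz]; first by rewrite !mr Hz Hz'.
elim/gr_ind: y => [y y' Hy Hy'|n y hy].
  by rewrite ml !mr ml Hy Hy'.
have hzy : gr (n + r) (z * sgnn r y) = z * sgnn r y.
  by rewrite addnC; apply: gr_mul => //; exact: gr_sgnn.
rewrite (smul_homogr y hz) (smul_homogr _ hzy) (smul_homogr x hy) (smul_homogr _ hz).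
by rewrite sgnn_mul [(n + r)%N]addnC sgnn_add mulrA.
Qed.

Lemma smul1x : left_id 1 smul.
Proof.
elim/gr_ind => [y y' Hy Hy'|n y hy]; first by rewrite mr Hy Hy'.
by rewrite (smul_homogr _ hy) (sgnn_homog _ gr_one) mul0n scale1r mulr1.
Qed.

Lemma smulx1 : right_id 1 smul.
Proof. by move=> x; rewrite (smul_homogr _ gr_one) mul1r. Qed.

Lemma smulDl : left_distributive smul +%R.
Proof. by move=> x y z; rewrite ml. Qed.

Lemma smulDr : right_distributive smul +%R.
Proof. by move=> x y z; rewrite mr. Qed.

HB.instance Definition _ := GRing.Zmodule_isNzRing.Build (sop A)
  smulA smul1x smulx1 smulDl smulDr (oner_neq0 A).

Lemma smul_scalerAl (k : K) x y : k *: smul x y = smul (k *: x) y.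
Proof. exact: esym (linZ (smull_linear y) k x). Qed.
Lemma smul_scalerAr (k : K) x y : k *: smul x y = smul x (k *: y).
Proof. exact: esym (linZ (smulr_linear x) k y). Qed.

HB.instance Definition _ := GRing.Lmodule_isLalgebra.Build K (sop A) smul_scalerAl.
HB.instance Definition _ := GRing.Lalgebra_isAlgebra.Build K (sop A) smul_scalerAr.

Lemma sop_gr_mul m n x y :
  gr m x = x -> gr n y = y -> gr (m + n)%N (smul x y) = smul x y.
Proof.
move=> hx hy; rewrite (smul_homog hx hy) gr_scale addnC.
by congr (_ *: _); exact: gr_mul.
Qed.

HB.instance Definition _ := isGraded.Build K (sop A)
  (@gr_linear K A) (@gr_gr K A) (@gr_total K A) (@gr_one K A) sop_gr_mul.

Lemma sop_mul m n (x y : sop A) : gr m x = x -> gr n y = y ->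
  x * y = (-1) ^+ (m * n) *: ((y : A) * (x : A)).
Proof. exact: smul_homog. Qed.

Lemma sop_sgn (x : sop A) : sgn x = sgn (x : A).
Proof. by apply: (@sgn_map K (sop A) A id). Qed.

End SuperOpposite.

Section SuperOppositeDGA.
Variables (K : fieldType) (A : dgaType K).

Lemma sop_dif_mul (x y : A) :
  dif (smul x y) = smul (dif x) y + smul (sgn x) (dif y).
Proof.
have dl := @dif_linear K A.
elim/gr_ind: y => [y y' Hy Hy'|n y hy].
  rewrite !(linD (smulr_linear _)) !(linD dl) !(linD (smulr_linear _)) Hy Hy'.
  by rewrite addrACA.
rewrite !(smul_homogr _ hy) (smul_homogr _ (dif_homog hy)) dif_mul (sgn_homog hy).
rewrite /sgnn /= -scalerAl addrC -signr_odd.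
case: (odd n) => /=; first by rewrite sgn_dif scaleN1r mulrN.
by rewrite sgn_sgn scale1r.
Qed.

Lemma sop_dif_sgn_mul (x y : A) :
  dif (smul x y) = smul (dif x) y + @smul K A (sgn (x : sop A)) (dif y).
Proof. by rewrite sop_sgn; exact: sop_dif_mul. Qed.

HB.instance Definition _ := isDGA.Build K (sop A) (@dif_linear K A)
  (@gr0_dif K A) (@grS_dif K A) (@dif_dif K A) sop_dif_sgn_mul.

End SuperOppositeDGA.

(** A copy of C that carries the DGA structure concentrated in degree 0, with d = 0; it serves for
    matrix algebras. *)
Definition deg0 (K : fieldType) (C : algType K) : Type := C.

Section Degree0.
Variables (K : fieldType) (C : algType K).
HB.instance Definition _ := GRing.Algebra.on (deg0 C).
Local Notation D := (deg0 C).
Implicit Types x y : D.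

Definition deg0_gr (n : nat) x : D := if n == 0%N then x else 0.

Lemma deg0_gr_linear n : linear (deg0_gr n).
Proof. by rewrite /deg0_gr; case: eqP => // _ k x y; rewrite scaler0 addr0. Qed.

Lemma deg0_gr_gr m n x : deg0_gr m (deg0_gr n x) = if m == n then deg0_gr n x else 0.
Proof. by case: m n => [|m] [|n] //=; rewrite /deg0_gr /=; case: ifP. Qed.

Lemma deg0_gr_total x : exists N, x = \sum_(n < N) deg0_gr n x.
Proof. by exists 1%N; rewrite big_ord1. Qed.

Lemma deg0_gr_mul m n x y :
  deg0_gr m x = x -> deg0_gr n y = y -> deg0_gr (m + n)%N (x * y) = x * y.
Proof.
by case: m n => [|m] [|n] //= <- <-; rewrite /deg0_gr /= ?mul0r ?mulr0.
Qed.

HB.instance Definition _ := isGraded.Build K D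
  deg0_gr_linear deg0_gr_gr deg0_gr_total (erefl _) deg0_gr_mul.

Definition deg0_dif x : D := 0.

Lemma deg0_dif_linear : linear deg0_dif.
Proof. by move=> k x y; rewrite scaler0 addr0. Qed.

Lemma deg0_gr0_dif x : gr 0 (deg0_dif x) = 0. Proof. by []. Qed.

Lemma deg0_grS_dif n x : gr n.+1 (deg0_dif x) = deg0_dif (gr n x). Proof. by []. Qed.

Lemma deg0_dif_mul x y : deg0_dif (x * y) = deg0_dif x * y + sgn x * deg0_dif y.
Proof. by rewrite mul0r mulr0 addr0. Qed.

HB.instance Definition _ := isDGA.Build K D
  deg0_dif_linear deg0_gr0_dif deg0_grS_dif (fun=> erefl) deg0_dif_mul.

Lemma deg0_difE x : dif x = 0. Proof. by []. Qed.

End Degree0.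

(* Upper triangular matrices [[x, m], [0, y]], with x, y of degree 0 and m of  *)
(* degree 1; the differential is the graded commutator with [[0, 1], [0, 0]].  *)
(* A pair of algebra maps f, g : A -> C gives A -> tri C, a |-> (f a, 0, g a), *)
(* so that this DGA realises the (f, g)-derivation g - f.                      *)
Record tri (K : fieldType) (C : algType K) : Type :=
  Tri { tri_l : C; tri_m : C; tri_r : C }.

HB.instance Definition _ (K : fieldType) (C : algType K) := gen_eqMixin (tri C).
HB.instance Definition _ (K : fieldType) (C : algType K) := gen_choiceMixin (tri C).

Section Triangular.
Variables (K : fieldType) (C : algType K).

Local Notation T := (tri C).
Implicit Types u v w : T.

Lemma tri_ext u v :
  tri_l u = tri_l v -> tri_m u = tri_m v -> tri_r u = tri_r v -> u = v.
Proof. by case: u v => [x m y] [x' m' y'] /= -> -> ->. Qed.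

Definition tri_zero : T := Tri 0 0 0.
Definition tri_opp u : T := Tri (- tri_l u) (- tri_m u) (- tri_r u).
Definition tri_add u v : T :=
  Tri (tri_l u + tri_l v) (tri_m u + tri_m v) (tri_r u + tri_r v).
Definition tri_scale (k : K) u : T :=
  Tri (k *: tri_l u) (k *: tri_m u) (k *: tri_r u).

Lemma tri_addA : associative tri_add.
Proof. by move=> u v w; apply: tri_ext; exact: addrA. Qed.
Lemma tri_addC : commutative tri_add.
Proof. by move=> u v; apply: tri_ext; exact: addrC. Qed.
Lemma tri_add0 : left_id tri_zero tri_add.
Proof. by move=> u; apply: tri_ext; exact: add0r. Qed.
Lemma tri_addN : left_inverse tri_zero tri_opp tri_add.
Proof. by move=> u; apply: tri_ext; exact: addNr. Qed.

HB.instance Definition _ :=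
  GRing.isZmodule.Build T tri_addA tri_addC tri_add0 tri_addN.

Lemma tri_scaleA k l u : tri_scale k (tri_scale l u) = tri_scale (k * l) u.
Proof. by apply: tri_ext; exact: scalerA. Qed.
Lemma tri_scale1 : left_id 1 tri_scale.
Proof. by move=> u; apply: tri_ext; exact: scale1r. Qed.
Lemma tri_scaleDr : right_distributive tri_scale +%R.
Proof. by move=> k u v; apply: tri_ext; exact: scalerDr. Qed.
Lemma tri_scaleDl u : {morph tri_scale^~ u : k l / k + l}.
Proof. by move=> k l; apply: tri_ext; exact: scalerDl. Qed.

HB.instance Definition _ := GRing.Zmodule_isLmodule.Build K T
  tri_scaleA tri_scale1 tri_scaleDr tri_scaleDl.

Lemma tri_m_linear : linear (@tri_m K C). Proof. by []. Qed.

Definition tri_mul u v : T :=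
  Tri (tri_l u * tri_l v) (tri_l u * tri_m v + tri_m u * tri_r v)
    (tri_r u * tri_r v).
Definition tri_one : T := Tri 1 0 1.

Lemma tri_mulA : associative tri_mul.
Proof.
move=> u v w; apply: tri_ext; rewrite /= ?mulrA //.
by rewrite mulrDr mulrDl !mulrA addrA.
Qed.

Lemma tri_mul1x : left_id tri_one tri_mul.
Proof.
by move=> u; apply: tri_ext; rewrite /= ?mul1r ?mul0r ?addr0.
Qed.

Lemma tri_mulx1 : right_id tri_one tri_mul.
Proof.
by move=> u; apply: tri_ext; rewrite /= ?mulr1 ?mulr0 ?add0r.
Qed.

Lemma tri_mulDl : left_distributive tri_mul +%R.
Proof.
move=> u v w; apply: tri_ext; rewrite /= ?mulrDl //.
by rewrite addrACA.
Qed.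

Lemma tri_mulDr : right_distributive tri_mul +%R.
Proof.
move=> u v w; apply: tri_ext; rewrite /= ?mulrDr //.
by rewrite addrACA.
Qed.

Lemma tri_one_neq0 : tri_one != 0.
Proof. by apply/eqP => /(congr1 (@tri_l K C))/eqP; rewrite oner_eq0. Qed.

HB.instance Definition _ := GRing.Zmodule_isNzRing.Build T
  tri_mulA tri_mul1x tri_mulx1 tri_mulDl tri_mulDr tri_one_neq0.

Lemma tri_scalerAl (k : K) u v : k *: tri_mul u v = tri_mul (k *: u) v.
Proof.
apply: tri_ext; rewrite /= -?scalerAl //.
by rewrite scalerDr.
Qed.

Lemma tri_scalerAr (k : K) u v : k *: tri_mul u v = tri_mul u (k *: v).
Proof.
apply: tri_ext; rewrite /= -?scalerAr //.
by rewrite scalerDr.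
Qed.

HB.instance Definition _ := GRing.Lmodule_isLalgebra.Build K T tri_scalerAl.
HB.instance Definition _ := GRing.Lalgebra_isAlgebra.Build K T tri_scalerAr.

Definition tri_gr (n : nat) u : T :=
  match n with
  | 0 => Tri (tri_l u) 0 (tri_r u)
  | 1 => Tri 0 (tri_m u) 0
  | _ => 0
  end.

Lemma tri_gr_linear n : linear (tri_gr n).
Proof.
move=> k u v; case: n => [|[|n]]; apply: tri_ext;
  by rewrite /= ?scaler0 ?addr0.
Qed.

Lemma tri_gr_gr m n u : tri_gr m (tri_gr n u) = if m == n then tri_gr n u else 0.
Proof. by case: m n => [|[|m]] [|[|n]] //=; case: ifP. Qed.

Lemma tri_gr_total u : exists N, u = \sum_(n < N) tri_gr n u.
Proof.
exists 2; rewrite big_ord_recr big_ord1; apply: tri_ext;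
  by rewrite /= ?add0r ?addr0.
Qed.

Lemma tri_gr_one : tri_gr 0 1 = 1. Proof. by []. Qed.

Lemma tri_gr_mul m n u v :
  tri_gr m u = u -> tri_gr n v = v -> tri_gr (m + n)%N (u * v) = u * v.
Proof.
suff H : tri_gr (m + n)%N (tri_gr m u * tri_gr n v) = tri_gr m u * tri_gr n v.
  by move=> hu hv; move: H; rewrite hu hv.
have g0 p : tri_gr p 0 = 0 by case: p => [|[|p]].
case: m n => [|[|m]] [|[|n]] /=; rewrite ?(mul0r, mulr0) ?g0 //;
  apply: tri_ext => /=; by rewrite ?(mul0r, mulr0, addr0, add0r).
Qed.

HB.instance Definition _ := isGraded.Build K T
  tri_gr_linear tri_gr_gr tri_gr_total tri_gr_one tri_gr_mul.

Lemma tri_sgn u : sgn u = Tri (tri_l u) (- tri_m u) (tri_r u).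
Proof.
have sl := @sgn_linear K T.
have E : u = gr 0 u + gr 1 u.
  by apply: tri_ext; rewrite /= ?add0r ?addr0.
rewrite E (linD sl) (sgn_homog (gr_homog 0 u)) (sgn_homog (gr_homog 1 u)).
by apply: tri_ext; rewrite /= ?scale1r ?scaler0 ?addr0 //
  !add0r scaleN1r.
Qed.

Definition tri_dif u : T := Tri 0 (tri_r u - tri_l u) 0.

Lemma tri_dif_linear : linear tri_dif.
Proof.
move=> k u v; apply: tri_ext; rewrite /= ?scaler0 ?addr0 //.
by rewrite scalerBr opprD addrACA.
Qed.

Lemma tri_gr0_dif u : gr 0 (tri_dif u) = 0. Proof. by []. Qed.

Lemma tri_grS_dif n u : gr n.+1 (tri_dif u) = tri_dif (gr n u).
Proof.
by case: n => [|[|n]] //; apply: tri_ext; rewrite /= ?subrr.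
Qed.

Lemma tri_dif_dif u : tri_dif (tri_dif u) = 0.
Proof. by apply: tri_ext; rewrite /= ?subrr. Qed.

Lemma tri_dif_mul u v : tri_dif (u * v) = tri_dif u * v + sgn u * tri_dif v.
Proof.
rewrite tri_sgn; apply: tri_ext=> /=;
  rewrite ?(mul0r, mulr0, addr0, add0r) //.
by rewrite mulrBl mulrBr addrA subrK.
Qed.

HB.instance Definition _ := isDGA.Build K T
  tri_dif_linear tri_gr0_dif tri_grS_dif tri_dif_dif tri_dif_mul.

Lemma tri_mkM x m y x' m' y' :
  Tri x m y * Tri x' m' y' = Tri (x * x') (x * m' + m * y') (y * y').
Proof. by []. Qed.

Lemma tri_difE x m y : dif (Tri x m y) = Tri 0 (y - x) 0.
Proof. by []. Qed.

End Triangular.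

(** * Rewriting rules in tensor products and opposites *)

Fixpoint qren (f : nat -> nat) (e : qexp) : qexp :=
  match e with
  | QGen x => QGen (f x)
  | QZero => QZero
  | QOne => QOne
  | QOpp e => QOpp (qren f e)
  | QAdd e g => QAdd (qren f e) (qren f g)
  | QMul e g => QMul (qren f e) (qren f g)
  | QScale s e => QScale s (qren f e)
  end.

Lemma qeval_ren (K : fieldType) (q : K) (A B : algType K) (envA : nat -> A)
    (envB : nat -> B) (f : nat -> nat) (h : A -> B) e :
  alg_map h -> (forall x, envB (f x) = h (envA x)) ->
  qeval q envB (qren f e) = h (qeval q envA e).
Proof.
move=> [hl h1 hM] H.
elim: e => //= [|e IH|e IHe g IHg|e IHe g IHg|s e IH].
- by rewrite (lin0 hl).
- by rewrite IH (linN hl).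
- by rewrite IHe IHg (linD hl).
- by rewrite IHe IHg hM.
by rewrite IH (linZ hl).
Qed.

(** Even letters stand for a ⊗ 1 and odd ones for 1 ⊗ b. The former are moved to the left, with the
    Koszul sign, so that a normal word is a pure tensor of normal words. *)
Definition tens_rule (dA dB : nat -> nat) (rA rB : nat -> nat -> option qexp)
    (x y : nat) : option qexp :=
  if odd x then
    if odd y then omap (qren (fun z => z.*2.+1)) (rB x./2 y./2)
    else
      let m := QMul (QGen y) (QGen x) in
      Some (if odd (dB x./2 * dA y./2) then QOpp m else m)
  else if odd y then None
  else omap (qren double) (rA x./2 y./2).

Inductive texp : Type :=
| TPure of qexp & qexp
| TZero
| TOne
| TOpp of texp
| TAdd of texp & texp
| TMul of texp & texp
| TScale of qscal & texp.

Fixpoint tflat (e : texp) : qexp :=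
  match e with
  | TPure a b => QMul (qren double a) (qren (fun z => z.*2.+1) b)
  | TZero => QZero
  | TOne => QOne
  | TOpp e => QOpp (tflat e)
  | TAdd e f => QAdd (tflat e) (tflat f)
  | TMul e f => QMul (tflat e) (tflat f)
  | TScale s e => QScale s (tflat e)
  end.

Section TensorRules.
Variables (K : fieldType) (q : K) (A B : gralgType K).
Variables (envA : nat -> A) (envB : nat -> B) (dA dB : nat -> nat).

Definition tens_env (x : nat) : tens A B :=
  if odd x then 1 ⊗ envB x./2 else envA x./2 ⊗ 1.

Fixpoint teval (e : texp) : tens A B :=
  match e with
  | TPure a b => qeval q envA a ⊗ qeval q envB b
  | TZero => 0
  | TOne => 1
  | TOpp e => - teval e
  | TAdd e f => teval e + teval f
  | TMul e f => teval e * teval f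
  | TScale s e => seval q s *: teval e
  end.

Lemma tens_inl_alg : alg_map (fun a : A => a ⊗ (1 : B)).
Proof.
split=> // [k x y|x y]; first by rewrite tpureDl tpureZl.
elim/gr_ind: y => [y y' Hy Hy'|n y hy]; first by rewrite mulrDr !tpureDl Hy Hy' mulrDr.
by rewrite [RHS](tens_mul_homog _ _ gr_one hy) mul0n scale1r mulr1.
Qed.

Lemma tens_inr_alg : alg_map (fun b : B => (1 : A) ⊗ b).
Proof.
split=> // [k x y|x y]; first by rewrite tpureDr tpureZr.
elim/gr_ind: x => [x x' Hx Hx'|n x hx]; first by rewrite mulrDl !tpureDr Hx Hx' mulrDl.
by rewrite [RHS](tens_mul_homog _ _ hx gr_one) muln0 scale1r mulr1.
Qed.

Lemma tens_inlr (a : A) (b : B) : (a ⊗ 1) * (1 ⊗ b) = a ⊗ b.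
Proof.
by rewrite [LHS](tens_mul_homog _ _ gr_one gr_one) scale1r mulr1 mul1r.
Qed.

Lemma qeval_tens_l a : qeval q tens_env (qren double a) = qeval q envA a ⊗ 1.
Proof.
apply: (qeval_ren _ _ tens_inl_alg) => x.
by rewrite /tens_env odd_double doubleK.
Qed.

Lemma qeval_tens_r b :
  qeval q tens_env (qren (fun z => z.*2.+1) b) = 1 ⊗ qeval q envB b.
Proof.
apply: (qeval_ren _ _ tens_inr_alg) => x.
by rewrite /tens_env /= odd_double /= uphalf_double.
Qed.

Lemma teval_flat e : qeval q tens_env (tflat e) = teval e.
Proof.
elim: e => //= [a b|e ->|e -> f ->|e -> f ->|s e ->] //.
by rewrite qeval_tens_l qeval_tens_r tens_inlr.
Qed.

Variables (rA rB : nat -> nat -> option qexp).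
Hypotheses (hA : forall x, gr (dA x) (envA x) = envA x).
Hypotheses (hB : forall x, gr (dB x) (envB x) = envB x).
Hypotheses (okA : rules_ok q envA rA) (okB : rules_ok q envB rB).

Lemma tens_rules_ok : rules_ok q tens_env (tens_rule dA dB rA rB).
Proof.
move=> x y e; rewrite /tens_rule.
have [ox|ex] := boolP (odd x); have [oy|ey] := boolP (odd y) => //.
- case E: (rB _ _) => [e'|] //= -[<-]; rewrite qeval_tens_r -(okB E).
  by rewrite /tens_env ox oy; have [_ _ ->] := tens_inr_alg.
- move=> [<-]; set m := QMul _ _.
  have -> : qeval q tens_env (if odd (dB x./2 * dA y./2) then QOpp m else m)
    = (-1) ^+ (dB x./2 * dA y./2) *: qeval q tens_env m.
    by rewrite -signr_odd; case: odd; rewrite /= ?scaleN1r ?scale1r.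
  rewrite /= /tens_env ox (negPf ey) tens_inlr.
  by rewrite [LHS](tens_mul_homog _ _ (hB _) (hA _)) mulr1 mul1r.
case E: (rA _ _) => [e'|] //= -[<-]; rewrite qeval_tens_l -(okA E).
by rewrite /tens_env (negPf ex) (negPf ey); have [_ _ ->] := tens_inl_alg.
Qed.

Lemma tequal_sound e f : q != 0 ->
  qequal (tens_rule dA dB rA rB) (tflat e) (tflat f) -> teval e = teval f.
Proof.
by move=> q0 H; rewrite -!teval_flat; apply: qequal_sound H => //; exact: tens_rules_ok.
Qed.

End TensorRules.

Fixpoint qrev (e : qexp) : qexp :=
  match e with
  | QOpp e => QOpp (qrev e)
  | QAdd e f => QAdd (qrev e) (qrev f)
  | QMul e f => QMul (qrev f) (qrev e)
  | QScale s e => QScale s (qrev e)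
  | _ => e
  end.

Fixpoint qdeg (d : nat -> nat) (e : qexp) : nat :=
  match e with
  | QGen x => d x
  | QZero | QOne => 0
  | QOpp e | QScale _ e => qdeg d e
  | QAdd e f => qdeg d e
  | QMul e f => qdeg d e + qdeg d f
  end.

Fixpoint qhom (d : nat -> nat) (k : nat) (e : qexp) : bool :=
  match e with
  | QGen x => d x == k
  | QZero => true
  | QOne => k == 0%N
  | QOpp e | QScale _ e => qhom d k e
  | QAdd e f => qhom d k e && qhom d k f
  | QMul e f => [&& (qdeg d e <= k)%N, qhom d (qdeg d e) e & qhom d (k - qdeg d e) f]
  end.

(** In the opposite, xy is yx up to sign, so the rule for yx is read backwards. By homogeneity both
    sides of the rule acquire the same sign, and none has to be recorded. *)
Definition sop_rule (d : nat -> nat) (r : nat -> nat -> option qexp) (x y : nat) :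
    option qexp :=
  if r y x is Some e then
    if qhom d (d x + d y) e then Some (qrev e) else None
  else None.

Section SopRules.
Variables (K : fieldType) (q : K) (A : gralgType K) (env : nat -> A).
Variables (d : nat -> nat) (r : nat -> nat -> option qexp).
Hypothesis hd : forall x, gr (d x) (env x) = env x.
Hypothesis d_lt2 : forall x, (d x < 2)%N.
Hypothesis ok : rules_ok q env r.

Definition sop_env (x : nat) : sop A := env x.

Lemma qhom_gr k e : qhom d k e -> gr k (qeval q env e) = qeval q env e.
Proof.
elim: e k => /= [x|||e IH|e IHe f IHf|e IHe f IHf|s e IH] k.
- by move/eqP <-.
- by rewrite gr_0.
- by move/eqP ->; rewrite gr_one.
- by move/IH => {2}<-; rewrite -scaleN1r gr_scale scaleN1r.
- by case/andP => /IHe{2}<- /IHf{2}<-; rewrite gr_add.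
- case/and3P => le he hf; rewrite -{1}(subnKC le).
  by apply: gr_mul; [exact: IHe|exact: IHf].
by move/IH => {2}<-; rewrite gr_scale.
Qed.

Lemma bin2D m n : 'C(m + n, 2) = ('C(m, 2) + 'C(n, 2) + m * n)%N.
Proof.
elim: n => [|n IH]; first by rewrite addn0 muln0 !addn0.
rewrite addnS !binS !bin1 IH mulnS.
by rewrite -!addnA; congr (_ + (_ + _))%N; rewrite addnC addnA [(n + m)%N]addnC.
Qed.

(** Reversing k factors of degree 1 exchanges each of the 'C(k, 2) pairs once, with a sign -1 each.
    Letters have degree 0 or 1, so that a single letter carries no sign. *)
Lemma qeval_rev k e : qhom d k e ->
  qeval q sop_env (qrev e) = (-1) ^+ 'C(k, 2) *: (qeval q env e : sop A).
Proof.
elim: e k => /= [x|||e IH|e IHe f IHf|e IHe f IHf|s e IH] k.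
- move/eqP <-; rewrite bin_small ?d_lt2 //; exact: esym (scale1r _).
- by rewrite scaler0.
- by move/eqP ->; exact: esym (scale1r _).
- by move/IH ->; exact: esym (scalerN _ _).
- case/andP => he hf; rewrite (IHe _ he) (IHf _ hf); exact: esym (scalerDr _ _ _).
- case/and3P => le he hf; rewrite -(subnKC le) (IHe _ he) (IHf _ hf).
  rewrite -scalerAl -scalerAr scalerA [X in _ *: X](sop_mul (qhom_gr hf) (qhom_gr he)).
  by rewrite scalerA -!exprD mulnC bin2D [('C(k - _, 2) + _)%N]addnC.
by move/IH ->; rewrite scalerA mulrC; exact: esym (scalerA _ _ _).
Qed.

Lemma sop_rules_ok : rules_ok q sop_env (sop_rule d r).
Proof.
move=> x y e; rewrite /sop_rule; case E: (r y x) => [f|] //.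
case: ifP => // hf [<-]; rewrite (qeval_rev hf) -(ok E).
rewrite [LHS](sop_mul (hd x) (hd y)); congr (_ ^+ _ *: _).
by rewrite bin2D !bin_small ?d_lt2.
Qed.

End SopRules.

(** * Reification of goals into expressions *)

Ltac q_scal q s :=
  lazymatch s with
  | Algebra.zero => constr:(SZero)
  | GRing.one _ => constr:(SOne)
  | Algebra.opp ?a => let a' := q_scal q a in constr:(SOpp a')
  | Algebra.add ?a ?b =>
    let a' := q_scal q a in let b' := q_scal q b in constr:(SAdd a' b')
  | GRing.mul ?a ?b =>
    let a' := q_scal q a in let b' := q_scal q b in constr:(SMul a' b')
  | GRing.inv q => constr:(SPow (Negz 0))
  | GRing.exp q ?n => constr:(SPow (Posz n))
  | exprz q ?n => constr:(SPow n)
  | seval q ?e => e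
  | q => constr:(SPow (Posz 1))
  end.

(** Letters are found by syntactic comparison, so the goal has to display them exactly as they are
    listed. *)
Ltac q_index x xs :=
  lazymatch xs with
  | ?y :: ?ys =>
    match constr:(tt) with
    | _ => let _ := match constr:(tt) with _ => constr_eq x y end in constr:(0%N)
    | _ => let n := q_index x ys in constr:(n.+1)
    end
  end.

Ltac q_letters xs :=
  lazymatch xs with
  | nil => xs
  | _ :: _ => xs
  | _ => eval red in xs
  end.

Ltac q_exp q xs t :=
  lazymatch t with
  | Algebra.zero => constr:(QZero)
  | GRing.one _ => constr:(QOne)
  | Algebra.opp ?a => let a' := q_exp q xs a in constr:(QOpp a')
  | Algebra.add ?a ?b =>
    let a' := q_exp q xs a in let b' := q_exp q xs b in constr:(QAdd a' b')
  | GRing.mul ?a ?b =>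
    let a' := q_exp q xs a in let b' := q_exp q xs b in constr:(QMul a' b')
  | GRing.scale ?s ?a =>
    let s' := q_scal q s in let a' := q_exp q xs a in constr:(QScale s' a')
  | qeval _ _ ?e => e
  | _ => let n := q_index t xs in constr:(QGen n)
  end.

Ltac t_exp q xs ys t :=
  lazymatch t with
  | tpure ?a ?b =>
    let a' := q_exp q xs a in let b' := q_exp q ys b in constr:(TPure a' b')
  | teval _ _ _ ?e => e
  | Algebra.zero => constr:(TZero)
  | GRing.one _ => constr:(TOne)
  | Algebra.opp ?a => let a' := t_exp q xs ys a in constr:(TOpp a')
  | Algebra.add ?a ?b =>
    let a' := t_exp q xs ys a in let b' := t_exp q xs ys b in constr:(TAdd a' b')
  | GRing.mul ?a ?b =>
    let a' := t_exp q xs ys a in let b' := t_exp q xs ys b in constr:(TMul a' b')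
  | GRing.scale ?s ?a =>
    let s' := q_scal q s in let a' := t_exp q xs ys a in constr:(TScale s' a')
  end.

(* Proves an identity in the elements xs, by the rules which ok proves sound *)
Ltac nc_ring q0 ok xs :=
  lazymatch type of q0 with is_true (negb (eq_op ?q _)) =>
  lazymatch goal with |- ?l = ?r =>
    let ls := q_letters xs in
    let e := q_exp q ls l in let f := q_exp q ls r in
    refine (@qequal_sound _ q q0 _ (nth 0 xs) _ e f ok _);
    vm_compute; reflexivity
  end end.

Ltac nc_tens q0 hA hB okA okB xs ys :=
  lazymatch type of q0 with is_true (negb (eq_op ?q _)) =>
  lazymatch goal with |- ?l = ?r =>
    let ls := q_letters xs in let ms := q_letters ys in
    let e := t_exp q ls ms l in let f := t_exp q ls ms r in
    refine (@tequal_sound _ q _ _ _ _ _ _ _ _ hA hB okA okB e f q0 _);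
    vm_compute; reflexivity
  end end.

(** * The relations as rewriting rules *)

Lemma sum_ord2 (V : nmodType) (F : 'I_2 -> V) : \sum_i F i = F i1 + F i2.
Proof. by rewrite big_ord_recr big_ord1 /=; congr (F _ + _); apply: val_inj. Qed.

Lemma ord2_ind (P : 'I_2 -> Prop) : P i1 -> P i2 -> forall i, P i.
Proof.
by move=> P1 P2 [[|[|//]] lt]; [move: P1|move: P2]; congr P; apply: val_inj.
Qed.

(* In gl2_pre_table and dt_table, t^i_j is the letter 2 i + j and its           *)
(* differential the letter 4 + 2 i + j, where i, j = 0, 1. In gl2_table and     *)
(* omega_table, these are shifted by 2 and the letters 0, 1 are D, D^-1.        *)
Definition gl2_pre_table : seq (nat * nat * qexp) :=
  [:: (2, 1, QMul (QGen 1) (QGen 2));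
      (0, 1, QScale (SPow (-1)) (QMul (QGen 1) (QGen 0)));
      (0, 2, QScale (SPow (-1)) (QMul (QGen 2) (QGen 0)));
      (3, 1, QScale (SPow 1) (QMul (QGen 1) (QGen 3)));
      (3, 2, QScale (SPow 1) (QMul (QGen 2) (QGen 3)));
      (3, 0, QAdd (QMul (QGen 0) (QGen 3))
         (QScale (SAdd (SPow 1) (SOpp (SPow (-1)))) (QMul (QGen 1) (QGen 2))))].

(** Both ad and da are eliminated in favour of D, so a normal word is a power of D or of D^-1,
    followed by powers of b and c and then by a power of either a or d. *)
Definition gl2_table : seq (nat * nat * qexp) :=
  [seq (x, y, QMul (QGen y) (QGen x)) | x <- [:: 2; 3; 4; 5], y <- [:: 0; 1]] ++
  [:: (0, 1, QOne);
      (1, 0, QOne);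
      (4, 3, QMul (QGen 3) (QGen 4));
      (2, 3, QScale (SPow (-1)) (QMul (QGen 3) (QGen 2)));
      (2, 4, QScale (SPow (-1)) (QMul (QGen 4) (QGen 2)));
      (5, 3, QScale (SPow 1) (QMul (QGen 3) (QGen 5)));
      (5, 4, QScale (SPow 1) (QMul (QGen 4) (QGen 5)));
      (2, 5, QAdd (QGen 0) (QScale (SPow (-1)) (QMul (QGen 3) (QGen 4))));
      (5, 2, QAdd (QGen 0) (QScale (SPow 1) (QMul (QGen 3) (QGen 4))))].

Definition Rscal (i j k l : nat) : qscal :=
  if (i == j) && (k == l) then (if i == k then SPow 1 else SOne)
  else if [&& i == 0, j == 1, k == 1 & l == 0]%N then SAdd (SPow 1) (SOpp (SPow (-1)))
  else SZero.

(** The q-antisymmetric tensor: D is the sum of [epsscal j l] t^1_j t^2_l over j and l. *)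
Definition epsscal (i k : nat) : qscal :=
  match i, k with
  | 0, 1 => SOne
  | 1, 0 => SOpp (SPow (-1))
  | _, _ => SZero
  end.

Definition qsum2 (F : nat -> qexp) : qexp := QAdd (F 0%N) (F 1%N).

Definition bits2 : seq (nat * nat) := [:: (0, 0); (0, 1); (1, 0); (1, 1)]%N.

(* dt_1 t_2 = R_21 t_2 dt_1 R + eps th eps, where th is a 1-form which is not   *)
(* known to vanish in the proof of universality.                               *)
Definition dt_table (th : qexp) : seq (nat * nat * qexp) :=
  [seq (4 + (2 * x.1 + x.2), 2 * y.1 + y.2,
     QAdd (QScale (SMul (epsscal x.1 y.1) (epsscal x.2 y.2)) th)
      (qsum2 (fun p => qsum2 (fun r => qsum2 (fun n => qsum2 (fun m =>
        QScale (SMul (Rscal y.1 p x.1 r) (Rscal m x.2 n y.2))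
          (QMul (QGen (2 * p + n)) (QGen (4 + (2 * r + m)))))))))%N)
  | x <- bits2, y <- bits2].

Definition shift_table (s : seq (nat * nat * qexp)) : seq (nat * nat * qexp) :=
  [seq (r.1.1.+2, r.1.2.+2, qren (fun x => x.+2) r.2) | r <- s].

(** A normal word is one for [gl2_table], followed by distinct differentials in the order da, db,
    dc, dd. *)
Definition omega_table : seq (nat * nat * qexp) :=
  gl2_table ++
  [seq (x, y, QScale (SPow (if y == 0%N then 2 else -2)%R) (QMul (QGen y) (QGen x)))
  | x <- [:: 6; 7; 8; 9], y <- [:: 0; 1]]%N ++
  shift_table (dt_table QZero) ++
  [:: (6, 6, QZero); (7, 7, QZero); (8, 8, QZero); (9, 9, QZero);
      (7, 6, QScale (SOpp (SPow (-1))) (QMul (QGen 6) (QGen 7)));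
      (8, 6, QScale (SOpp (SPow (-1))) (QMul (QGen 6) (QGen 8)));
      (9, 6, QOpp (QMul (QGen 6) (QGen 9)));
      (9, 7, QScale (SOpp (SPow (-1))) (QMul (QGen 7) (QGen 9)));
      (9, 8, QScale (SOpp (SPow (-1))) (QMul (QGen 8) (QGen 9)));
      (8, 7, QAdd (QOpp (QMul (QGen 7) (QGen 8)))
         (QScale (SAdd (SPow 1) (SOpp (SPow (-1)))) (QMul (QGen 6) (QGen 9))))].

Section GL2Rules.
Variables (K : fieldType) (q : K).
Hypothesis q0 : q != 0.

Section Algebra.
Variables (B : algType K) (h : gl2_gen -> B).
Hypothesis hrel : forall s t, gl2_rel q s t -> eval h s = eval h t.

Let a := h (Tgen i1 i1).
Let b := h (Tgen i1 i2).
Let c := h (Tgen i2 i1).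
Let d := h (Tgen i2 i2).
Let D' := h Dinv.

Definition hdet : B := h (Tgen i1 i1) * h (Tgen i2 i2)
  - q^-1 *: (h (Tgen i1 i2) * h (Tgen i2 i1)).

Definition gl2_letters : seq B :=
  [:: hdet; h Dinv; h (Tgen i1 i1); h (Tgen i1 i2); h (Tgen i2 i1); h (Tgen i2 i2)].

Lemma gl2_hrel :
  [/\ b * a = q *: (a * b), c * a = q *: (a * c), d * b = q *: (b * d),
      d * c = q *: (c * d) & c * b = b * c] /\
  [/\ d * a = a * d + (q - q^-1) *: (b * c), hdet * D' = 1 & D' * hdet = 1].
Proof.
split; split.
- by have := hrel (gl2_ba q); rewrite /= -scalerAl mul1r.
- by have := hrel (gl2_ca q); rewrite /= -scalerAl mul1r.
- by have := hrel (gl2_db q); rewrite /= -scalerAl mul1r.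
- by have := hrel (gl2_dc q); rewrite /= -scalerAl mul1r.
- by have := hrel (gl2_cb q).
- have := hrel (gl2_da q); rewrite /= -!scalerAl !mul1r scaleN1r => <-.
  by rewrite addrC subrK.
- have := hrel (gl2_DDinv q); rewrite /= scale1r => <-.
  by rewrite -!scalerAl !mul1r scaleN1r.
have := hrel (gl2_DinvD q); rewrite /= scale1r => <-.
by rewrite -!scalerAl !mul1r scaleN1r.
Qed.

Lemma gl2_pre_ok : rules_ok q (nth 0 [:: a; b; c; d]) (qlookup gl2_pre_table).
Proof.
have [[ba ca db dc cb] [da _ _]] := gl2_hrel.
apply: table_rules_ok; rewrite /=.
by rewrite ba ca !scalerA mulVf // !scale1r.
Qed.

(** [gl2_table] presupposes that D is central; this is therefore computed with the rules for the
    bare generators, where D is expanded. *)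
Lemma hdet_central : [/\ b * hdet = hdet * b, c * hdet = hdet * c,
  a * hdet = hdet * a & d * hdet = hdet * d].
Proof.
by split; rewrite /hdet -/a -/b -/c -/d; nc_ring q0 gl2_pre_ok [:: a; b; c; d].
Qed.

Lemma gl2_table_ok : table_ok q (nth 0 gl2_letters) gl2_table.
Proof.
have [[ba ca db dc cb] [da DD' D'D]] := gl2_hrel.
have [bD cD aD dD] := hdet_central.
have inv x : x * hdet = hdet * x -> x * D' = D' * x.
  by move=> H; rewrite -[LHS]mul1r -D'D mulrA -(mulrA D') -H -!mulrA DD' mulr1.
rewrite /= -/a -/b -/c -/d -/D'.
have ad : a * d = hdet + q^-1 *: (b * c) by rewrite /hdet subrK.
rewrite !inv // bD cD aD dD D'D cb db dc ba ca !scalerA mulVf // !scale1r.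
by rewrite da ad -!addrA -!scalerDl [q^-1 + _]addrC subrK.
Qed.

Lemma gl2_rules_ok : rules_ok q (nth 0 gl2_letters) (qlookup gl2_table).
Proof. exact/table_rules_ok/gl2_table_ok. Qed.

End Algebra.

Section Forms.
Variables (B : dgaType K) (h : gl2_gen -> B).
Hypothesis hdeg : forall g, gr 0 (h g) = h g.
Hypothesis hrel : forall s t, gl2_omega_rel q s t ->
  eval (dgen h) s = eval (dgen h) t.

Lemma omega_hrel s t : gl2_rel q s t -> eval h s = eval h t.
Proof. by move=> /(gl2_omega_alg (q := q))/hrel; rewrite !eval_inl. Qed.

Let a := h (Tgen i1 i1).
Let b := h (Tgen i1 i2).
Let c := h (Tgen i2 i1).
Let d := h (Tgen i2 i2).
Let da := dif a.
Let db := dif b.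
Let dc := dif c.
Let dd := dif d.
Let D' := h Dinv.
Let D := hdet h.

Lemma omega_dt_t i j k l : dif (h (Tgen i j)) * h (Tgen k l)
  = \sum_p \sum_r \sum_n \sum_m (Rmat q k p i r * Rmat q m j n l) *:
      (h (Tgen p n) * dif (h (Tgen r m))).
Proof.
have := hrel (gl2_omega_dt_t q i j k l); rewrite /= => ->.
rewrite eval_sum; apply: eq_bigr => p _; rewrite eval_sum; apply: eq_bigr => r _.
rewrite eval_sum; apply: eq_bigr => n _; rewrite eval_sum; apply: eq_bigr => m _.
by rewrite /= -scalerAl mul1r.
Qed.

Lemma omega_dt_dt i j k l : dif (h (Tgen i j)) * dif (h (Tgen k l))
  = - \sum_p \sum_r \sum_n \sum_m (Rmat q k p i r * Rmat q m j n l) *: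
      (dif (h (Tgen p n)) * dif (h (Tgen r m))).
Proof.
have := hrel (gl2_omega_dt_dt q i j k l); rewrite /= => ->.
rewrite -scalerAl mul1r scaleN1r; congr (- _).
rewrite eval_sum; apply: eq_bigr => p _; rewrite eval_sum; apply: eq_bigr => r _.
rewrite eval_sum; apply: eq_bigr => n _; rewrite eval_sum; apply: eq_bigr => m _.
by rewrite /= -scalerAl mul1r.
Qed.

Lemma omega_pre_ok :
  rules_ok q (nth 0 [:: a; b; c; d; da; db; dc; dd])
    (qlookup (gl2_pre_table ++ dt_table QZero)).
Proof.
have [[ba ca bd cd cb] [ad _ _]] := gl2_hrel omega_hrel.
apply: table_rules_ok; rewrite /= !scaler0 !add0r.
rewrite -/a -/b -/c -/d ba ca !scalerA mulVf // !scale1r.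
by do ![split=> //]; rewrite /da /db /dc /dd omega_dt_t !sum_ord2.
Qed.

Lemma dif_hdet : dif D = da * d + a * dd - q^-1 *: (db * c + b * dc).
Proof.
have dl := @dif_linear K B.
rewrite /D /hdet (linD dl) (linN dl) (linZ dl) !dif_mul.
by rewrite !(sgn_homog (hdeg _)) !scale1r.
Qed.

(** Also computed with D expanded: it is the source of the rules of [omega_table] that move D and
    D^-1 past forms. *)
Lemma dt_hdet x y : dif (h (Tgen x y)) * D = q ^+ 2 *: (D * dif (h (Tgen x y))).
Proof.
rewrite /D /hdet; elim/ord2_ind: x; elim/ord2_ind: y;
  rewrite -/a -/b -/c -/d -/da -/db -/dc -/dd;
  nc_ring q0 omega_pre_ok [:: a; b; c; d; da; db; dc; dd].
Qed.

Lemma dt_Dinv x y : dif (h (Tgen x y)) * D' = q ^ (-2) *: (D' * dif (h (Tgen x y))).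
Proof.
have [_ [_ DD' D'D]] := gl2_hrel omega_hrel.
have E : D' * dif (h (Tgen x y)) = q ^+ 2 *: (dif (h (Tgen x y)) * D').
  by rewrite -[LHS]mulr1 -DD' mulrA -(mulrA D') dt_hdet -scalerAr mulrA D'D mul1r scalerAl.
by rewrite E scalerA -[q ^+ 2]/(q ^ 2) -expfzDr // scale1r.
Qed.

Lemma dif_Dinv : dif D' = - (D' * dif D * D').
Proof.
have dl := @dif_linear K B; have [_ [_ DD' D'D]] := gl2_hrel omega_hrel.
have sD : sgn D = D.
  have sl := @sgn_linear K B.
  rewrite /D /hdet (linD sl) (linN sl) (linZ sl) !sgn_mul.
  by rewrite !(sgn_homog (hdeg _)) !scale1r.
have := congr1 dif DD'; rewrite dif_mul dif_one [sgn _]sD => /eqP.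
rewrite addrC addr_eq0 => /eqP E.
transitivity (D' * (D * dif D')); first by rewrite mulrA D'D mul1r.
by rewrite E mulrN mulrA.
Qed.

Definition omega_letters : seq B :=
  [:: hdet h; h Dinv; h (Tgen i1 i1); h (Tgen i1 i2); h (Tgen i2 i1); h (Tgen i2 i2);
      dif (h (Tgen i1 i1)); dif (h (Tgen i1 i2));
      dif (h (Tgen i2 i1)); dif (h (Tgen i2 i2))].

Definition omega_deg (x : nat) : nat := (5 < x)%N.

Lemma omega_letters_deg x :
  gr (omega_deg x) (nth 0 omega_letters x) = nth 0 omega_letters x.
Proof.
have hM g g' : gr 0 (h g * h g') = h g * h g' by rewrite -[0%N]/(0 + 0)%N gr_mul.
case: x => [|x] /=; first by rewrite /hdet -scaleN1r !(gr_add, gr_scale) !hM.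
do 5![case: x => [|x] /=; first exact: hdeg].
by do 4![case: x => [|x] /=; first exact: dif_homog]; rewrite nth_nil gr_0.
Qed.

Hypothesis q2N1 : q ^+ 2 != -1.

Lemma omega_rules_ok : rules_ok q (nth 0 omega_letters) (qlookup omega_table).
Proof.
have ok0 : rules_ok q (nth 0 omega_letters) (fun _ _ => None) by [].
have N z : (q ^+ 2 + 1) *: z = 0 -> z = 0 :> B.
  move=> /eqP; rewrite scaler_eq0 addr_eq0 (negPf q2N1) /=.
  by move/eqP.
have [[ba ca bd cd cb] [ad _ _]] := gl2_hrel omega_hrel.
(* For equal index pairs only the diagonal entries q of the two R-matrices contribute, whence the
   factor q^2. *)
have sq x : x = - (q ^+ 2 *: x) -> x = 0 :> B.
  by move=> E; apply: N; rewrite scalerDl scale1r {2}E subrr.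
apply/table_rules_ok/table_ok_cat; split.
  exact: (gl2_table_ok omega_hrel).
apply/table_ok_cat; split.
  by rewrite /= !dt_hdet !dt_Dinv.
apply/table_ok_cat; split.
  rewrite /= !scaler0 !add0r.
  by do ![split=> //]; rewrite omega_dt_t !sum_ord2.
rewrite /=.
split; first by apply: sq; rewrite {1}omega_dt_dt !sum_ord2 /Rmat /=; nc_ring q0 ok0 omega_letters.
split; first by apply: sq; rewrite {1}omega_dt_dt !sum_ord2 /Rmat /=; nc_ring q0 ok0 omega_letters.
split; first by apply: sq; rewrite {1}omega_dt_dt !sum_ord2 /Rmat /=; nc_ring q0 ok0 omega_letters.
split; first by apply: sq; rewrite {1}omega_dt_dt !sum_ord2 /Rmat /=; nc_ring q0 ok0 omega_letters.
split; first by rewrite (omega_dt_dt i1 i1 i1 i2) !sum_ord2 /Rmat /=; nc_ring q0 ok0 omega_letters.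
split; first by rewrite (omega_dt_dt i1 i1 i2 i1) !sum_ord2 /Rmat /=; nc_ring q0 ok0 omega_letters.
split; first by rewrite (omega_dt_dt i1 i1 i2 i2) !sum_ord2 /Rmat /=; nc_ring q0 ok0 omega_letters.
split; first by rewrite (omega_dt_dt i1 i2 i2 i2) !sum_ord2 /Rmat /=; nc_ring q0 ok0 omega_letters.
split; first by rewrite (omega_dt_dt i2 i1 i2 i2) !sum_ord2 /Rmat /=; nc_ring q0 ok0 omega_letters.
(* The relation for db dc involves dd da; the second rewriting turns da dd into -dd da to match. *)
split=> //; rewrite (omega_dt_dt i1 i2 i2 i1) (omega_dt_dt i1 i1 i2 i2) !sum_ord2 /Rmat /=.
nc_ring q0 ok0 omega_letters.
Qed.

End Forms.

(** The sign in the relations between 2-forms is that of d(dt t') = -dt dt'. The coproduct, the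
    antipode, the matrix model and the universal property are thereby reduced to the relations
    between dt and t. *)
Lemma omega_relI (B : dgaType K) (h : gl2_gen -> B) :
  (forall g, gr 0 (h g) = h g) ->
  (forall s t, gl2_rel q s t -> eval h s = eval h t) ->
  (forall i j k l, dif (h (Tgen i j)) * h (Tgen k l)
    = \sum_p \sum_r \sum_n \sum_m (Rmat q k p i r * Rmat q m j n l) *:
        (h (Tgen p n) * dif (h (Tgen r m)))) ->
  forall s t, gl2_omega_rel q s t -> eval (dgen h) s = eval (dgen h) t.
Proof.
move=> hdeg hrel hdt _ _ [s t /hrel|i j k l|i j k l]; rewrite ?eval_inl //=.
  rewrite hdt; symmetry.
  rewrite eval_sum; apply: eq_bigr => p _; rewrite eval_sum; apply: eq_bigr => r _.
  rewrite eval_sum; apply: eq_bigr => n _; rewrite eval_sum; apply: eq_bigr => m _.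
  by rewrite /= -scalerAl mul1r.
have dl := @dif_linear K B.
have := congr1 dif (hdt i j k l).
rewrite dif_mul dif_dif mul0r add0r (sgn_homog (dif_homog (hdeg _))) expr1 scaleN1r mulNr.
move=> /(congr1 -%R); rewrite opprK => ->; rewrite -scalerAl mul1r scaleN1r; congr (- _).
rewrite (lin_sum dl) eval_sum; apply: eq_bigr => p _.
rewrite (lin_sum dl) eval_sum; apply: eq_bigr => r _.
rewrite (lin_sum dl) eval_sum; apply: eq_bigr => n _.
rewrite (lin_sum dl) eval_sum; apply: eq_bigr => m _.
rewrite /= -scalerAl mul1r (linZ dl) dif_mul dif_dif mulr0 addr0.
by [].
Qed.

End GL2Rules.

(** * Coproduct and antipode on generators *)

Section Generic.
Variables (K : fieldType) (q : K).
Hypothesis q0 : q != 0.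

Definition gl2_delta (A : gralgType K) (h : gl2_gen -> A) (g : gl2_gen) : tens A A :=
  match g with
  | Tgen i j => \sum_k h (Tgen i k) ⊗ h (Tgen k j)
  | Dinv => h Dinv ⊗ h Dinv
  end.

(* The adjugate matrix divided by D; the argument D is needed since D is not    *)
(* the expression hdet in the opposite algebra.                                *)
Definition gl2_antip (C : algType K) (D : C) (h : gl2_gen -> C) (g : gl2_gen) : C :=
  match g with
  | Tgen i j => h Dinv *
    (if i == i1 then (if j == i1 then h (Tgen i2 i2) else - q *: h (Tgen i1 i2))
     else if j == i1 then - q^-1 *: h (Tgen i2 i1) else h (Tgen i1 i1))
  | Dinv => D
  end.

(* The differential of gl2_antip, in terms of the differentials dh of h *)
Definition gl2_dantip (C : algType K) (h dh : gl2_gen -> C) (i j : 'I_2) : C :=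
  let dD := h (Tgen i2 i2) * dh (Tgen i1 i1) + dh (Tgen i2 i2) * h (Tgen i1 i1)
    - q^-1 *: (h (Tgen i2 i1) * dh (Tgen i1 i2) + dh (Tgen i2 i1) * h (Tgen i1 i2)) in
  let dS x := - (h Dinv * (dD * h Dinv)) * h x + h Dinv * dh x in
  if i == i1 then (if j == i1 then dS (Tgen i2 i2) else - q *: dS (Tgen i1 i2))
  else if j == i1 then - q^-1 *: dS (Tgen i2 i1) else dS (Tgen i1 i1).

Definition letters_of (C : algType K) (D : C) (h dh : gl2_gen -> C) : seq C :=
  [:: D; h Dinv; h (Tgen i1 i1); h (Tgen i1 i2); h (Tgen i2 i1); h (Tgen i2 i2);
      dh (Tgen i1 i1); dh (Tgen i1 i2); dh (Tgen i2 i1); dh (Tgen i2 i2)].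

(** The differentials are formal letters [dh] in a bare algebra, so that the 16 cases are computed
    without the structure of the opposite DGA. *)
Lemma dantip_antip (C : algType K) (D : C) (h dh : gl2_gen -> C) :
  rules_ok q (nth 0 (letters_of D h dh)) (sop_rule omega_deg (qlookup omega_table)) ->
  forall i j k l, gl2_dantip h dh i j * gl2_antip D h (Tgen k l)
    = \sum_p \sum_r \sum_n \sum_m (Rmat q k p i r * Rmat q m j n l) *:
        (gl2_antip D h (Tgen p n) * gl2_dantip h dh r m).
Proof.
move=> ok i j k l; rewrite !sum_ord2.
elim/ord2_ind: i; elim/ord2_ind: j; elim/ord2_ind: k; elim/ord2_ind: l;
  rewrite /Rmat /gl2_dantip /=.
all: nc_ring q0 ok (letters_of D h dh).
Qed.

Section Algebra.
Variables (A : gralgType K) (h : gl2_gen -> A).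
Hypothesis hdeg : forall g, gr 0 (h g) = h g.
Hypothesis hrel : forall s t, gl2_rel q s t -> eval h s = eval h t.

Let ok := gl2_rules_ok q0 hrel.

Lemma gl2_letters_deg x :
  gr ((fun=> 0%N) x) (nth 0 (gl2_letters q h) x) = nth 0 (gl2_letters q h) x.
Proof.
have hM g g' : gr 0 (h g * h g') = h g * h g' by rewrite -[0%N]/(0 + 0)%N gr_mul.
case: x => [|x] /=; first by rewrite /hdet -scaleN1r !(gr_add, gr_scale) !hM.
by do 5![case: x => [|x] /=; first exact: hdeg]; rewrite nth_nil gr_0.
Qed.

Lemma gl2_delta_deg g : gr 0 (gl2_delta h g) = gl2_delta h g.
Proof.
case: g => [i j|] /=.
  by rewrite gr_sum; apply: eq_bigr => k _; rewrite -[0%N]/(0 + 0)%N tens_pure_homog.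
by rewrite -[0%N]/(0 + 0)%N tens_pure_homog.
Qed.

Lemma gl2_delta_rel s t :
  gl2_rel q s t -> eval (gl2_delta h) s = eval (gl2_delta h) t.
Proof.
case; rewrite /= !sum_ord2; nc_tens q0 gl2_letters_deg gl2_letters_deg ok ok
  (gl2_letters q h) (gl2_letters q h).
Qed.

Definition sop_gens : gl2_gen -> sop A := h.

Definition gl2_sop_letters : seq (sop A) :=
  [:: hdet q h : sop A; sop_gens Dinv; sop_gens (Tgen i1 i1);
      sop_gens (Tgen i1 i2); sop_gens (Tgen i2 i1); sop_gens (Tgen i2 i2)].

Lemma gl2_sop_ok :
  rules_ok q (nth 0 gl2_sop_letters) (sop_rule (fun=> 0%N) (qlookup gl2_table)).
Proof. exact: (sop_rules_ok gl2_letters_deg (fun=> isT) ok). Qed.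

Definition gl2_S : gl2_gen -> sop A := gl2_antip (hdet q h : sop A) sop_gens.

Lemma gl2_S_rel s t : gl2_rel q s t -> eval gl2_S s = eval gl2_S t.
Proof. by case; rewrite /=; nc_ring q0 gl2_sop_ok gl2_sop_letters. Qed.

Lemma gl2_S_deg g : gr 0 (gl2_S g) = gl2_S g.
Proof.
have h0 i j : gr 0 (sop_gens (Tgen i j)) = sop_gens (Tgen i j) by exact: hdeg.
case: g => [i j|] /=; last exact: (gl2_letters_deg 0).
rewrite -[0%N]/(0 + 0)%N; apply: gr_mul; first exact: hdeg.
by case: ifP; case: ifP; rewrite ?gr_scale h0.
Qed.

End Algebra.

Section Forms.
Hypothesis q2N1 : q ^+ 2 != -1.
Variables (A : dgaType K) (h : gl2_gen -> A).
Hypothesis hdeg : forall g, gr 0 (h g) = h g.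
Hypothesis hrel : forall s t, gl2_omega_rel q s t ->
  eval (dgen h) s = eval (dgen h) t.

Let ok := omega_rules_ok q0 hrel q2N1.
Let ldeg := omega_letters_deg q hdeg.

Lemma dif_delta i j : dif (gl2_delta h (Tgen i j)) =
  \sum_k (dif (h (Tgen i k)) ⊗ h (Tgen k j) + h (Tgen i k) ⊗ dif (h (Tgen k j))).
Proof.
rewrite /= (lin_sum (@dif_linear _ _)); apply: eq_bigr => k _.
by rewrite [LHS](tens_dif_homog _ (hdeg _)) scale1r.
Qed.

Lemma gl2_delta_omega_rel s t : gl2_omega_rel q s t ->
  eval (dgen (gl2_delta h)) s = eval (dgen (gl2_delta h)) t.
Proof.
apply: omega_relI; [exact: gl2_delta_deg hdeg| |].
  exact: (gl2_delta_rel hdeg (omega_hrel hrel)).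
move=> i j k l; rewrite dif_delta !sum_ord2 !dif_delta /= !sum_ord2.
elim/ord2_ind: i; elim/ord2_ind: j; elim/ord2_ind: k; elim/ord2_ind: l;
  rewrite /Rmat /=.
all: nc_tens q0 ldeg ldeg ok ok (omega_letters q h) (omega_letters q h).
Qed.

Let deg_lt2 x : (omega_deg x < 2)%N. Proof. by rewrite /omega_deg; case: (_ < x)%N. Qed.

Lemma omega_sop_ok :
  rules_ok q (nth 0 (letters_of (hdet q h : sop A) (sop_gens h) (fun g => dif (sop_gens h g))))
    (sop_rule omega_deg (qlookup omega_table)).
Proof. exact: (sop_rules_ok ldeg deg_lt2 ok). Qed.

Let a := sop_gens h (Tgen i1 i1).
Let b := sop_gens h (Tgen i1 i2).
Let c := sop_gens h (Tgen i2 i1).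
Let d := sop_gens h (Tgen i2 i2).
Let D' := sop_gens h Dinv.

(** A word with a single letter of degree 1 reverses without a sign, so the formula for the
    differential of D^-1 is simply read backwards. *)
Lemma dif_sop_Dinv :
  dif D' = - (D' * ((d * dif a + dif d * a - q^-1 *: (c * dif b + dif c * b)) * D')).
Proof.
pose e := QOpp (QMul (QMul (QGen 1)
  (QAdd (QAdd (QMul (QGen 6) (QGen 5)) (QMul (QGen 2) (QGen 9)))
     (QOpp (QScale (SPow (-1)) (QAdd (QMul (QGen 7) (QGen 4)) (QMul (QGen 3) (QGen 8)))))))
  (QGen 1)).
have E : dif (h Dinv) = qeval q (nth 0 (omega_letters q h)) e.
  by rewrite (dif_Dinv hdeg hrel) (dif_hdet _ hdeg).
transitivity (qeval q (sop_env (nth 0 (omega_letters q h))) (qrev e)) => //.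
by rewrite (qeval_rev q ldeg deg_lt2 (isT : qhom omega_deg 1 e)) scale1r.
Qed.

Lemma sop_sgn_gens g : sgn (sop_gens h g) = sop_gens h g.
Proof. by rewrite (sgn_homog (hdeg g : gr 0 (sop_gens h g) = _)) scale1r. Qed.

Lemma gl2_S_omega_rel s t : gl2_omega_rel q s t ->
  eval (dgen (gl2_S h)) s = eval (dgen (gl2_S h)) t.
Proof.
apply: omega_relI; [exact: gl2_S_deg| |].
  exact: (gl2_S_rel hdeg (omega_hrel hrel)).
move=> i j k l.
have dS i' j' : dif (gl2_S h (Tgen i' j')) =
    gl2_dantip (sop_gens h) (fun g => dif (sop_gens h g)) i' j'.
  elim/ord2_ind: i'; elim/ord2_ind: j';
    rewrite /= dif_mul sop_sgn_gens dif_sop_Dinv //;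
    by rewrite (linZ (@dif_linear _ _)) -!scalerAr -scalerDr.
rewrite dS; under eq_bigr do under eq_bigr do under eq_bigr do under eq_bigr do rewrite dS.
exact: (dantip_antip omega_sop_ok).
Qed.

End Forms.
End Generic.

(** * Tensor products of DGA maps, and the Hopf axioms for DGAs *)

Section TensorDGA.
Variable K : fieldType.

Lemma tmap_dif (A B A' B' : dgaType K) (f : A -> A') (g : B -> B') :
  dga_map f -> dga_map g -> forall x, tmap f g (dif x) = dif (tmap f g x).
Proof.
move=> [[fl _ _] fgr fd] [[gl _ _] ggr gd].
have tl := tmap_linear fl gl; have dl := @dif_linear K (tens A B).
have dl' := @dif_linear K (tens A' B').
elim/tens_homog_ind => [x y Hx Hy|m n a b ha hb].
  by rewrite (linD dl) !(linD tl) (linD dl') Hx Hy.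
rewrite [dif (a ⊗ b)](tens_dif_homog _ ha) tmap_pure //.
have hfa : gr m (f a) = f a by rewrite -fgr ha.
rewrite [RHS](tens_dif_homog _ hfa) (linD tl) (linZ tl) !tmap_pure //.
by rewrite fd gd.
Qed.

Lemma tmap_dga (A B A' B' : dgaType K) (f : A -> A') (g : B -> B') :
  dga_map f -> dga_map g -> dga_map (tmap f g).
Proof.
move=> Hf Hg; split; last exact: tmap_dif.
  by case: Hf Hg => [fa fgr _] [ga ggr _]; exact: tmap_alg.
by case: Hf Hg => [fa fgr _] [ga ggr _]; exact: tmap_graded.
Qed.

Lemma tassoc_dif (A B C : dgaType K) (x : tens (tens A B) C) :
  tassoc (dif x) = dif (tassoc x).
Proof.
have tl := @tassoc_linear K A B C; have dl := @dif_linear K (tens (tens A B) C).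
have dl' := @dif_linear K (tens A (tens B C)).
elim/tens_homog_ind: x => [x y Hx Hy|m n ab c hab hc].
  by rewrite (linD dl) !(linD tl) (linD dl') Hx Hy.
rewrite -hab; elim/tens_homog_ind: ab {hab} => [x y Hx Hy|p r a b ha hb].
  by rewrite gr_add tpureDl (linD dl) !(linD tl) (linD dl') Hx Hy.
rewrite (gr_degree _ (tens_pure_homog ha hb)).
case: eqP => [_|_]; last by rewrite tpure0l (lin0 dl) !(lin0 tl) (lin0 dl').
rewrite [dif (_ ⊗ c)](tens_dif_homog _ (tens_pure_homog ha hb)) tassoc_pure.
rewrite [dif (a ⊗ (_ ⊗ _))](tens_dif_homog _ ha).
rewrite [dif (a ⊗ b)](tens_dif_homog _ ha) [dif (b ⊗ c)](tens_dif_homog _ hb).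
rewrite tpureDl tpureZl !(linD tl) !(linZ tl) !tassoc_pure.
rewrite tpureDr tpureZr scalerDr scalerA -exprD addrA.
by [].
Qed.

Lemma dga_map_comp (A B C : dgaType K) (f : B -> C) (g : A -> B) :
  dga_map f -> dga_map g -> dga_map (fun x => f (g x)).
Proof.
move=> [fa fgr fd] [ga ggr gd]; split; first exact: alg_map_comp.
  by move=> n x; rewrite ggr fgr.
by move=> x; rewrite gd fd.
Qed.

Lemma dga_map_id (A : dgaType K) : dga_map (id : A -> A).
Proof. by []. Qed.

End TensorDGA.

Section DGAHopf.
Variables (K : fieldType) (H : dgaType K) (G : Type) (gen : G -> H).
Variables (Delta : H -> tens H H) (eps : H -> K^o) (S : H -> H).
Hypothesis gen_ind : generated_by (dgen gen).
Hypothesis gen_deg : forall g, gr 0 (gen g) = gen g.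
Hypotheses (Dd : dga_map Delta) (ed : dga_map eps).
Hypotheses (Sl : linear S) (S1 : S 1 = 1) (Sgr : graded_map S).
Hypothesis Sd : forall x, S (dif x) = dif (S x).
Hypothesis Smul : forall m n x y, gr m x = x -> gr n y = y ->
  S (x * y) = (-1) ^+ (m * n) *: (S y * S x).

(** All maps involved commute with d, so each axiom for dg follows by differentiating the one for g.
    For the counit and antipode axioms this uses that eps vanishes on exact forms and d(1) = 0. *)
Lemma super_hopf_dga_gen :
  (forall g, tassoc (tmap Delta id (Delta (gen g))) = tmap id Delta (Delta (gen g))) ->
  (forall g, tlift (fun a b => (eps a : K) *: b) (Delta (gen g)) = gen g) ->
  (forall g, tlift (fun a b => (eps b : K) *: a) (Delta (gen g)) = gen g) ->
  (forall g, tlift (fun a b => S a * b) (Delta (gen g)) = (eps (gen g) : K) *: 1) ->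
  (forall g, tlift (fun a b => a * S b) (Delta (gen g)) = (eps (gen g) : K) *: 1) ->
  super_hopf Delta.
Proof.
case: (Dd) => Da Dgr Ddif; case: (ed) => ea egr edif.
have el : linear eps by case: ea.
have dl := @dif_linear K H; have dT := @dif_linear K (tens H H).
have sl := @sgn_linear K H.
move=> Hco Hl Hr Hal Har.
apply: (@super_hopf_gen _ _ _ (dgen gen) (fun g => if g is inl _ then 0%N else 1%N)
  Delta eps S) => //.
- by case=> g //=; exact: dif_homog.
- case=> g //=; rewrite Ddif !tmap_dif ?tassoc_dif ?Hco //; exact: dga_map_id.
- case=> g //=; rewrite Ddif -{2}[gen g]Hl.
  have tl := tlift_linear (counitl_bilin H ea).
  elim/tens_homog_ind: (Delta (gen g)) => [x y Hx Hy|m n a b ha hb].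
    by rewrite (linD dT) !(linD tl) (linD dl) Hx Hy.
  rewrite [dif (_ ⊗ _)](tens_dif_pure a b) (linD tl).
  rewrite !tlift_pure; try exact: (counitl_bilin H ea).
  rewrite edif regular_dif scale0r add0r (linZ dl) (sgn_map el egr).
  by rewrite (sgn_homog (erefl : gr 0 (eps a) = _)) scale1r.
- case=> g //=; rewrite Ddif -{2}[gen g]Hr.
  have tl := tlift_linear (counitr_bilin H ea).
  elim/tens_homog_ind: (Delta (gen g)) => [x y Hx Hy|m n a b ha hb].
    by rewrite (linD dT) !(linD tl) (linD dl) Hx Hy.
  rewrite [dif (_ ⊗ _)](tens_dif_pure a b) (linD tl).
  rewrite !tlift_pure; try exact: (counitr_bilin H ea).
  rewrite edif regular_dif scale0r addr0 (linZ dl).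
  by [].
- case=> g //=; rewrite edif regular_dif scale0r Ddif.
  have tl := tlift_linear (lantip_bilin Sl).
  transitivity (dif (tlift (fun a b => S a * b) (Delta (gen g)))); last first.
    by rewrite Hal (linZ dl) dif_one scaler0.
  elim/tens_homog_ind: (Delta (gen g)) => [x y Hx Hy|m n a b ha hb].
    by rewrite (linD dT) !(linD tl) (linD dl) Hx Hy.
  rewrite [dif (_ ⊗ _)](tens_dif_pure a b) (linD tl).
  rewrite !tlift_pure; try exact: (lantip_bilin Sl).
  by rewrite dif_mul Sd (sgn_map Sl Sgr).
case=> g //=; rewrite edif regular_dif scale0r Ddif.
have tl := tlift_linear (rantip_bilin Sl).
transitivity (dif (tlift (fun a b => a * S b) (Delta (gen g)))); last first.
  by rewrite Har (linZ dl) dif_one scaler0.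
elim/tens_homog_ind: (Delta (gen g)) => [x y Hx Hy|m n a b ha hb].
  by rewrite (linD dT) !(linD tl) (linD dl) Hx Hy.
rewrite [dif (_ ⊗ _)](tens_dif_pure a b) (linD tl).
rewrite !tlift_pure; try exact: (rantip_bilin Sl).
by rewrite dif_mul Sd.
Qed.

End DGAHopf.

(** * Strong bicovariance *)

Section GeneratorIdentities.
Variables (K : fieldType) (q : K).
Hypothesis q0 : q != 0.
Variables (A : gralgType K) (h : gl2_gen -> A).
Hypothesis hdeg : forall g, gr 0 (h g) = h g.
Hypothesis hrel : forall s t, gl2_rel q s t -> eval h s = eval h t.
Variables (Delta : A -> tens A A) (eps : A -> K^o) (S : A -> A).
Hypotheses (Da : alg_map Delta) (ea : alg_map eps).
Hypothesis Sa : alg_map (S : A -> sop A).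
Hypothesis DE : forall g, Delta (h g) = gl2_delta h g.
Hypothesis eE : forall g, eps (h g) = gl2_char K g.
Hypothesis SE : forall g, S (h g) = gl2_S q h g.

Let idl : linear (id : A -> A). Proof. by []. Qed.
Let Dl : linear Delta. Proof. by case: Da. Qed.
Let Sl : linear S. Proof. by case: Sa. Qed.

Lemma gl2_coassoc g :
  tassoc (tmap Delta id (Delta (h g))) = tmap id Delta (Delta (h g)).
Proof.
have tl := @tassoc_linear K A A A; have Dil := tmap_linear Dl idl.
have iDl := tmap_linear idl Dl; rewrite DE; case: g => [i j|] /=; last first.
  by rewrite !tmap_pure // DE tassoc_pure.
rewrite !sum_ord2 (linD Dil) (linD iDl) !tmap_pure // !DE /= !sum_ord2.
rewrite !tpureDl !(linD tl) !tassoc_pure !tpureDr.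
by rewrite addrACA.
Qed.

Lemma gl2_counitl g : tlift (fun a b => (eps a : K) *: b) (Delta (h g)) = h g.
Proof.
have bl := counitl_bilin A ea; have tl := tlift_linear bl.
rewrite DE; case: g => [i j|] /=; last by rewrite (tlift_pure _ _ bl) eE scale1r.
rewrite sum_ord2 (linD tl) !(tlift_pure _ _ bl) !eE /=.
by elim/ord2_ind: i; rewrite /= scale0r scale1r ?addr0 ?add0r.
Qed.

Lemma gl2_counitr g : tlift (fun a b => (eps b : K) *: a) (Delta (h g)) = h g.
Proof.
have bl := counitr_bilin A ea; have tl := tlift_linear bl.
rewrite DE; case: g => [i j|] /=; last by rewrite (tlift_pure _ _ bl) eE scale1r.
rewrite sum_ord2 (linD tl) !(tlift_pure _ _ bl) !eE /=.
by elim/ord2_ind: j; rewrite /= scale0r scale1r ?addr0 ?add0r.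
Qed.

Let ok := gl2_rules_ok q0 hrel.

(* gl2_S is written with products in the opposite algebra; here it is in A. *)
Let SA (g : gl2_gen) : A :=
  match g with
  | Tgen i j =>
    (if i == i1 then (if j == i1 then h (Tgen i2 i2) else - q *: h (Tgen i1 i2))
     else if j == i1 then - q^-1 *: h (Tgen i2 i1) else h (Tgen i1 i1)) * h Dinv
  | Dinv => hdet q h
  end.

Let SAE g : gl2_S q h g = SA g.
Proof.
case: g => [i j|] //=; rewrite /gl2_S /= (@sop_mul _ _ 0 0) ?scale1r //; first exact: hdeg.
have e0 x y : gr 0 (sop_gens h (Tgen x y)) = sop_gens h (Tgen x y) by exact: hdeg.
by case: ifP; case: ifP; rewrite ?gr_scale e0.
Qed.

Lemma gl2_antipl g : tlift (fun a b => S a * b) (Delta (h g)) = (eps (h g) : K) *: 1.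
Proof.
have bl := lantip_bilin Sl; have tl := tlift_linear bl.
rewrite DE eE; case: g => [i j|] /=; last first.
  rewrite (tlift_pure _ _ bl) SE SAE /=; nc_ring q0 ok (gl2_letters q h).
rewrite sum_ord2 (linD tl) !(tlift_pure _ _ bl) !SE !SAE /=.
by elim/ord2_ind: i; elim/ord2_ind: j; rewrite /= ?mulr1n ?mulr0n; nc_ring q0 ok (gl2_letters q h).
Qed.

Lemma gl2_antipr g : tlift (fun a b => a * S b) (Delta (h g)) = (eps (h g) : K) *: 1.
Proof.
have bl := rantip_bilin Sl; have tl := tlift_linear bl.
rewrite DE eE; case: g => [i j|] /=; last first.
  rewrite (tlift_pure _ _ bl) SE SAE /=; nc_ring q0 ok (gl2_letters q h).
rewrite sum_ord2 (linD tl) !(tlift_pure _ _ bl) !SE !SAE /=.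
by elim/ord2_ind: i; elim/ord2_ind: j; rewrite /= ?mulr1n ?mulr0n; nc_ring q0 ok (gl2_letters q h).
Qed.

Hypotheses (Dgr : graded_map Delta) (egr : graded_map eps) (Sgr : graded_map S).

Lemma sop_alg_map_mul m n x y : gr m x = x -> gr n y = y ->
  S (x * y) = (-1) ^+ (m * n) *: (S y * S x).
Proof.
case: Sa => _ _ SM hx hy; rewrite SM (@sop_mul _ _ m n) //.
  exact: etrans (esym (Sgr m x)) (congr1 S hx).
exact: etrans (esym (Sgr n y)) (congr1 S hy).
Qed.

Lemma gl2_super_hopf : generated_by h -> super_hopf Delta.
Proof.
move=> hgen; have S1 : S 1 = 1 by case: Sa.
apply: (super_hopf_gen hgen hdeg Da Dgr ea egr Sl S1 Sgr sop_alg_map_mul).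
- exact: gl2_coassoc.
- exact: gl2_counitl.
- exact: gl2_counitr.
- exact: gl2_antipl.
exact: gl2_antipr.
Qed.

End GeneratorIdentities.

Lemma gl2_omega_super_hopf (K : fieldType) (q : K) (A : dgaType K) (h : gl2_gen -> A)
    (Delta : A -> tens A A) (eps : A -> K^o) (S : A -> A) :
  q != 0 -> (forall g, gr 0 (h g) = h g) ->
  (forall s t, gl2_rel q s t -> eval h s = eval h t) ->
  dga_map Delta -> dga_map eps -> dga_map (S : A -> sop A) ->
  (forall g, Delta (h g) = gl2_delta h g) ->
  (forall g, eps (h g) = gl2_char K g) -> (forall g, S (h g) = gl2_S q h g) ->
  generated_by (dgen h) -> super_hopf Delta.
Proof.
move=> q0 hdeg hrel Dd ed [Sa Sgr Sdif] DE eE SE hgen.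
have Da : alg_map Delta by case: Dd.
have ea : alg_map eps by case: ed.
have [Sl S1 _] := Sa.
apply: (super_hopf_dga_gen hgen hdeg Dd ed Sl S1 Sgr Sdif (sop_alg_map_mul Sa Sgr)).
- exact: gl2_coassoc.
- exact: gl2_counitl.
- exact: gl2_counitr.
- exact: (gl2_antipl q0 hdeg hrel Sa DE eE SE).
exact: (gl2_antipr q0 hdeg hrel Sa DE eE SE).
Qed.

Lemma tmap_gl2_delta (K : fieldType) (A B : gralgType K) (f : A -> B) (h : gl2_gen -> A) g :
  linear f -> tmap f f (gl2_delta h g) = gl2_delta (fun g => f (h g)) g.
Proof.
move=> fl; case: g => [i j|] /=; last by rewrite tmap_pure.
by rewrite !sum_ord2 (linD (tmap_linear fl fl)) !tmap_pure.
Qed.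


Section Hopf.
Variables (K : fieldType) (q : K).

Definition genG (g : gl2_gen) : GL2 q := palg_gen _ g.

Lemma genG_generated : generated_by genG.
Proof. exact: palg_generated. Qed.

Lemma genG_rel s t : gl2_rel q s t -> eval genG s = eval genG t.
Proof. exact: palg_rel. Qed.

Definition genO (g : gl2_gen) : OmegaGL2 q := pdga_gen _ g.

Lemma genO_generated : generated_by (dgen genO).
Proof.
move=> P Pg Pk PD PM; apply: pdga_generated => // g; first exact: (Pg (inl g)).
exact: (Pg (inr g)).
Qed.

Lemma genO_rel s t : gl2_omega_rel q s t -> eval (dgen genO) s = eval (dgen genO) t.
Proof. exact: pdga_rel. Qed.

Lemma genO_deg g : gr 0 (genO g) = genO g.
Proof. exact: pdga_gen_deg. Qed.

Lemma genO_alg_rel s t : gl2_rel q s t -> eval genO s = eval genO t.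
Proof. exact: (omega_hrel genO_rel). Qed.

Definition liftG (B : algType K) (h : gl2_gen -> B) : GL2 q -> B := palg_lift h.

Lemma liftGP (B : algType K) (h : gl2_gen -> B) :
    (forall s t, gl2_rel q s t -> eval h s = eval h t) ->
  alg_map (liftG h) /\ forall g, liftG h (genG g) = h g.
Proof. exact: palg_liftP. Qed.

Definition liftO (B : dgaType K) (h : gl2_gen -> B) : OmegaGL2 q -> B := pdga_lift h.

Lemma liftOP (B : dgaType K) (h : gl2_gen -> B) :
    (forall g, gr 0 (h g) = h g) ->
    (forall s t, gl2_omega_rel q s t -> eval (dgen h) s = eval (dgen h) t) ->
  dga_map (liftO h) /\ forall g, liftO h (genO g) = h g.
Proof. exact: pdga_liftP. Qed.

Lemma omegaGL2P : alg_map (@omegaGL2 K q) /\ forall g, omegaGL2 (genG g) = genO g.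
Proof. exact: (liftGP genO_alg_rel). Qed.

Let genG_deg g : gr 0 (genG g) = genG g. Proof. by []. Qed.

Hypothesis q0 : q != 0.

Lemma DeltaGL2P : alg_map (@DeltaGL2 K q) /\
  forall g, DeltaGL2 (genG g) = gl2_delta genG g.
Proof.
apply: (@liftGP _ (gl2_delta genG)).
exact: (gl2_delta_rel q0 genG_deg genG_rel).
Qed.

Lemma GL2_hopf : super_hopf (@DeltaGL2 K q).
Proof.
have [Da DE] := DeltaGL2P; have [ea eE] := liftGP (@gl2_char_rel K q).
have [Sa SE] := liftGP (gl2_S_rel q0 genG_deg genG_rel).
apply: (gl2_super_hopf q0 genG_deg genG_rel Da ea Sa DE eE SE _ _ _ genG_generated).
- apply: (graded_map_gen genG_generated Da genG_deg) => g.
  by rewrite DE; apply: (gl2_delta_deg genG_deg).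
- exact: (graded_map_gen genG_generated ea genG_deg).
by case=> [|n] x //; case: Sa => Sl _ _; exact: (lin0 Sl).
Qed.

Hypothesis q2N1 : q ^+ 2 != -1.

Lemma omegaGL2_graded : graded_map (@omegaGL2 K q).
Proof.
have [wa wE] := omegaGL2P.
apply: (graded_map_gen genG_generated wa genG_deg) => g.
by rewrite wE; exact: genO_deg.
Qed.

Lemma OmegaGL2_bicovariant : strongly_bicovariant (@DeltaGL2 K q) (@omegaGL2 K q).
Proof.
have [Dd DE] := liftOP (gl2_delta_deg genO_deg)
  (gl2_delta_omega_rel q0 q2N1 genO_deg genO_rel).
have [ed eE] := liftOP (fun=> erefl) (@gl2_char_omega_rel K q).
have [Sd SE] := liftOP (gl2_S_deg q genO_deg)
  (gl2_S_omega_rel q0 q2N1 genO_deg genO_rel).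
exists (liftO (gl2_delta genO)).
have [Da Dgr Ddif] := Dd; split=> //.
  exact: (gl2_omega_super_hopf q0 genO_deg genO_alg_rel Dd ed Sd DE eE SE genO_generated).
have [wa wE] := omegaGL2P; have [DGa DGE] := DeltaGL2P.
apply: (alg_map_eq genG_generated).
- exact: alg_map_comp.
- by apply: alg_map_comp => //; apply: tmap_alg => //; exact: omegaGL2_graded.
move=> g; rewrite wE DE DGE tmap_gl2_delta; last by case: wa.
by congr gl2_delta; apply/funext => g'; rewrite wE.
Qed.

Lemma OmegaGL2_exterior : exterior_algebra (@omegaGL2 K q).
Proof.
apply: presented_exterior; first exact: gl2_omega_alg.
move=> B h d0 hrel _ _ [s t /hrel|i j k l|i j k l] /=; rewrite ?eval_inl // d0 mul0r.
  symmetry; rewrite eval_sum big1 // => p _; rewrite eval_sum big1 // => r _.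
  rewrite eval_sum big1 // => n _; rewrite eval_sum big1 // => m _ /=.
  by rewrite !d0 ?(mulr0, mul0r).
symmetry; rewrite eval_sum big1 ?mulr0 // => p _; rewrite eval_sum big1 // => r _.
rewrite eval_sum big1 // => n _; rewrite eval_sum big1 // => m _ /=.
by rewrite !d0 ?(mulr0, mul0r).
Qed.

End Hopf.

(** * The dimension of the calculus *)

(* The letter 5 i + j stands for the matrix unit E_ij of the 5 x 5 matrices.   *)
Definition mx_rule (x y : nat) : option qexp :=
  if (x < 25)%N && (y < 25)%N then
    Some (if (x %% 5 == y %/ 5)%N then QGen (5 * (x %/ 5) + y %% 5) else QZero)
  else None.

Definition tsum2 (F : nat -> texp) : texp := TAdd (F 0%N) (F 1%N).

Definition mx_unit (i j : nat) : qexp := QGen (5 * i + j).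

(* The left A-module of 1-forms has the basis dt^i_j, to which we assign the   *)
(* index 1 + 2 i + j. The matrix psi a is block diagonal: its blocks are a and *)
(* the matrix of the right multiplication by a on the 1-forms. In phi = psi +  *)
(* corner, row 0 of corner contains the coefficients of da.                    *)
Definition psi_texp (g : gl2_gen) : texp :=
  match g with
  | Tgen k l =>
    TAdd (TPure (mx_unit 0 0) (QGen (2 + (2 * k + l))))
    (tsum2 (fun i => tsum2 (fun j => tsum2 (fun r => tsum2 (fun m =>
      tsum2 (fun p => tsum2 (fun n =>
        TScale (SMul (Rscal k p i r) (Rscal m j n l))
          (TPure (mx_unit (1 + (2 * i + j)) (1 + (2 * r + m)))
             (QGen (2 + (2 * p + n)))))))))))
  | Dinv =>
    TAdd (TPure (mx_unit 0 0) (QGen 1))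
      (TScale (SPow (-2))
         (TPure (QAdd (QAdd (mx_unit 1 1) (mx_unit 2 2)) (QAdd (mx_unit 3 3) (mx_unit 4 4)))
            (QGen 1)))
  end.

(** For D^-1 the entries are the coefficients in dD^-1 = -q^-2 D^-2 dD, where dD = a dd - q^-1 b dc
    - q^-1 c db + q^-2 d da once all differentials are moved to the right. *)
Definition corner_texp (g : gl2_gen) : texp :=
  match g with
  | Tgen k l => TPure (mx_unit 0 (1 + (2 * k + l))) QOne
  | Dinv =>
    let e (i x : nat) := TPure (mx_unit 0 i) (QMul (QMul (QGen 1) (QGen 1)) (QGen x)) in
    TScale (SOpp (SPow (-2)))
      (TAdd (TAdd (e 4 2) (TScale (SOpp (SPow (-1))) (e 3 3)))
         (TAdd (TScale (SOpp (SPow (-1))) (e 2 4)) (TScale (SPow (-2)) (e 1 5))))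
  end.

Lemma Rmat_scal (K : fieldType) (q : K) (i j k l : 'I_2) :
  Rmat q i j k l = seval q (Rscal i j k l).
Proof.
rewrite /Rmat /Rscal.
elim/ord2_ind: i; elim/ord2_ind: j; elim/ord2_ind: k; elim/ord2_ind: l;
  by rewrite /= ?expr1z.
Qed.

Section CalculusModel.
Variables (K : fieldType) (q : K).
Hypothesis q0 : q != 0.
Variables (M : gralgType K) (E : nat -> M).
Hypothesis Edeg : forall x, gr ((fun=> 0%N) x) (E x) = E x.
Hypothesis Eok : rules_ok q E mx_rule.
Hypothesis E1 : E 0%N + E 6%N + E 12%N + E 18%N + E 24%N = 1.
Variables (A : gralgType K) (h : gl2_gen -> A).
Hypothesis hdeg : forall g, gr 0 (h g) = h g.
Hypothesis hrel : forall s t, gl2_rel q s t -> eval h s = eval h t.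

Let ok := gl2_rules_ok q0 hrel.
Let ldeg := gl2_letters_deg q hdeg.
Local Notation ev := (@teval K q M A E (nth 0 (gl2_letters q h))).

Definition psi_mx g : tens M A := ev (psi_texp g).
Definition corner_mx g : tens M A := ev (corner_texp g).
Definition phi_mx g : tens M A := psi_mx g + corner_mx g.

Let one : ev (TPure (QAdd (QAdd (QAdd (QAdd (QGen 0) (QGen 6)) (QGen 12)) (QGen 18))
  (QGen 24)) QOne) = 1.
Proof. by rewrite /= E1. Qed.

Lemma psi_mx_rel s t : gl2_rel q s t -> eval psi_mx s = eval psi_mx t.
Proof.
case; rewrite /= /psi_mx.
(* The matrices are already given as expressions [texp], so no letters have to be recognised and the
   lists are empty. *)
1-6: nc_tens q0 Edeg ldeg Eok ok (@nil M) (@nil A).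
(* The rules do not know that the diagonal matrix units sum to 1, so the unit is expanded
   beforehand. *)
all: rewrite scale1r -one.
all: nc_tens q0 Edeg ldeg Eok ok (@nil M) (@nil A).
Qed.

(** The corner lies in row 0 and columns 1 to 4, so products of two corners vanish. What remains is
    that the corner respects the relations as a derivation along psi, which is the Leibniz rule for
    d. *)
Lemma phi_mx_rel s t : gl2_rel q s t -> eval phi_mx s = eval phi_mx t.
Proof.
case; rewrite /= /phi_mx /psi_mx /corner_mx.
1-6: nc_tens q0 Edeg ldeg Eok ok (@nil M) (@nil A).
all: rewrite scale1r -one.
all: nc_tens q0 Edeg ldeg Eok ok (@nil M) (@nil A).
Qed.

Lemma corner_mx_dt_t i j k l : corner_mx (Tgen i j) * phi_mx (Tgen k l)
  = \sum_p \sum_r \sum_n \sum_m (Rmat q k p i r * Rmat q m j n l) *: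
      (psi_mx (Tgen p n) * corner_mx (Tgen r m)).
Proof.
rewrite /phi_mx /psi_mx /corner_mx !sum_ord2.
elim/ord2_ind: i; elim/ord2_ind: j; elim/ord2_ind: k; elim/ord2_ind: l;
  rewrite !Rmat_scal.
all: nc_tens q0 Edeg ldeg Eok ok (@nil M) (@nil A).
Qed.

Definition cal_gen (g : gl2_gen) : tri (tens M A) := Tri (psi_mx g) 0 (phi_mx g).

Lemma cal_gen_deg g : gr 0 (cal_gen g) = cal_gen g. Proof. by []. Qed.

(** Diagonal matrices multiply entrywise, so the algebra relations can be checked for psi and phi
    separately. *)
Lemma eval_tri s : eval cal_gen s = Tri (eval psi_mx s) 0 (eval phi_mx s).
Proof.
elim: s => //= [k|s -> t ->|s -> t ->].
- by apply: tri_ext; rewrite //= scaler0.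
- by apply: tri_ext; rewrite //= addr0.
by rewrite tri_mkM mulr0 mul0r addr0.
Qed.

Lemma cal_gen_omega_rel s t : gl2_omega_rel q s t ->
  eval (dgen cal_gen) s = eval (dgen cal_gen) t.
Proof.
apply: omega_relI; [exact: cal_gen_deg| |].
  by move=> s' t' st; rewrite !eval_tri (psi_mx_rel st) (phi_mx_rel st).
have difE g : dif (cal_gen g) = Tri 0 (corner_mx g) 0.
  by rewrite tri_difE /phi_mx addrAC subrr add0r.
move=> i j k l; rewrite difE tri_mkM !mul0r add0r corner_mx_dt_t.
have cl : linear (fun m : tens M A => Tri 0 m 0).
  by move=> c x y; apply: tri_ext; rewrite /= ?scaler0 ?addr0.
rewrite (lin_sum cl); apply: eq_bigr => p _; rewrite (lin_sum cl); apply: eq_bigr => r _.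
rewrite (lin_sum cl); apply: eq_bigr => n _; rewrite (lin_sum cl); apply: eq_bigr => m _.
by rewrite (linZ cl) difE tri_mkM !mulr0 addr0.
Qed.

(** The block of psi at position (0, 0) is the element itself. Hence psi(a) E_0k = a E_0k, and the
    coefficients of a 1-form can be recovered from its image. *)
Lemma psi_mx_col g : psi_mx g * (E 0 ⊗ 1) = E 0 ⊗ h g.
Proof.
transitivity (psi_mx g * ev (TPure (QGen 0) QOne)) => //; rewrite /psi_mx.
transitivity (ev (TPure (QGen 0) (QGen (if g is Tgen i j then 2 + (2 * i + j) else 1)))).
  case: g => [i j|]; last by nc_tens q0 Edeg ldeg Eok ok (@nil M) (@nil A).
  elim/ord2_ind: i; elim/ord2_ind: j; nc_tens q0 Edeg ldeg Eok ok (@nil M) (@nil A).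
by case: g => [i j|] //; elim/ord2_ind: i; elim/ord2_ind: j.
Qed.

End CalculusModel.

(** * The 5 x 5 matrix model and linear independence of the dt^i_j *)

Section MatrixUnits.
Variables (K : fieldType) (q : K).

Definition mxM : algType K := 'M[K]_5.
Definition mxE5 (x : nat) : deg0 mxM :=
  delta_mx (inord (x %/ 5)) (inord (x %% 5)) : 'M[K]_5.

Lemma mxE5_ok : rules_ok q mxE5 mx_rule.
Proof.
move=> x y e; rewrite /mx_rule; case: andP => // -[lx ly] [<-].
have lt5 z : (z < 25)%N -> (z %/ 5 < 5)%N by move=> lz; rewrite ltn_divLR.
transitivity ((mxE5 x : 'M[K]_5) *m (mxE5 y : 'M[K]_5)) => //; rewrite /mxE5.
rewrite mul_delta_mx_cond -val_eqE /= !inordK ?ltn_mod ?lt5 //.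
case: eqP => _ //=; rewrite /mxE5 mulr1n.
by rewrite mulnC divnMDl // modnMDl modn_mod (divn_small (ltn_pmod _ _)) // addn0.
Qed.

Lemma mxE5_sum : mxE5 0 + mxE5 6 + mxE5 12 + mxE5 18 + mxE5 24 = 1.
Proof.
have H : (1 : 'M[K]_5) = \sum_i delta_mx i i by rewrite -mx1_sum_delta.
rewrite !big_ord_recr big_ord0 /= add0r in H; apply: etrans (esym H).
by do ![congr (_ + _)]; congr (delta_mx _ _ : 'M[K]_5); apply: val_inj; rewrite /= inordK.
Qed.

End MatrixUnits.

Section CalculusDim.
Variables (K : fieldType) (q : K).
Hypothesis q0 : q != 0.

Local Notation A := (GL2 q).
Local Notation C := (tens (deg0 (mxM K)) A).
Let genG_deg g : gr 0 (genG q g) = genG q g. Proof. by []. Qed.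
Let Edeg x : gr ((fun=> 0%N) x) (mxE5 K x) = mxE5 K x. Proof. by []. Qed.
Let Eok := @mxE5_ok K q.
Let psi := psi_mx q (mxE5 K) (genG q).
Let cal := cal_gen q (mxE5 K) (genG q).

Lemma calP : dga_map (liftO (q := q) cal) /\
  forall g, liftO (q := q) cal (genO q g) = cal g.
Proof.
apply: liftOP => //.
exact: (cal_gen_omega_rel q0 Edeg Eok (@mxE5_sum K) genG_deg (@genG_rel K q)).
Qed.

Definition psi_alg : A -> C := liftG psi.

Lemma psi_algP : alg_map psi_alg /\ forall g, psi_alg (genG q g) = psi g.
Proof.
apply: liftGP.
exact: (psi_mx_rel q0 Edeg Eok (@mxE5_sum K) genG_deg (@genG_rel K q)).
Qed.

Lemma psi_alg_col a : psi_alg a * (mxE5 K 0 ⊗ 1) = mxE5 K 0 ⊗ a.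
Proof.
have [[pl p1 pM] pE] := psi_algP.
elim/(@genG_generated K q): a => [g|k|x y Hx Hy|x y Hx Hy].
- rewrite pE; exact: (psi_mx_col q0 Edeg Eok genG_deg (@genG_rel K q)).
- by rewrite (linZ pl) p1 -scalerAl mul1r tpureZr.
- by rewrite (linD pl) mulrDl Hx Hy tpureDr.
rewrite pM -mulrA Hy -[X in _ * X]tens_inlr mulrA Hx.
by rewrite [LHS](tens_mul_homog _ _ (erefl : gr 0 x = x) (@gr_one K _)) scale1r mulr1.
Qed.

(** Taking the upper left entry is multiplicative, so both sides are algebra maps and it suffices to
    compare generators. *)
Lemma cal_l a : tri_l (liftO (q := q) cal (omegaGL2 a)) = psi_alg a.
Proof.
have [[ca _ _] cE] := calP; have [pa pE] := psi_algP.
have [wa wE] := @omegaGL2P K q.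
have fa : alg_map (fun a => tri_l (liftO (q := q) cal (omegaGL2 a)) : C).
  split=> [k x y||x y].
  - by case: wa => wl _ _; case: ca => cl _ _; rewrite wl cl.
  - by case: wa => _ w1 _; case: ca => _ c1 _; rewrite w1 c1.
  by case: wa => _ _ wM; case: ca => _ _ cM; rewrite wM cM.
by apply: (alg_map_eq (@genG_generated K q) fa pa) => g; rewrite wE cE pE.
Qed.

Definition gen4 (k : 'I_4) : gl2_gen :=
  match val k with
  | 0 => Tgen i1 i1 | 1 => Tgen i1 i2 | 2 => Tgen i2 i1 | _ => Tgen i2 i2
  end.

Lemma gen4_surj i j : exists k, gen4 k = Tgen i j.
Proof.
elim/ord2_ind: i; elim/ord2_ind: j.
- by exists (inord 0); rewrite /gen4 /= inordK.
- by exists (inord 1); rewrite /gen4 /= inordK.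
- by exists (inord 2); rewrite /gen4 /= inordK.
by exists (inord 3); rewrite /gen4 /= inordK.
Qed.

Definition form4 (c : {ffun 'I_4 -> A}) : OmegaGL2 q :=
  \sum_k omegaGL2 (c k) * dif (genO q (gen4 k)).

Lemma cal_form4 c :
  tri_m (liftO (q := q) cal (form4 c)) = \sum_(k < 4) mxE5 K k.+1 ⊗ c k.
Proof.
have [[[cl c1 cM] cgr cd] cE] := calP.
rewrite (lin_sum cl) (lin_sum (@tri_m_linear _ _)); apply: eq_bigr => k _.
have mM (u v : tri C) : tri_m (u * v) = tri_l u * tri_m v + tri_m u * tri_r v by [].
rewrite cM cd cE mM cal_l /cal /cal_gen tri_difE [tri_m _]/= [tri_r _]/= mulr0 addr0.
rewrite /phi_mx addrAC subrr add0r.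
have Ek : mxE5 K 0 * mxE5 K k.+1 = mxE5 K k.+1.
  by apply: (Eok (e := QGen k.+1)); case: k => -[|[|[|[|//]]]].
have -> : corner_mx q (mxE5 K) (genG q) (gen4 k) = (mxE5 K 0 ⊗ 1) * (mxE5 K k.+1 ⊗ 1).
  rewrite [RHS](tens_mul_homog _ _ (@gr_one K _) (Edeg _)) scale1r mul1r.
  by rewrite Ek; case: (k) => -[|[|[|[|//]]]] lt.
(* The factorisation E_0k = E_00 E_0k makes [psi_alg_col] applicable. *)
transitivity (psi_alg (c k) * (mxE5 K 0 ⊗ 1) * (mxE5 K k.+1 ⊗ 1)); first exact: mulrA.
rewrite psi_alg_col.
rewrite [LHS](tens_mul_homog _ _ (erefl : gr 0 (c k) = c k) (Edeg _)) scale1r mulr1.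
by rewrite Ek.
Qed.

Lemma form4_inj c c' : form4 c = form4 c' -> c = c'.
Proof.
move=> /(congr1 (fun w => tri_m (liftO (q := q) cal w))); rewrite !cal_form4 => H.
apply/ffunP => k.
pose f (m : deg0 (mxM K)) (a : A) : A := (m : 'M[K]_5) (inord 0) (inord k.+1) *: a.
have fb : bilin f.
  split=> [a|m] s x y; first by rewrite /f !mxE scalerDl scalerA.
  by rewrite /f scalerDr !scalerA mulrC.
have EE (j : 'I_4) : mxE5 K j.+1 = delta_mx (inord 0) (inord j.+1) :> 'M[K]_5.
  by case: j => -[|[|[|[|//]]]] lt.
have fE d : tlift f (\sum_(k < 4) mxE5 K k.+1 ⊗ d k) = d k.
  rewrite (lin_sum (tlift_linear fb)) (bigD1 k) //= big1 ?addr0 => [|j jk].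
    by rewrite tlift_pure // /f EE mxE !eqxx scale1r.
  rewrite tlift_pure // /f EE mxE eqxx -val_eqE /= !inordK ?ltnS; try exact: (ltn_ord (_ : 'I_4)).
  by rewrite eqSS eq_sym (inj_eq val_inj) (negPf jk) scale0r.
by rewrite -(fE c) H fE.
Qed.

End CalculusDim.

(** * The dt^i_j span the 1-forms as a left module *)

Section Span.
Variables (K : fieldType) (q : K).
Hypothesis q0 : q != 0.

Local Notation A := (GL2 q).
Local Notation W := (OmegaGL2 q).
Local Notation dt x := (dif (genO q x)).

Let wa : alg_map (@omegaGL2 K q). Proof. by case: (@omegaGL2P K q). Qed.
Let wl : linear (@omegaGL2 K q). Proof. by case: wa. Qed.
Let wM x y : omegaGL2 (x * y) = omegaGL2 x * omegaGL2 y :> W.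
Proof. by case: wa. Qed.
Let wE g : omegaGL2 (genG q g) = genO q g. Proof. by case: (@omegaGL2P K q). Qed.

Definition spanned (w : W) : Prop := exists c, w = form4 (q := q) c.

Lemma spanned_add v w : spanned v -> spanned w -> spanned (v + w).
Proof.
move=> [c ->] [c' ->]; exists [ffun k => c k + c' k].
rewrite /form4 -big_split; apply: eq_bigr => k _.
by rewrite ffunE (linD wl) mulrDl.
Qed.

Lemma spanned_mull a w : spanned w -> spanned (omegaGL2 a * w).
Proof.
move=> [c ->]; exists [ffun k => a * c k].
rewrite /form4 mulr_sumr; apply: eq_bigr => k _.
by rewrite ffunE wM mulrA.
Qed.

Lemma spanned_scale k w : spanned w -> spanned (k *: w).
Proof.
move=> /(spanned_mull (k%:A)); rewrite (linZ wl); case: wa => _ -> _.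
by rewrite -scalerAl mul1r.
Qed.

Lemma spanned0 : spanned 0.
Proof.
exists [ffun=> 0]; rewrite /form4 big1 // => k _.
by rewrite ffunE (lin0 wl) mul0r.
Qed.

Lemma spanned_sum (I : Type) (s : seq I) (P : pred I) (F : I -> W) :
  (forall i, spanned (F i)) -> spanned (\sum_(i <- s | P i) F i).
Proof. by move=> H; apply: big_ind => //; [exact: spanned0|exact: spanned_add]. Qed.

Lemma spanned_dt i j : spanned (dt (Tgen i j)).
Proof.
have [k <-] := gen4_surj i j; exists [ffun l => (l == k)%:R].
rewrite /form4 (bigD1 k) //= big1 => [|l lk].
  by rewrite ffunE eqxx addr0; case: wa => _ -> _; rewrite mul1r.
by rewrite ffunE (negPf lk) (lin0 wl) mul0r.
Qed.

(** The relations move each dt^i_j to the right of t^k_l and of D^-1, so the left span is a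
    bimodule; by the Leibniz rule it then contains all differentials. *)
Lemma spanned_mulr a w : spanned w -> spanned (w * omegaGL2 a).
Proof.
elim/(@genG_generated K q): a w => [g|k|x y Hx Hy|x y Hx Hy] w Hw.
- case: Hw => [c ->]; rewrite wE /form4 mulr_suml; apply: spanned_sum => k.
  rewrite -mulrA; apply: spanned_mull.
  have [i [j ->]] : exists i j, gen4 k = Tgen i j.
    by rewrite /gen4; case: (val k) => [|[|[|n]]]; do 2!eexists.
  case: g => [k' l|].
    rewrite (omega_dt_t (@genO_rel K q)).
    do 4!(apply: spanned_sum => ?); apply: spanned_scale.
    by rewrite -wE; apply: spanned_mull; exact: spanned_dt.
  rewrite (dt_Dinv q0 (@genO_rel K q)); apply: spanned_scale.
  by rewrite -wE; apply: spanned_mull; exact: spanned_dt.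
- rewrite (linZ wl); case: wa => _ -> _; rewrite -scalerAr mulr1.
  exact: spanned_scale.
- by rewrite (linD wl) mulrDr; apply: spanned_add; [exact: Hx|exact: Hy].
by rewrite wM mulrA; apply: Hy; exact: Hx.
Qed.

Lemma spanned_dif a : spanned (dif (omegaGL2 a)).
Proof.
have dl := @dif_linear K W.
elim/(@genG_generated K q): a => [g|k|x y Hx Hy|x y Hx Hy].
- rewrite wE; case: g => [i j|]; first exact: spanned_dt.
  rewrite (dif_Dinv (@genO_deg K q) (@genO_rel K q)) -scaleN1r; apply: spanned_scale.
  rewrite -(wE Dinv). apply: spanned_mulr; apply: spanned_mull.
  rewrite (dif_hdet _ (@genO_deg K q)).
  have H i j k l : spanned (dt (Tgen i j) * genO q (Tgen k l)).
    by rewrite -(wE (Tgen k l)); apply: spanned_mulr; exact: spanned_dt.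
  have H' i j k l : spanned (genO q (Tgen k l) * dt (Tgen i j)).
    by rewrite -(wE (Tgen k l)); apply: spanned_mull; exact: spanned_dt.
  rewrite -scaleN1r; apply: spanned_add; first by apply: spanned_add.
  by do 2!apply: spanned_scale; apply: spanned_add.
- rewrite (linZ wl) (linZ dl); case: wa => _ -> _; rewrite dif_one scaler0.
  exact: spanned0.
- by rewrite (linD wl) (linD dl); apply: spanned_add.
rewrite wM dif_mul; apply: spanned_add; first exact: spanned_mulr.
rewrite -(sgn_map wl (@omegaGL2_graded K q)); exact: spanned_mull.
Qed.

Lemma OmegaGL2_dim : calculus_dim (@omegaGL2 K q) 4.
Proof.
exists (fun k => dt (gen4 k)); split=> [k|w].
  by apply: dif_homog; exact: genO_deg.
have [_ _ _ H1 _] := @OmegaGL2_exterior K q.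
move=> /H1 [s ->]; have [c E] : spanned (\sum_(p <- s) omegaGL2 p.1 * dif (omegaGL2 p.2)).
  by apply: spanned_sum => p; apply: spanned_mull; exact: spanned_dif.
exists c; split=> // c' E'; apply: (form4_inj q0).
by rewrite -E E'.
Qed.

End Span.

(** * The coaction on the quantum plane and the determinant *)

(* The letters are x_1, x_2, dx_1, dx_2. *)
Definition plane_table : seq (nat * nat * qexp) :=
  [:: (1, 0, QScale (SPow 1) (QMul (QGen 0) (QGen 1)));
      (2, 0, QScale (SPow 2) (QMul (QGen 0) (QGen 2)));
      (3, 1, QScale (SPow 2) (QMul (QGen 1) (QGen 3)));
      (2, 1, QScale (SPow 1) (QMul (QGen 1) (QGen 2)));
      (3, 0, QAdd (QScale (SPow 1) (QMul (QGen 0) (QGen 3)))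
         (QScale (SAdd (SPow 2) (SOpp SOne)) (QMul (QGen 1) (QGen 2))));
      (2, 2, QZero);
      (3, 3, QZero);
      (3, 2, QScale (SOpp (SPow (-1))) (QMul (QGen 2) (QGen 3)))].

Section Coaction.
Variables (K : fieldType) (q : K).
Hypothesis q0 : q != 0.

Definition plane_coact (P A : gralgType K) (x : 'I_2 -> P) (h : gl2_gen -> A) (i : 'I_2) :
    tens P A :=
  \sum_j x j ⊗ h (Tgen j i).

Section Algebra.
Variables (P A : gralgType K) (x : 'I_2 -> P) (h : gl2_gen -> A).
Hypothesis xdeg : forall i, gr 0 (x i) = x i.
Hypothesis xrel : forall s t, plane_rel q s t -> eval x s = eval x t.
Hypothesis hdeg : forall g, gr 0 (h g) = h g.
Hypothesis hrel : forall s t, gl2_rel q s t -> eval h s = eval h t.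

Lemma plane_hrel : x i2 * x i1 = q *: (x i1 * x i2).
Proof. by have := xrel (plane_xx q); rewrite /= -scalerAl mul1r. Qed.

Lemma plane_letters_deg y :
  gr ((fun=> 0%N) y) (nth 0 [:: x i1; x i2] y) = nth 0 [:: x i1; x i2] y.
Proof. by do 2![case: y => [|y] /=; first exact: xdeg]; rewrite nth_nil gr_0. Qed.

(** The first entry of [plane_table] is the only one without forms. *)
Lemma plane_rules_ok :
  rules_ok q (nth 0 [:: x i1; x i2]) (qlookup (take 1 plane_table)).
Proof. by apply: table_rules_ok; rewrite /= plane_hrel. Qed.

Lemma plane_coact_deg i : gr 0 (plane_coact x h i) = plane_coact x h i.
Proof.
rewrite gr_sum; apply: eq_bigr => j _.
by rewrite -[0%N]/(0 + 0)%N tens_pure_homog.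
Qed.

Lemma plane_coact_rel s t : plane_rel q s t ->
  eval (plane_coact x h) s = eval (plane_coact x h) t.
Proof.
case; rewrite /= /plane_coact !sum_ord2.
nc_tens q0 plane_letters_deg (gl2_letters_deg q hdeg) plane_rules_ok (gl2_rules_ok q0 hrel)
  [:: x i1; x i2] (gl2_letters q h).
Qed.

Lemma tmap_plane_coact (P' A' : gralgType K) (f : P -> P') (g : A -> A') i :
  linear f -> linear g ->
  tmap f g (plane_coact x h i) = plane_coact (fun i => f (x i)) (fun a => g (h a)) i.
Proof.
by move=> fl gl; rewrite /plane_coact !sum_ord2 (linD (tmap_linear fl gl)) !tmap_pure.
Qed.

Lemma plane_comodule (Delta : A -> tens A A) (eps : A -> K^o) (delta : P -> tens P A) :
  generated_by x -> generated_by h ->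
  alg_map Delta -> alg_map eps -> alg_map delta -> graded_map eps ->
  (forall g, Delta (h g) = gl2_delta h g) ->
  (forall g, eps (h g) = gl2_char K g) ->
  (forall i, delta (x i) = plane_coact x h i) ->
  comodule_algebra Delta delta.
Proof.
move=> xgen hgen Da ea da egr DE eE dE.
have Dgr : graded_map Delta.
  apply: (graded_map_gen hgen Da hdeg) => g; rewrite DE; exact: gl2_delta_deg.
have dgr : graded_map delta.
  apply: (graded_map_gen xgen da xdeg) => i; rewrite dE; exact: plane_coact_deg.
have idlA : linear (id : A -> A) by []; have idlP : linear (id : P -> P) by [].
have [[Dl _ _] [dl _ _]] := (Da, da).
split=> //.
  apply: (coassoc_gen Da Dgr xgen da dgr) => i; rewrite dE.
  have tl := @tassoc_linear K P A A.
  have dil := tmap_linear dl idlA; have iDl := tmap_linear idlP Dl.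
  rewrite /plane_coact !sum_ord2 (linD dil) (linD iDl) !tmap_pure // !DE !dE.
  rewrite /plane_coact /= !sum_ord2 !tpureDl !(linD tl) !tassoc_pure !tpureDr.
  by rewrite addrACA.
exists eps; split.
  split=> //; apply: (alg_map_eq hgen) => //.
  - by apply: alg_map_comp => //; exact: counitl_alg.
  - exact: gl2_counitl.
  - by apply: alg_map_comp => //; exact: counitr_alg.
  exact: gl2_counitr.
apply: (alg_map_eq xgen) => //.
  by apply: alg_map_comp => //; exact: counitr_alg.
move=> i; have bl := counitr_bilin P ea; have tl := tlift_linear bl.
rewrite dE /plane_coact sum_ord2 (linD tl) !(tlift_pure _ _ bl) !eE /=.
by elim/ord2_ind: i; rewrite /= scale0r scale1r ?addr0 ?add0r.
Qed.

End Algebra.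

Section Forms.
Hypothesis q2N1 : q ^+ 2 != -1.
Variables (P A : dgaType K) (x : 'I_2 -> P) (h : gl2_gen -> A).
Hypothesis xdeg : forall i, gr 0 (x i) = x i.
Hypothesis xrel : forall s t, plane_omega_rel q s t ->
  eval (dgen x) s = eval (dgen x) t.
Hypothesis hdeg : forall g, gr 0 (h g) = h g.
Hypothesis hrel : forall s t, gl2_omega_rel q s t ->
  eval (dgen h) s = eval (dgen h) t.

Lemma plane_omega_hrel s t : plane_rel q s t -> eval x s = eval x t.
Proof. by move=> /(plane_omega_alg (q := q))/xrel; rewrite !eval_inl. Qed.

Definition plane_letters : seq P := [:: x i1; x i2; dif (x i1); dif (x i2)].

Definition plane_deg (y : nat) : nat := (1 < y)%N.

Lemma plane_omega_deg y :
  gr (plane_deg y) (nth 0 plane_letters y) = nth 0 plane_letters y.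
Proof.
do 2![case: y => [|y] /=; first exact: xdeg].
by do 2![case: y => [|y] /=; first exact: dif_homog]; rewrite nth_nil gr_0.
Qed.

Lemma plane_omega_ok : rules_ok q (nth 0 plane_letters) (qlookup plane_table).
Proof.
apply: table_rules_ok; rewrite /= (plane_hrel plane_omega_hrel).
have := xrel (plane_omega_dx_x q i1); have := xrel (plane_omega_dx_x q i2).
have := xrel (plane_omega_dx1_x2 q); have := xrel (plane_omega_dx2_x1 q).
have := xrel (plane_omega_dx_dx q i1); have := xrel (plane_omega_dx_dx q i2).
have := xrel (plane_omega_dx2_dx1 q).
rewrite /= -!scalerAl !mul1r !scale0r scaleN1r => -> -> -> -> -> -> ->.
by rewrite -scaleNr.
Qed.

Lemma dif_plane_coact i : dif (plane_coact x h i) =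
  \sum_j (dif (x j) ⊗ h (Tgen j i) + x j ⊗ dif (h (Tgen j i))).
Proof.
rewrite (lin_sum (@dif_linear _ _)); apply: eq_bigr => k _.
by rewrite [LHS](tens_dif_homog _ (xdeg _)) scale1r.
Qed.

Lemma plane_coact_omega_rel s t : plane_omega_rel q s t ->
  eval (dgen (plane_coact x h)) s = eval (dgen (plane_coact x h)) t.
Proof.
have okP := plane_omega_ok; have okA := omega_rules_ok q0 hrel q2N1.
have dP := plane_omega_deg; have dA := omega_letters_deg q hdeg.
case=> [{}s {}t /(plane_coact_rel xdeg plane_omega_hrel hdeg (omega_hrel hrel))|i|||i|];
  rewrite ?eval_inl //= ?dif_plane_coact /plane_coact ?sum_ord2; try elim/ord2_ind: i.
all: nc_tens q0 dP dA okP okA plane_letters (omega_letters q h).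
Qed.

End Forms.
End Coaction.

Section Determinant.
Variables (K : fieldType) (q : K).
Hypothesis q0 : q != 0.
Hypothesis q2N1 : q ^+ 2 != -1.
Variables (B : dgaType K) (h : gl2_gen -> B).
Hypothesis hdeg : forall g, gr 0 (h g) = h g.
Hypothesis hrel : forall s t, gl2_omega_rel q s t ->
  eval (dgen h) s = eval (dgen h) t.

Lemma dif_hdet_hdet :
  dif (hdet q h) * hdet q h = q ^+ 2 *: (hdet q h * dif (hdet q h)).
Proof. by rewrite dif_hdet //; nc_ring q0 (omega_rules_ok q0 hrel q2N1) (omega_letters q h). Qed.

Lemma dif_hdet_sq : dif (hdet q h) * dif (hdet q h) = 0.
Proof. by rewrite dif_hdet //; nc_ring q0 (omega_rules_ok q0 hrel q2N1) (omega_letters q h). Qed.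

End Determinant.

Section Concrete.
Variables (K : fieldType) (q : K).
Hypothesis q0 : q != 0.
Hypothesis q2N1 : q ^+ 2 != -1.

Definition genP (i : 'I_2) : plane q := palg_gen _ i.
Definition genOP (i : 'I_2) : OmegaPlane q := pdga_gen _ i.

Lemma genP_generated : generated_by genP.
Proof. exact: palg_generated. Qed.

Lemma genP_rel s t : plane_rel q s t -> eval genP s = eval genP t.
Proof. exact: palg_rel. Qed.

Lemma genOP_rel s t : plane_omega_rel q s t ->
  eval (dgen genOP) s = eval (dgen genOP) t.
Proof. exact: pdga_rel. Qed.

Lemma genOP_deg i : gr 0 (genOP i) = genOP i.
Proof. exact: pdga_gen_deg. Qed.

Let genP_deg i : gr 0 (genP i) = genP i. Proof. by []. Qed.
Let genG_deg g : gr 0 (genG q g) = genG q g. Proof. by []. Qed.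

Definition liftPlane (B : algType K) (h : 'I_2 -> B) : plane q -> B := palg_lift h.

Lemma liftPlaneP (B : algType K) (h : 'I_2 -> B) :
    (forall s t, plane_rel q s t -> eval h s = eval h t) ->
  alg_map (liftPlane h) /\ forall i, liftPlane h (genP i) = h i.
Proof. exact: palg_liftP. Qed.

Definition liftOmegaPlane (B : dgaType K) (h : 'I_2 -> B) : OmegaPlane q -> B := pdga_lift h.

Lemma liftOmegaPlaneP (B : dgaType K) (h : 'I_2 -> B) :
    (forall i, gr 0 (h i) = h i) ->
    (forall s t, plane_omega_rel q s t -> eval (dgen h) s = eval (dgen h) t) ->
  dga_map (liftOmegaPlane h) /\ forall i, liftOmegaPlane h (genOP i) = h i.
Proof. exact: pdga_liftP. Qed.

Lemma omegaPlaneP : alg_map (@omegaPlane K q) /\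
  forall i, omegaPlane (genP i) = genOP i.
Proof. exact: (liftPlaneP (plane_omega_hrel genOP_rel)). Qed.

Lemma omegaPlane_graded : graded_map (@omegaPlane K q).
Proof.
have [wa wE] := omegaPlaneP; apply: (graded_map_gen genP_generated wa genP_deg) => i.
by rewrite wE; exact: genOP_deg.
Qed.

Lemma DeltaRP : alg_map (@DeltaR K q) /\
  forall i, DeltaR (genP i) = plane_coact genP (genG q) i.
Proof.
apply: (@liftPlaneP _ (plane_coact genP (genG q))).
exact: (plane_coact_rel q0 genP_deg genP_rel genG_deg (@genG_rel K q)).
Qed.

Lemma OmegaGL2_coaction : coaction_condition (@omegaGL2 K q).
Proof.
have [Ra RE] := DeltaRP; have [Da DE] := DeltaGL2P q0.
have [ea eE] := liftGP (@gl2_char_rel K q).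
split.
  apply: (plane_comodule genP_deg genG_deg genP_generated (@genG_generated K q) Da ea Ra
    _ DE eE RE).
  exact: (graded_map_gen (@genG_generated K q) ea genG_deg).
have [fd fE] := liftOmegaPlaneP (plane_coact_deg genOP_deg (@genO_deg K q))
  (plane_coact_omega_rel q0 q2N1 genOP_deg genOP_rel (@genO_deg K q) (@genO_rel K q)).
exists (liftOmegaPlane (plane_coact genOP (genO q))); split=> //.
have [fa _ _] := fd; have [wa wE] := @omegaGL2P K q; have [pa pE] := omegaPlaneP.
apply: (alg_map_eq genP_generated).
- exact: alg_map_comp.
- apply: alg_map_comp => //; apply: tmap_alg => //; first exact: omegaPlane_graded.
  exact: omegaGL2_graded.
move=> i; rewrite pE fE RE tmap_plane_coact; [|by case: pa|by case: wa].
by congr plane_coact; apply/funext => z; rewrite ?pE ?wE.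
Qed.

Definition genD (b : bool) : GL1 K := palg_gen _ b.

Lemma genD_generated : generated_by genD.
Proof. exact: palg_generated. Qed.

Definition genOD (b : bool) : OmegaGL1 q := pdga_gen _ b.

Definition liftD (B : algType K) (h : bool -> B) : GL1 K -> B := palg_lift h.

Lemma liftDP (B : algType K) (h : bool -> B) :
    (forall s t, gl1_rel s t -> eval h s = eval h t) ->
  alg_map (liftD h) /\ forall b, liftD h (genD b) = h b.
Proof. exact: palg_liftP. Qed.

Definition liftOD (B : dgaType K) (h : bool -> B) : OmegaGL1 q -> B := pdga_lift h.

Lemma liftODP (B : dgaType K) (h : bool -> B) :
    (forall b, gr 0 (h b) = h b) ->
    (forall s t, gl1_omega_rel q s t -> eval (dgen h) s = eval (dgen h) t) ->
  dga_map (liftOD h) /\ forall b, liftOD h (genOD b) = h b.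
Proof. exact: pdga_liftP. Qed.

Lemma omegaGL1P : alg_map (@omegaGL1 K q) /\
  forall b, omegaGL1 q (genD b) = genOD b.
Proof.
apply: liftDP => s t st.
have : eval (dgen genOD) (term_inl s) = eval (dgen genOD) (term_inl t).
  by apply: pdga_rel; exact: gl1_omega_alg.
by rewrite !eval_inl.
Qed.

Lemma OmegaGL2_det : det_condition (@omegaGL2 K q).
Proof.
have [wa wE] := @omegaGL2P K q.
have wdet : omegaGL2 (qdet q) = hdet q (genO q).
  case: (wa) => wl _ wM.
  by rewrite /qdet (linD wl) (linN wl) (linZ wl) !wM !wE.
have [_ [_ DD' D'D]] := gl2_hrel (@genG_rel K q).
have [_ [_ OD' O'D]] := gl2_hrel (@genO_alg_rel K q).
have [da dE] : alg_map (@det_incl K q) /\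
    forall b, det_incl q (genD b) = if b then qdet q else DinvG q.
  by apply: liftDP => s t [] /=; rewrite scale1r.
split=> //.
pose h b := if b then hdet q (genO q) else genO q Dinv.
have [gd gE] : dga_map (liftOD h) /\
    forall b, liftOD h (genOD b) = h b.
  apply: liftODP => [[]|s t []] /=.
  - exact: (omega_letters_deg q (@genO_deg K q) 0).
  - exact: genO_deg.
  - by move=> {}s {}t []; rewrite /= scale1r.
  - by rewrite -scalerAl mul1r; exact: (dif_hdet_hdet q0 q2N1 (@genO_deg K q) (@genO_rel K q)).
  by rewrite scale0r; exact: (dif_hdet_sq q0 q2N1 (@genO_deg K q) (@genO_rel K q)).
exists (liftOD h); split=> //.
have [ga _ _] := gd; have [oa oE] := omegaGL1P.
apply: (alg_map_eq genD_generated); [exact: alg_map_comp|exact: alg_map_comp|].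
by move=> b; rewrite oE gE dE; case: b; rewrite /h ?wdet -?wE.
Qed.

End Concrete.

(** * Universality *)

(* The letter 8 is theta. *)
Definition theta_table : seq (nat * nat * qexp) :=
  gl2_pre_table ++ dt_table (QGen 8) ++
  [seq (8, x, QScale (SPow 2) (QMul (QGen x) (QGen 8))) | x <- [:: 0; 1; 2; 3]].

Section Universality.
Variables (K : fieldType) (q : K).
Hypotheses (q0 : q != 0) (q2N1 : q ^+ 2 != -1).
Variables (W : dgaType K) (h : gl2_gen -> W).
Hypothesis hdeg : forall g, gr 0 (h g) = h g.
Hypothesis hrel : forall s t, gl2_rel q s t -> eval h s = eval h t.

Let a := h (Tgen i1 i1).
Let b := h (Tgen i1 i2).
Let c := h (Tgen i2 i1).
Let d := h (Tgen i2 i2).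
Let da := dif a.
Let db := dif b.
Let dc := dif c.
Let dd := dif d.

(* The 12 relations given by the coaction: those of the plane with x_i         *)
(* replaced by the column t^1_i, t^2_i, contracted with the coefficients of    *)
(* x_1^2, x_2^2 and x_1 x_2.                                                   *)
Hypothesis coact11 : [/\ da * a = q ^+ 2 *: (a * da), db * b = q ^+ 2 *: (b * db),
  da * b = q *: (b * da) & db * a = q *: (a * db) + (q ^+ 2 - 1) *: (b * da)].
Hypothesis coact22 : [/\ dc * c = q ^+ 2 *: (c * dc), dd * d = q ^+ 2 *: (d * dd),
  dc * d = q *: (d * dc) & dd * c = q *: (c * dd) + (q ^+ 2 - 1) *: (d * dc)].
Hypothesis coact12 :
  [/\ da * c + q *: (dc * a) = q ^+ 2 *: (a * dc + q *: (c * da)),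
      db * d + q *: (dd * b) = q ^+ 2 *: (b * dd + q *: (d * db)),
      da * d + q *: (dc * b) = q *: (b * dc + q *: (d * da))
    & db * c + q *: (dd * a) = q *: (a * dd + q *: (c * db))
        + (q ^+ 2 - 1) *: (b * dc + q *: (d * da))].

Let dl := @dif_linear K W.

Let hM g g' : dif (h g * h g') = dif (h g) * h g' + h g * dif (h g').
Proof. by rewrite dif_mul (sgn_homog (hdeg _)) scale1r. Qed.

Lemma dif_gl2_rel : [/\ dc * a + c * da = q *: (da * c + a * dc),
  dd * b + d * db = q *: (db * d + b * dd), dc * b + c * db = db * c + b * dc
  & dd * a + d * da = da * d + a * dd + (q - q^-1) *: (db * c + b * dc)].
Proof.
have [[_ ca bd _ cb] [ad _ _]] := gl2_hrel hrel.
split; [have := congr1 dif ca|have := congr1 dif bd|have := congr1 dif cb|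
  have := congr1 dif ad]; by rewrite ?(linD dl) ?(linZ dl) !hM.
Qed.

Let cancel_q2 (x y : W) : (1 + q ^+ 2) *: x = (1 + q ^+ 2) *: y -> x = y.
Proof.
have nz : 1 + q ^+ 2 != 0 by rewrite addrC addr_eq0.
by move=> E; rewrite -[x]scale1r -[y]scale1r -(mulVf nz) -!scalerA E.
Qed.

(** The first equation comes from the coaction and the second from differentiating ca = q ac or db =
    q bd. Eliminating v gives (1 + q^2) u = (1 + q^2) q y. *)
Lemma cancel_pair (u v x y : W) :
  u + q *: v = q ^+ 2 *: (x + q *: y) -> v + y = q *: (u + x) ->
  u = q *: y /\ v = q *: x + (q ^+ 2 - 1) *: y.
Proof.
move=> E1 E2; have ok0 : rules_ok q (nth 0 [:: u; v; x; y]) (fun _ _ => None) by [].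
split; apply: cancel_q2.
  transitivity ((u + q *: v) - q *: (v + y - q *: u) + q *: y).
    by nc_ring q0 ok0 [:: u; v; x; y].
  by rewrite E1 E2; nc_ring q0 ok0 [:: u; v; x; y].
transitivity (q *: (u + q *: v) + (v + y - q *: u) - y).
  by nc_ring q0 ok0 [:: u; v; x; y].
by rewrite E1 E2; nc_ring q0 ok0 [:: u; v; x; y].
Qed.

(** In [OmegaGL2] the relation for this product reads (da) d = d (da), so theta has to vanish. *)
Definition theta : W :=
  dif (h (Tgen i1 i1)) * h (Tgen i2 i2) - h (Tgen i2 i2) * dif (h (Tgen i1 i1)).

Let letters : seq W := [:: a; b; c; d; da; db; dc; dd; theta].

(** Twelve of the products are determined by the equations. The other four, (da) d, (dc) b, (db) c
    and (dd) a, are solved for in terms of theta, with coefficients 1, -q^-1, -q^-1 and q^-2, which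
    are the products of two entries of the q-antisymmetric tensor. *)
Lemma dt_t_theta i j k l : dif (h (Tgen i j)) * h (Tgen k l)
  = (seval q (epsscal i k) * seval q (epsscal j l)) *: theta +
    \sum_p \sum_r \sum_n \sum_m (Rmat q k p i r * Rmat q m j n l) *:
      (h (Tgen p n) * dif (h (Tgen r m))).
Proof.
have [aa bb ab ba] := coact11; have [cc dd' cd dc'] := coact22.
have [E1 E2 E3 E4] := coact12; have [F1 F2 F3 F4] := dif_gl2_rel.
have [Eac Eca] := cancel_pair E1 F1; have [Ebd Edb] := cancel_pair E2 F2.
have ok0 : rules_ok q (nth 0 letters) (fun _ _ => None) by [].
have Ead : da * d = d * da + theta by rewrite /theta addrC subrK.
have Ecb : dc * b = b * dc + (q - q^-1) *: (d * da) - q^-1 *: theta.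
  transitivity (q^-1 *: (da * d + q *: (dc * b)) - q^-1 *: (da * d)).
    by rewrite scalerDr addrAC subrr add0r scalerA mulVf // scale1r.
  by rewrite E3 Ead; nc_ring q0 ok0 letters.
have Ebc : db * c = c * db + (q - q^-1) *: (d * da) - q^-1 *: theta.
  transitivity (db * c + b * dc - b * dc); first by rewrite addrK.
  by rewrite -F3 Ecb; nc_ring q0 ok0 letters.
have Eda : dd * a = a * dd + (q - q^-1) *: (c * db) + (q - q^-1) *: (b * dc)
    + ((q - q^-1) * (q - q^-1)) *: (d * da) + q ^ (-2) *: theta.
  transitivity (dd * a + d * da - d * da); first by rewrite addrK.
  by rewrite F4 Ead Ebc; nc_ring q0 ok0 letters.
rewrite !sum_ord2 !Rmat_scal.
elim/ord2_ind: i; elim/ord2_ind: j; elim/ord2_ind: k; elim/ord2_ind: l.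
all: rewrite -/a -/b -/c -/d -/da -/db -/dc -/dd.
all: first [rewrite [LHS]aa | rewrite [LHS]bb | rewrite [LHS]ab | rewrite [LHS]ba
  | rewrite [LHS]cc | rewrite [LHS]dd' | rewrite [LHS]cd | rewrite [LHS]dc'
  | rewrite [LHS]Eac | rewrite [LHS]Eca | rewrite [LHS]Ebd | rewrite [LHS]Edb
  | rewrite [LHS]Ead | rewrite [LHS]Ecb | rewrite [LHS]Ebc | rewrite [LHS]Eda].
all: nc_ring q0 ok0 letters.
Qed.

Lemma theta_pre_ok :
  rules_ok q (nth 0 letters) (qlookup (gl2_pre_table ++ dt_table (QGen 8))).
Proof.
have [[ba ca bd cd cb] [ad _ _]] := gl2_hrel hrel.
apply: table_rules_ok; rewrite /= -/a -/b -/c -/d ba ca !scalerA mulVf // !scale1r.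
by do ![split=> //]; rewrite /da /db /dc /dd dt_t_theta !sum_ord2.
Qed.

(* Compare the two ways of reducing the overlaps dt t t. *)
Lemma theta_t i j : theta * h (Tgen i j) = q ^+ 2 *: (h (Tgen i j) * theta).
Proof.
have [[ba ca bd cd cb] [ad _ _]] := gl2_hrel hrel.
apply/eqP; rewrite -subr_eq0; apply/eqP.
elim/ord2_ind: i; elim/ord2_ind: j; rewrite -?/a -?/b -?/c -?/d.
(* This is da times the relation for d a - a d, hence 0 by associativity. With the brackets to the
   left, the rules first move da past the inner factor, which leaves theta a - q^2 a theta. *)
- transitivity ((da * d) * a - (da * a) * d - (q - q^-1) *: ((da * b) * c)).
    by nc_ring q0 theta_pre_ok letters.
  by rewrite -!mulrA ad mulrDr -scalerAr [X in X - _]addrAC subrr add0r subrr.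
- transitivity ((da * d) * b - q *: ((da * b) * d)).
    by nc_ring q0 theta_pre_ok letters.
  by rewrite -!mulrA bd -scalerAr subrr.
- transitivity ((da * d) * c - q *: ((da * c) * d)).
    by nc_ring q0 theta_pre_ok letters.
  by rewrite -!mulrA cd -scalerAr subrr.
(* Here db is used because (db) c contains -q^-1 theta, which the remaining factor d turns into the
   required theta d. *)
transitivity ((db * d) * c - q *: ((db * c) * d)).
  by nc_ring q0 theta_pre_ok letters.
by rewrite -!mulrA cd -scalerAr subrr.
Qed.

Lemma theta_ok : rules_ok q (nth 0 letters) (qlookup theta_table).
Proof.
have [[ba ca bd cd cb] [ad _ _]] := gl2_hrel hrel.
apply: table_rules_ok; rewrite /= -/a -/b -/c -/d ba ca !scalerA mulVf // !scale1r.
rewrite !theta_t.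
by do ![split=> //]; rewrite /da /db /dc /dd dt_t_theta !sum_ord2.
Qed.

Hypothesis det : dif (hdet q h) * hdet q h = q ^+ 2 *: (hdet q h * dif (hdet q h)).

Lemma theta0 : theta = 0.
Proof.
have [_ [_ _ D'D]] := gl2_hrel hrel.
have E : dif (hdet q h) * hdet q h - q ^+ 2 *: (hdet q h * dif (hdet q h))
    = (q ^+ 2 * (1 + q ^+ 2)) *: (hdet q h * theta).
  rewrite dif_hdet // /hdet -/a -/b -/c -/d -/da -/db -/dc -/dd.
  nc_ring q0 theta_ok letters.
move: E; rewrite det subrr => /esym/eqP.
rewrite scaler_eq0 mulf_eq0 expf_eq0 /= (negPf q0) addrC addr_eq0 (negPf q2N1) /=.
by move=> /eqP E; rewrite -[LHS]mul1r -D'D -mulrA E mulr0.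
Qed.

Lemma universal_omega_rel s t : gl2_omega_rel q s t ->
  eval (dgen h) s = eval (dgen h) t.
Proof.
apply: omega_relI => // i j k l.
by rewrite dt_t_theta theta0 scaler0 add0r.
Qed.

End Universality.

(* The quantum plane acts by a diagonal and a shift matrix; x_1^2, x_1 x_2 and *)
(* x_2^2 are supported on different diagonals.                                 *)
Section PlaneModel.
Variables (K : fieldType) (q : K).

Definition mxM3 : algType K := 'M[K]_3.

Definition plane_mx (i : 'I_2) : deg0 mxM3 :=
  if i == i1 then diag_mx (\row_j q ^+ j) : 'M[K]_3
  else \matrix_(i, j) (j == i.+1 :> nat)%:R : 'M[K]_3.

Lemma plane_mx_rel s t : plane_rel q s t -> eval plane_mx s = eval plane_mx t.
Proof.
case; rewrite /= -scalerAl mul1r.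
apply: (_ : (_ *m _ = q *: (_ *m _) :> 'M[K]_3)); apply/matrixP => i j.
rewrite mul_mx_diag mul_diag_mx !mxE.
by case: eqP => [->|_]; rewrite ?mulr0 ?mul0r // !mulr1 mul1r exprS.
Qed.

Lemma plane_mx_omega_rel s t : plane_omega_rel q s t ->
  eval (dgen plane_mx) s = eval (dgen plane_mx) t.
Proof.
case=> [{}s {}t /plane_mx_rel|i|||i|] /=; rewrite ?eval_inl //;
  by rewrite !deg0_difE ?(mulr0, mul0r, scale0r, addr0).
Qed.

(** In row 0 the diagonal matrix has the entry q^0 = 1, so x_1^2, x_1 x_2 and x_2^2 have the entry 1
    in columns 0, 1 and 2 and no other entry there. This row thus acts as a dual basis; size 3 keeps
    x_2^2 from vanishing. *)
Definition plane_coef (r : 'I_3) (j l : 'I_2) : K :=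
  ((plane_mx j : 'M[K]_3) *m (plane_mx l : 'M[K]_3)) ord0 r.

Lemma plane_coefE r : 
  [/\ plane_coef r i1 i1 = (r == 0 :> nat)%:R, plane_coef r i1 i2 = (r == 1 :> nat)%:R,
      plane_coef r i2 i1 = (r == 1 :> nat)%:R * q
    & plane_coef r i2 i2 = (r == 2 :> nat)%:R].
Proof.
rewrite /plane_coef /plane_mx /=.
by case: r => -[|[|[|//]]] lt; rewrite mul_mx_diag !mul_diag_mx !mxE !big_ord_recl !big_ord0
  !mxE /= ?(mul0r, mulr0, mul1r, mulr1, addr0, add0r, expr0, expr1).
Qed.

End PlaneModel.

(** * The relations between dt and t forced by the coaction *)

Section Coefficients.
Variables (K : fieldType) (q : K).
Hypotheses (q0 : q != 0) (q2N1 : q ^+ 2 != -1).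
Variables (W : dgaType K) (h : gl2_gen -> W).
Hypothesis hdeg : forall g, gr 0 (h g) = h g.
Variable f : OmegaPlane q -> tens (OmegaPlane q) W.
Hypothesis fd : dga_map f.
Hypothesis fE : forall i, f (genOP q i) = plane_coact (genOP q) h i.

Let M := deg0 (mxM3 K).

(** The matrix model has d = 0. In the image of dx_i, the terms dx_j ⊗ t^j_i disappear and only x_j
    ⊗ dt^j_i remain, so each relation of the plane turns into relations between dt and t alone. *)
Definition model_coact (x : OmegaPlane q) : tens M W :=
  tmap (liftOmegaPlane (plane_mx q)) id (f x).

Lemma model_coactP : dga_map model_coact /\
  forall i, model_coact (genOP q i) = \sum_j plane_mx q j ⊗ h (Tgen j i).
Proof.
have [pd pE] := @liftOmegaPlaneP K q M (plane_mx q) (fun=> erefl) (@plane_mx_omega_rel K q).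
split.
  by apply: dga_map_comp => //; apply: tmap_dga => //; exact: dga_map_id.
move=> i; have [[pl _ _] _ _] := pd.
rewrite /model_coact fE tmap_plane_coact //.
by rewrite /plane_coact; apply: eq_bigr => j _; rewrite pE.
Qed.

Definition coef_map (r : 'I_3) : tens M W -> W :=
  tlift (fun (m : M) (w : W) => (m : 'M[K]_3) ord0 r *: w).

Lemma coef_map_bilin r : bilin (fun (m : M) (w : W) => (m : 'M[K]_3) ord0 r *: w).
Proof.
split=> [w|m] s x y; first by rewrite !mxE scalerDl scalerA.
by rewrite scalerDr !scalerA mulrC.
Qed.

Lemma coef_map_mul r (u v : 'I_2 -> W) :
  coef_map r ((\sum_j plane_mx q j ⊗ u j) * (\sum_j plane_mx q j ⊗ v j))
  = \sum_j \sum_l plane_coef q r j l *: (u j * v l).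
Proof.
have cl : linear (coef_map r) := tlift_linear (coef_map_bilin r).
rewrite mulr_suml (lin_sum cl); apply: eq_bigr => j _.
rewrite mulr_sumr (lin_sum cl); apply: eq_bigr => l _.
(* No Koszul sign arises, because the matrices have degree 0. *)
have E : (plane_mx q j ⊗ u j) * (plane_mx q l ⊗ v l)
    = (plane_mx q j * plane_mx q l) ⊗ (u j * v l) :> tens M W.
  elim/gr_ind: (u j) => [x y Hx Hy|n x hx].
    by rewrite tpureDr mulrDl Hx Hy mulrDl tpureDr.
  by rewrite [LHS](tens_mul_homog _ _ hx (erefl : gr 0 (plane_mx q l) = _)) muln0 scale1r.
by rewrite E /coef_map (tlift_pure _ _ (coef_map_bilin r)).
Qed.

Let t i j := h (Tgen j i).
Let dt i j := dif (h (Tgen j i)).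
Local Notation S r u v := (\sum_j \sum_l plane_coef q r j l *: (u j * v l)).

Lemma coact_coef r :
  [/\ forall i, S r (dt i) (t i) = q ^+ 2 *: S r (t i) (dt i),
      S r (dt i1) (t i2) = q *: S r (t i2) (dt i1)
    & S r (dt i2) (t i1) = q *: S r (t i1) (dt i2) + (q ^+ 2 - 1) *: S r (t i2) (dt i1)].
Proof.
have [[ga ggr gd] gE] := model_coactP; have [gl g1 gM] := ga.
have cl : linear (coef_map r) := tlift_linear (coef_map_bilin r).
have gdE i : model_coact (dif (genOP q i)) = \sum_j plane_mx q j ⊗ dt i j.
  rewrite gd gE (lin_sum (@dif_linear _ _)); apply: eq_bigr => j _.
  rewrite [LHS](tens_dif_homog _ (erefl : gr 0 (plane_mx q j) = _)).
  by rewrite deg0_difE tpure0l add0r scale1r.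
have P i k : coef_map r (model_coact (dif (genOP q i) * genOP q k)) = S r (dt i) (t k).
  by rewrite gM gdE gE coef_map_mul.
have P' i k : coef_map r (model_coact (genOP q i * dif (genOP q k))) = S r (t i) (dt k).
  by rewrite gM gdE gE coef_map_mul.
have rel := @genOP_rel K q.
split=> [i||]; rewrite -!P -!P'.
- have /= := rel _ _ (plane_omega_dx_x q i); rewrite -scalerAl mul1r => ->.
  by rewrite (linZ gl) (linZ cl).
- have /= := rel _ _ (plane_omega_dx1_x2 q); rewrite -scalerAl mul1r => ->.
  by rewrite (linZ gl) (linZ cl).
have /= := rel _ _ (plane_omega_dx2_x1 q); rewrite -!scalerAl !mul1r => ->.
by rewrite (linD gl) (linD cl) !(linZ gl) !(linZ cl).
Qed.

Lemma coef_sums (u v : 'I_2 -> W) :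
  [/\ S ord0 u v = u i1 * v i1,
      S (Ordinal (isT : (1 < 3)%N)) u v = u i1 * v i2 + q *: (u i2 * v i1)
    & S ord_max u v = u i2 * v i2].
Proof.
rewrite !sum_ord2; split.
- have [-> -> -> ->] := plane_coefE q ord0; rewrite /= mul0r.
  by rewrite !scale0r scale1r !addr0.
- have [-> -> -> ->] := plane_coefE q (Ordinal (isT : (1 < 3)%N)); rewrite /= mul1r.
  by rewrite !scale0r scale1r add0r addr0.
have [-> -> -> ->] := plane_coefE q ord_max; rewrite /= mul0r.
by rewrite !scale0r scale1r !add0r.
Qed.

Hypothesis hrel : forall s t, gl2_rel q s t -> eval h s = eval h t.
Hypothesis det : dif (hdet q h) * hdet q h = q ^+ 2 *: (hdet q h * dif (hdet q h)).

Lemma coaction_omega_rel s s' : gl2_omega_rel q s s' ->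
  eval (dgen h) s = eval (dgen h) s'.
Proof.
have S0 u v := let: And3 E _ _ := coef_sums u v in E.
have S1 u v := let: And3 _ E _ := coef_sums u v in E.
have S2 u v := let: And3 _ _ E := coef_sums u v in E.
apply: (universal_omega_rel q0 q2N1 hdeg hrel _ _ _ det).
- have [E E12 E21] := coact_coef ord0; move: E12 E21 (E i1) (E i2).
  by rewrite !S0.
- have [E E12 E21] := coact_coef ord_max; move: E12 E21 (E i1) (E i2).
  by rewrite !S2.
have [E E12 E21] := coact_coef (Ordinal (isT : (1 < 3)%N)); move: E12 E21 (E i1) (E i2).
by rewrite !S1.
Qed.

End Coefficients.

(** * The universal property *)

Lemma OmegaGL2_universal (K : fieldType) (q : K) (W : dgaType K) (i : GL2 q -> W) :
  q != 0 -> q ^+ 2 != -1 -> exterior_algebra i ->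
  coaction_condition i -> det_condition i ->
  exists f : OmegaGL2 q -> W,
    [/\ dga_map f, forall a, f (omegaGL2 a) = i a & forall w, exists x, f x = w].
Proof.
move=> q0 q2N1 [ia _ i0 ig1 igen] [_ [f [fd fE]]] [_ [g [gd gE]]].
have il : linear i by case: ia.
pose h x := i (genG q x).
have hdeg x : gr 0 (h x) = h x by apply/i0; exists (genG q x).
have hrel s t : gl2_rel q s t -> eval h s = eval h t.
  by move=> /(@genG_rel K q) E; rewrite -!(eval_alg_map _ _ ia) E.
have fgen j : f (genOP q j) = plane_coact (genOP q) h j.
  have [pa pE] := @omegaPlaneP K q; have [_ RE] := DeltaRP q0.
  rewrite -pE fE RE tmap_plane_coact //; last by case: pa.
  by congr plane_coact; apply/funext => k; rewrite pE.
(* This is the image under g of the relation (dD) D = q^2 D dD of the calculus on [GL1]. *)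
have det : dif (hdet q h) * hdet q h = q ^+ 2 *: (hdet q h * dif (hdet q h)).
  have [_ oE] := @omegaGL1P K q; have [[gl _ gM] _ gdif] := gd.
  have gdet : g (genOD q true) = hdet q h.
    rewrite -oE gE; have [_ ->] : alg_map (@det_incl K q) /\
        forall b, det_incl q (genD K b) = if b then qdet q else DinvG q.
      apply: liftDP => s t [] /=; rewrite scale1r;
        by have [_ [_ DD' D'D]] := gl2_hrel (@genG_rel K q).
    by case: ia => _ _ iM; rewrite /qdet (linD il) (linN il) (linZ il) !iM.
  have /= := pdga_rel (DGAModel (fun=> erefl) (@gl1_char_omega_rel K q)) (gl1_omega_dD_D q).
  rewrite -scalerAl mul1r => /(congr1 g).
  by rewrite (linZ gl) !gM gdif [g _]gdet.
have [Fd FE] := liftOP hdeg (coaction_omega_rel q0 q2N1 hdeg fd fgen hrel det).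
have [Fa _ Fdif] := Fd; have [Fl F1 FM] := Fa; have [wa wE] := @omegaGL2P K q.
have Fi a : liftO h (omegaGL2 a) = i a.
  apply: (alg_map_eq (@genG_generated K q) (alg_map_comp Fa wa) ia) => x.
  by rewrite wE FE.
exists (liftO h); split=> //.
(* Surjectivity: W is generated in degrees 0 and 1, where preimages are explicit. *)
apply: igen => [w /i0 [a ->]|w /ig1 [s ->]|v w [x <-] [y <-]|v w [x <-] [y <-]].
- by exists (omegaGL2 a).
- exists (\sum_(p <- s) omegaGL2 p.1 * dif (omegaGL2 p.2)).
  by rewrite (lin_sum Fl); apply: eq_bigr => p _; rewrite FM Fdif !Fi.
- by exists (x + y); rewrite (linD Fl).
by exists (x * y); rewrite FM.
Qed.

Theorem proposition4p11 (R : realType) (q : R[i])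
    (q_neq0 : q != 0) (q2_neqN1 : q ^+ 2 != -1) :
  [/\ super_hopf (@DeltaGL2 _ q),
      exterior_algebra (@omegaGL2 _ q),
      calculus_dim (@omegaGL2 _ q) 4
    & strongly_bicovariant (@DeltaGL2 _ q) (@omegaGL2 _ q)] /\
  [/\ coaction_condition (@omegaGL2 _ q),
      det_condition (@omegaGL2 _ q)
    & forall (W : dgaType R[i]) (i : GL2 q -> W),
        exterior_algebra i ->
        strongly_bicovariant (@DeltaGL2 _ q) i ->
        coaction_condition i -> det_condition i ->
        exists f : OmegaGL2 q -> W,
          [/\ dga_map f, forall a, f (omegaGL2 a) = i a
            & forall w, exists x, f x = w]].
Proof.
split; split.
- exact: GL2_hopf.
- exact: OmegaGL2_exterior.
- exact: OmegaGL2_dim.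
- exact: OmegaGL2_bicovariant.
- exact: OmegaGL2_coaction.
- exact: OmegaGL2_det.
by move=> W i iext _; exact: OmegaGL2_universal.
Qed.
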